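(* Let $T>0$, $\xi\in\mathbb{R}^d$. Assume $b\colon\mathbb{R}^d\to\mathbb{R}^d$ is continuous and satisfies the following two conditions: there exists a constant $C_1$ such that $$\langle b(\eta)-b(\zeta),\eta-\zeta\rangle\le C_1|\eta-\zeta|^2\quad\text{for every }\eta,\zeta\in\mathbb{R}^d,$$ and there exists a constant $C_2$ such that $$\left|b(\eta)-b(\zeta)-\frac{\langle b(\eta)-b(\zeta),\eta-\zeta\rangle(\eta-\zeta)}{|\eta-\zeta|^2}\right|\le C_2|\eta-\zeta|\quad\text{for every }\eta,\zeta\in\mathbb{R}^d\text{ with }\eta-\zeta\ne0.$$ Let $X\colon[0,T]\to\mathbb{R}^d$ be a continuous Gaussian process starting at $0$ with corresponding Gaussian measure $\gamma$ on the Banach space $B=C_0([0,T];\mathbb{R}^d)$ of continuous functions starting at $0$ with the uniform norm, and let $$\sigma^2=\sup_{l\in B^*,\ \|l\|\le1}\int_B l(x)^2\,d\gamma(x).$$ Let $Y$ be the (pathwise) solution to $Y_t=\xi+\int_0^t b(Y_s)\,ds+X_t$, $t\in[0,T]$, and let $\mu$ be the law of $Y$ on $C_\xi$. Then for every Borel probability measure $\nu$ on $C_\xi$, $$\inf_{\pi\in\Pi(\nu,\mu)}\int_{C_\xi\times C_\xi}\|x-y\|_\infty^2\,d\pi(x,y)\;\le\;18\,\sigma^2e^{4T(C_1+C_2)}\,H(\nu\,|\,\mu).$$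
   Context: $C_\xi=C_\xi([0,T];\mathbb{R}^d)$ is the space of continuous paths $x\colon[0,T]\to\mathbb{R}^d$ with $x_0=\xi$, with the uniform topology; $\|\cdot\|_\infty$ is the supremum norm over $[0,T]$. $\Pi(\nu,\mu)$ is the set of probability measures on the product space with marginals $\nu$ and $\mu$. The relative entropy is $H(\nu\,|\,\mu)=\int\log\left(\frac{d\nu}{d\mu}\right)d\nu$ if $\nu\ll\mu$ and $+\infty$ otherwise.
   Formalization: Assumes C_1+C_2 ≥ 0 (for C_1+C_2 < 0 the bound fails, e.g. b(x) = -2x with Brownian X, T = 1) and H(ν|μ) < ∞ (otherwise the right side is +∞, or the undefined 0·∞ when σ² = 0). *)

(* Defs.v *)
From HB Require Import structures.
From mathcomp Require Import all_boot all_order all_algebra.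
From mathcomp Require Import all_classical all_reals all_analysis.

Set Implicit Arguments.
Unset Strict Implicit.
Unset Printing Implicit Defensive.
Import Order.TTheory GRing.Theory Num.Theory.
Import numFieldNormedType.Exports.
From mathcomp Require Import ring lra.
Local Open Scope classical_set_scope.
Local Open Scope ring_scope.

(* The library norm of 'rV[R]_d is the maximum norm (it induces the same
   topology), hence the Euclidean structure is introduced separately. *)
Section euclidean.
Context {R : realType} {d : nat}.
Implicit Types u v w : 'rV[R]_d.

Definition dotv u v : R := \sum_(i < d) u 0 i * v 0 i.

Definition enorm u : R := Num.sqrt (dotv u u).

Lemma dotvC u v : dotv u v = dotv v u.
Proof. by apply: eq_bigr => i _; rewrite mulrC. Qed.

Lemma dotvDl u v w : dotv (u + v) w = dotv u w + dotv v w.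
Proof.
by rewrite /dotv -big_split; apply: eq_bigr => i _; rewrite mxE mulrDl.
Qed.

Lemma dotvZl a u v : dotv (a *: u) v = a * dotv u v.
Proof. by rewrite /dotv mulr_sumr; apply: eq_bigr => i _; rewrite mxE mulrA. Qed.

Lemma dotvv_ge0 u : 0 <= dotv u u.
Proof. by apply: sumr_ge0 => i _; rewrite -expr2 sqr_ge0. Qed.

Lemma dotvv_eq0 u : dotv u u = 0 -> u = 0.
Proof.
move=> /eqP; rewrite psumr_eq0 => [/allP u0|i _]; last by rewrite -expr2 sqr_ge0.
apply/rowP => i; rewrite mxE; apply/eqP.
by have := u0 i (mem_index_enum i); rewrite mulf_eq0 orbb.
Qed.

Lemma enorm_ge0 u : 0 <= enorm u.
Proof. exact: sqrtr_ge0. Qed.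

Lemma sqr_enorm u : enorm u ^+ 2 = dotv u u.
Proof. by rewrite sqr_sqrtr ?dotvv_ge0. Qed.

Lemma enorm_eq0 u : enorm u = 0 -> u = 0.
Proof. by move=> u0; apply: dotvv_eq0; rewrite -sqr_enorm u0 expr0n. Qed.

Lemma enormZ a u : enorm (a *: u) = `|a| * enorm u.
Proof.
by rewrite /enorm dotvZl dotvC dotvZl mulrA -expr2 sqrtrM ?sqr_ge0// sqrtr_sqr.
Qed.

Lemma dotv_le u v : dotv u v <= enorm u * enorm v.
Proof.
have [u0|u0] := eqVneq (enorm u) 0.
  by rewrite u0 (enorm_eq0 u0) -(scale0r v) dotvZl !mul0r.
have [v0|v0] := eqVneq (enorm v) 0.
  by rewrite v0 (enorm_eq0 v0) dotvC -(scale0r u) dotvZl mul0r mulr0.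
have uv0 : 0 < enorm u * enorm v.
  by rewrite mulr_gt0// lt_neqAle enorm_ge0 eq_sym ?u0 ?v0.
have := dotvv_ge0 (enorm v *: u + - enorm u *: v).
rewrite dotvDl !dotvZl ![dotv _ (_ + _)]dotvC !dotvDl !dotvZl -!sqr_enorm.
rewrite (dotvC v u) => h.
have : 0 <= enorm u * enorm v * (enorm u * enorm v - dotv u v) by lra.
by rewrite pmulr_rge0// subr_ge0.
Qed.

Lemma ler_enormD u v : enorm (u + v) <= enorm u + enorm v.
Proof.
rewrite -(@ler_pXn2r _ 2)// ?nnegrE ?addr_ge0 ?enorm_ge0//.
rewrite sqr_enorm dotvDl ![dotv _ (_ + _)]dotvC !dotvDl -!sqr_enorm.
have := dotv_le u v; rewrite (dotvC v u); lra.
Qed.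

Lemma enorm_continuous : continuous enorm.
Proof.
move=> u; apply: continuous_comp; last exact: sqrt_continuous.
apply: (@continuous_big _ _ _ _ _ _ _ _ (fun i v => v 0 i * v 0 i)) => [|i _ v].
  exact: add_continuous.
by apply: cvgM; [exact: nbhs_filter|exact: (@coord_continuous R 1 d 0 i v)..].
Qed.

End euclidean.

Section continuous_paths.
Context (R : realType) (d : nat) (T : R).

(* The time interval [0, T] as a type, with the subset topology. *)
Definition horizon : Type := set_type `[0, T]%classic.

HB.instance Definition _ := Choice.on horizon.
HB.instance Definition _ := Topological.on horizon.

Definition cpath_pred : {pred horizon -> 'rV[R]_d} :=
  [pred x | `[< continuous x >]].

Lemma cpath_submod_closed : submod_closed cpath_pred.
Proof.
split=> [|a x y /asboolP cx /asboolP cy]; apply/asboolP => t.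
  exact: cst_continuous.
apply: continuousD; last exact: cy.
by apply: continuousZr; exact: cx.
Qed.

HB.instance Definition _ := GRing.isSubmodClosed.Build _ _ cpath_pred
  cpath_submod_closed.

(* C([0,T]; R^d) *)
Record cpath := CPath {
  cpath_fun :> horizon -> 'rV[R]_d ;
  cpathP : cpath_fun \in cpath_pred }.

HB.instance Definition _ := [isSub for cpath_fun].
HB.instance Definition _ := [Choice of cpath by <:].
HB.instance Definition _ := [SubChoice_isSubLmodule of cpath by <:].

Lemma cpath_continuous (x : cpath) : continuous x.
Proof. exact/asboolP/cpathP. Qed.

Definition supnorm (x : cpath) : R := sup (range (fun t => enorm (x t))).

Lemma supnorm_has_ubound (x : cpath) : has_ubound (range (fun t => enorm (x t))).
Proof.
have [T0|T0] := leP 0 T; last first.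
  exists 0 => _ [t _ <-]; have := set_valP t.
  by rewrite /= in_itv/= => /andP[/le_trans h /h]; rewrite leNgt T0.
pose f (s : R) : R := oapp (fun t : horizon => enorm (x t)) 0 (insub s).
have fE (t : horizon) : f (val t) = enorm (x t) by rewrite /f valK.
have cf : {within `[0, T], continuous f}.
  apply/subspace_sigL_continuousP.
  rewrite (_ : sigL _ _ = (fun t : horizon => enorm (x t))).
    move=> t; apply: continuous_comp; first exact: cpath_continuous.
    exact: enorm_continuous.
  by apply/funext => t; exact: fE.
have [c _ fc] := EVT_max T0 cf.
by exists (f c) => _ [t _ <-]; rewrite -fE; apply: fc; case: t => t /=; rewrite inE.
Qed.

Lemma supnorm_ub (x : cpath) t : enorm (x t) <= supnorm x.
Proof. by apply: ub_le_sup; [exact: supnorm_has_ubound | exists t]. Qed.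

Lemma supnorm_ge0 (x : cpath) : 0 <= supnorm x.
Proof.
rewrite /supnorm; have [->|/set0P[_ [t _ _]]] :=
  eqVneq (range (fun t => enorm (x t))) set0; first by rewrite sup0.
exact: le_trans (enorm_ge0 _) (supnorm_ub x t).
Qed.

Lemma supnorm_le (x : cpath) (M : R) :
  0 <= M -> (forall t, enorm (x t) <= M) -> supnorm x <= M.
Proof.
move=> M0 xM; rewrite /supnorm; have [->|/set0P x0] :=
  eqVneq (range (fun t => enorm (x t))) set0; first by rewrite sup0.
by apply: ge_sup => // _ [t _ <-].
Qed.

Lemma ler_supnormD (x y : cpath) : supnorm (x + y) <= supnorm x + supnorm y.
Proof.
apply: supnorm_le => [|t]; first by rewrite addr_ge0 ?supnorm_ge0.
by rewrite (le_trans (ler_enormD _ _))// lerD ?supnorm_ub.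
Qed.

Lemma supnormZ_le (a : R) (x : cpath) : supnorm (a *: x) <= `|a| * supnorm x.
Proof.
apply: supnorm_le => [|t]; first by rewrite mulr_ge0 ?supnorm_ge0.
by rewrite [X in enorm X](_ : _ = a *: x t)// enormZ ler_wpM2l ?supnorm_ub.
Qed.

Lemma supnormZ (a : R) (x : cpath) : supnorm (a *: x) = `|a| * supnorm x.
Proof.
have [->|a0] := eqVneq a 0.
  apply/eqP; rewrite normr0 mul0r eq_le supnorm_ge0 andbT.
  by rewrite (le_trans (supnormZ_le _ _))// normr0 mul0r.
apply/eqP; rewrite eq_le supnormZ_le/=.
rewrite -ler_pdivlMl ?normr_gt0// -normfV.
by rewrite -[X in supnorm X <= _](scalerK a0) supnormZ_le.
Qed.

Lemma supnorm_eq0 (x : cpath) : supnorm x = 0 -> x = 0.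
Proof.
move=> x0; apply/val_inj/funext => t /=; apply: enorm_eq0.
by apply/eqP; rewrite eq_le enorm_ge0 andbT -x0 supnorm_ub.
Qed.

HB.instance Definition _ := Lmodule_isNormed.Build R cpath
  ler_supnormD supnormZ supnorm_eq0.

(* Extension of a path to the real line, by 0 outside [0, T]; it serves only to
   write integrals over subintervals of [0, T]. *)
Definition path_ext (V : zmodType) (x : horizon -> V) (s : R) : V :=
  oapp x 0 (insub s).

(* Quantifying over t makes the definition meaningful without 0 <= T, which is
   what makes 0 an element of [0, T]. *)
Definition starts_at (xi : 'rV[R]_d) (x : cpath) : Prop :=
  forall t : horizon, val t = 0 -> x t = xi.

(* The Banach space C_0([0,T]; R^d) *)
Definition c0path_pred : {pred cpath} := [pred x | `[< starts_at 0 x >]].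

Lemma c0path_submod_closed : submod_closed c0path_pred.
Proof.
split=> [|a x y /asboolP x0 /asboolP y0]; apply/asboolP => t t0 //.
by rewrite [LHS](_ : _ = a *: x t + y t)// x0// y0// scaler0 addr0.
Qed.

HB.instance Definition _ := GRing.isSubmodClosed.Build _ _ c0path_pred
  c0path_submod_closed.

Record c0path := C0Path {
  c0path_val :> cpath ;
  c0pathP : c0path_val \in c0path_pred }.

HB.instance Definition _ := [isSub for c0path_val].
HB.instance Definition _ := [Choice of c0path by <:].
HB.instance Definition _ := [SubChoice_isSubLmodule of c0path by <:].

Definition c0norm (x : c0path) : R := `|c0path_val x|.

Lemma ler_c0normD (x y : c0path) : c0norm (x + y) <= c0norm x + c0norm y.
Proof. exact: ler_normD. Qed.

Lemma c0normZ (a : R) (x : c0path) : c0norm (a *: x) = `|a| * c0norm x.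
Proof. exact: normrZ. Qed.

Lemma c0norm_eq0 (x : c0path) : c0norm x = 0 -> x = 0.
Proof. by move=> /normr0_eq0 x0; exact: val_inj. Qed.

HB.instance Definition _ := Lmodule_isNormed.Build R c0path
  ler_c0normD c0normZ c0norm_eq0.

HB.instance Definition _ :=
  Measurable.copy c0path (g_sigma_algebraType (@open c0path)).

(* C_xi([0,T]; R^d), with the topology induced by the uniform norm of
   C([0,T]; R^d) and the corresponding Borel sigma-algebra. *)
Definition cxipath (xi : 'rV[R]_d) : Type := set_type [set x | starts_at xi x].

Lemma cst_cpath_subproof (xi : 'rV[R]_d) : (fun _ : horizon => xi) \in cpath_pred.
Proof. by apply/asboolP => t; exact: cst_continuous. Qed.

Lemma cst_cxipath_subproof (xi : 'rV[R]_d) :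
  CPath (cst_cpath_subproof xi) \in [set x | starts_at xi x].
Proof. by rewrite inE => t. Qed.

Definition cst_cxipath (xi : 'rV[R]_d) : cxipath xi :=
  exist (fun x => x \in _) _ (cst_cxipath_subproof xi).

Section cxipath_instances.
Variable xi : 'rV[R]_d.

HB.instance Definition _ := Choice.on (cxipath xi).
HB.instance Definition _ := PseudoMetric.on (cxipath xi).
HB.instance Definition _ := isPointed.Build (cxipath xi) (cst_cxipath xi).
HB.instance Definition _ :=
  Measurable.copy (cxipath xi) (g_sigma_algebraType (@open (cxipath xi))).

End cxipath_instances.

Definition cxipath_val (xi : 'rV[R]_d) (x : cxipath xi) : cpath := val x.

End continuous_paths.

Coercion cxipath_val : cxipath >-> cpath.

Section gaussian.
Context {R : realType}.

(* s is the standard deviation; the degenerate Gaussian laws are Dirac masses. *)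
Definition gaussian_law (m s : R) : set R -> \bar R :=
  if s == 0 then \d_m else normal_prob m s.

Context {dO : measure_display} {Omega : measurableType dO}
  (P : probability Omega R).

Definition is_gaussian (Z : Omega -> R) : Prop :=
  exists m s : R, forall A : set R, measurable A ->
    P (Z @^-1` A) = gaussian_law m s A.

(* All finite-dimensional distributions are (possibly degenerate, possibly
   non-centered) Gaussian. *)
Definition gaussian_process {d : nat} {T : R} (X : Omega -> c0path d T) : Prop :=
  forall (n : nat) (t : 'I_n -> horizon T) (a : 'I_n -> 'rV[R]_d),
    is_gaussian (fun w => \sum_(i < n) dotv (a i) (X w (t i))).

End gaussian.

(* sup of int l^2 dgamma over the unit ball of the topological dual of C_0 *)
Definition weak_variance {R : realType} {d : nat} {T : R}
    (gamma : probability (c0path d T) R) : \bar R :=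
  ereal_sup [set (\int[gamma]_x ((l x) ^+ 2)%:E)%E | l in
    [set l : {linear c0path d T -> R^o} |
      continuous l /\ forall x, `|l x| <= `|x| ] ].

Definition is_solution {R : realType} {d : nat} {T : R}
    (b : 'rV[R]_d -> 'rV[R]_d) (xi : 'rV[R]_d)
    (x : c0path d T) (y : cxipath T xi) : Prop :=
  forall t : horizon T, y t = xi
    + \row_i (\int[lebesgue_measure]_(s in `[0, val t]) b (path_ext y s) 0 i)
    + x t.

Definition relative_entropy {R : realType} {dE : measure_display}
    {E : measurableType dE} (nu mu : probability E R) : \bar R :=
  if `[< nu `<< mu >]
  then (\int[nu]_x lne (Radon_Nikodym (charge_of_finite_measure nu) mu x))%E
  else +oo%E.

Definition coupling {R : realType} {d1 d2 : measure_display}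
    {E1 : measurableType d1} {E2 : measurableType d2}
    (nu : probability E1 R) (mu : probability E2 R) :
    set (probability (E1 * E2)%type R) :=
  [set pi | (forall A, measurable A -> pi (A `*` setT) = nu A) /\
            (forall B, measurable B -> pi (setT `*` B) = mu B)].

Definition unif_dist {R : realType} {d : nat} {T : R} {xi : 'rV[R]_d}
    (x y : cxipath T xi) : R := `|(x : cpath d T) - (y : cpath d T)|.

(* The squared 2-Wasserstein cost for the uniform distance. *)
Definition transport_cost {R : realType} {d : nat} {T : R} {xi : 'rV[R]_d}
    (nu mu : probability (cxipath T xi) R) : \bar R :=
  ereal_inf [set (\int[pi]_z (unif_dist z.1 z.2 ^+ 2)%:E)%E
            | pi in coupling nu mu].

(* Main.v *)
(* The solution map X |-> Y is Lipschitz for the uniform norms, with constant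
   5/2 exp(2T(C1+C2)): as long as |Y - Y'| is large compared with |X - X'|, the
   two conditions on b bound the radial growth of Y - Y' - (X - X').

   For finitely many times, the transport inequality for the Gaussian vector is
   obtained by duality: if phi(x) + psi(y) <= c(x, y), the Prekopa-Leindler
   inequality with weights 1/4 and 3/4 gives (int e^(b phi)) (int e^(b psi/3))^3
   <= 1 with 8 b s2 = 3, where s2 bounds the variances of the one-time marginals.
   The entropy inequality under the density of nu and Jensen's inequality turn
   this into a bound on int phi dQ + int psi dP. Rounding the values of the path
   on a grid leaves only finitely many states, so the dual bound yields a plan by
   a finite-dimensional Hahn-Banach argument, and this plan is spread over the
   cells of the partition. The rounding errors vanish in L^2 of P and of Q, as
   |X| has Gaussian tails by Fernique's argument, here another instance of
   Prekopa-Leindler. The constants fit: (25/4)(8/3) = 50/3 < 18.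

   The Gaussian inequality is proved for independent standard variables by
   induction on the dimension; it passes to the given vector because bounded
   functionals of its law are determined by its characteristic function. *)
Require Import Defs.
From HB Require Import structures.
From mathcomp Require Import all_boot all_order all_algebra.
From mathcomp Require Import all_classical all_reals all_analysis.
From mathcomp Require Import measurable_realfun.
From mathcomp Require Import ring lra.

Set Implicit Arguments.
Unset Strict Implicit.
Unset Printing Implicit Defensive.
Import Order.TTheory GRing.Theory Num.Theory.
Import numFieldNormedType.Exports.
Local Open Scope classical_set_scope.
Local Open Scope ring_scope.

(** With weights [l] and [1 - l], the Gaussian Prekopa-Leindler inequality and the entropy argument
    give the transport constant [2 / (1 - l)] times the variance bound. Talagrand's constant 2 is
    the limit [l -> 0]; any [l] with [25/4 * 2 / (1 - l) < 18] is enough here. The value 1/4 turns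
    the convexity step into a polynomial inequality of degree 4 and leaves room for the
    discretization: each of two squared triangle inequalities costs a factor [27/26], and 26 is the
    least integer [k] for which [50/3 * ((k + 1) / k)^2 < 18].

    The bound must not depend on the number of times. In the inequality for vectors an increment is
    therefore measured by all its linear functionals, relative to their variances; testing it with
    functionals that live at one time yields the maximum over the times, at the price of one-time
    variances alone.

    The plan couples a tilted measure [Q] with [P] on the probability space itself, where [X] and
    [Y] coexist, so that the pathwise Lipschitz estimate compares [Y] at two sample points
    directly. *)

(** * Sublinear functionals: Hahn-Banach in finitely many steps *)

Section sublinear.
Context {R : realType} {V : lmodType R}.
Implicit Types (p q : V -> R) (u v e : V).

Definition sublinear p :=
  (forall u v, p (u + v) <= p u + p v) /\
  (forall (t : R) u, 0 < t -> p (t *: u) = t * p u).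

Lemma sublinear0 p : sublinear p -> p 0 = 0.
Proof. by move=> [_ /(_ 2 0)]; rewrite ltr0n => /(_ isT); rewrite scaler0; lra. Qed.

Lemma sublinearN p u : sublinear p -> - p (- u) <= p u.
Proof.
move=> sp; have := sp.1 u (- u).
by rewrite subrr sublinear0//; lra.
Qed.

(** The infimum of [p (v + t e) - t p e] over [t >= 0] is the largest sublinear minorant of [p]
    whose value at [- e] is at most [- p e]: any such [r] has [r v <= r (v + t e) + t r (- e)]. *)
Lemma sublinear_step p e : sublinear p ->
  exists q, [/\ sublinear q, forall v, q v <= p v, q e = p e & q (- e) = - p e].
Proof.
move=> sp; have [pD pZ] := sp.
have pZ0 t u : 0 <= t -> p (t *: u) = t * p u.
  rewrite le_eqVlt => /predU1P[<-|/pZ//].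
  by rewrite scale0r mul0r sublinear0.
pose S v : set R := [set p (v + t *: e) - t * p e | t in [set t | 0 <= t]].
pose q v := inf (S v).
have lbS v x : S v x -> - p (- v) <= x.
  move=> [t /= t0 <-].
  have := pD (v + t *: e) (- v).
  by rewrite addrAC subrr add0r pZ0//; lra.
have S0 v : S v !=set0 by exists (p (v + 0 *: e) - 0 * p e); exists 0 => /=.
have hlb v : has_lbound (S v) by exists (- p (- v)) => x /lbS.
have qle v t : 0 <= t -> q v <= p (v + t *: e) - t * p e.
  by move=> t0; apply: ge_inf => //; exists t.
have qge v c : (forall t, 0 <= t -> c <= p (v + t *: e) - t * p e) -> c <= q v.
  by move=> h; apply: lb_le_inf => // x [t /= t0 <-]; exact: h.
have qp v : q v <= p v.
  by have := qle v 0 (lexx _); rewrite scale0r addr0 mul0r subr0.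
have qD u v : q (u + v) <= q u + q v.
  have h s t : 0 <= s -> 0 <= t ->
    q (u + v) <= (p (u + s *: e) - s * p e) + (p (v + t *: e) - t * p e).
    move=> s0 t0; apply: (le_trans (qle _ (s + t) _)); first exact: addr_ge0.
    rewrite scalerDl addrACA; have := pD (u + s *: e) (v + t *: e); lra.
  suff: q (u + v) - q v <= q u by lra.
  apply: (qge) => s s0.
  suff: q (u + v) - (p (u + s *: e) - s * p e) <= q v by lra.
  by apply: (qge) => t t0; have := h s t s0 t0; lra.
have qZ t u : 0 < t -> q (t *: u) = t * q u.
  have h s v : 0 < s -> s * q v <= q (s *: v).
    move=> s0; apply: qge => r r0.
    have := qle v (r / s) (divr_ge0 r0 (ltW s0)).
    rewrite -(ler_pM2l s0) => /le_trans; apply.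
    rewrite mulrBr -pZ// scalerDr scalerA (mulrC s) divfK ?gt_eqF// mulrA.
    by rewrite (mulrC s) divfK ?gt_eqF.
  move=> t0; apply/eqP; rewrite eq_le h// andbT.
  have := h t^-1 (t *: u); rewrite invr_gt0 => /(_ t0).
  by rewrite scalerA mulVf ?gt_eqF// scale1r ler_pdivrMl.
have sq : sublinear q by [].
have qe : q (- e) <= - p e.
  have := qle (- e) 1 ler01; rewrite scale1r addNr mul1r sublinear0//; lra.
have qe2 := sublinearN e sq.
have qe3 := qp e.
by exists q; split=> //; lra.
Qed.

(** Oddness achieved at [e] survives in every smaller sublinear [q], since [- q (- e) <= q e].
    Finitely many directions suffice when they form a basis. *)
Lemma sublinear_linear_on p (s : seq V) : sublinear p ->
  exists q, [/\ sublinear q, forall v, q v <= p v &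
    forall e, e \in s -> q (- e) = - q e].
Proof.
move=> sp; elim: s => [|e s [q [sq qp qs]]]; first by exists p; split.
have [q' [sq' q'q q'e q'Ne]] := sublinear_step e sq.
exists q'; split => // [v|v]; first exact: le_trans (q'q v) (qp v).
rewrite inE => /predU1P[->|vs]; first by rewrite q'e.
have := q'q v; have := q'q (- v); have := sublinearN v sq'; rewrite qs//; lra.
Qed.

(** Oddness at one argument is enough: subadditivity at [(u + v) + (- u)] gives the reverse
    inequality. *)
Lemma sublinear_linearD p u v : sublinear p ->
  p (- u) = - p u -> p (u + v) = p u + p v.
Proof.
move=> [pD _] pu; apply/eqP; rewrite eq_le pD/=.
by have := pD (u + v) (- u); rewrite addrAC subrr add0r pu; lra.
Qed.

Lemma sublinear_linearZ p (t : R) u : sublinear p ->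
  p (- u) = - p u -> p (t *: u) = t * p u.
Proof.
move=> sp pu; have [t0|t0|->] := ltgtP t 0; last 2 first.
- exact: sp.2.
- by rewrite scale0r mul0r sublinear0.
rewrite -[t]opprK scaleNr -scalerN sp.2 ?oppr_gt0// pu; lra.
Qed.

End sublinear.

(** * Kantorovich duality on finite sets *)

Section finite_duality.
Context {R : realType} {I J : finType}.
Variables (p : I -> R) (q : J -> R) (c : I -> J -> R) (K : R).
Hypothesis p0 : forall i, 0 <= p i.
Hypothesis q0 : forall j, 0 <= q j.
Hypothesis p1 : \sum_i p i = 1.
Hypothesis q1 : \sum_j q j = 1.
Hypothesis dual : forall (phi : I -> R) (psi : J -> R),
  (forall i j, phi i + psi j <= c i j) ->
  \sum_i phi i * p i + \sum_j psi j * q j <= K.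

Local Notation V := {ffun I * J -> R^o}.

(** The values of separable majorants of [u]; their infimum [N] is the dual value. A linear
    functional below [N] is automatically a nonnegative plan with marginals [p] and [q]. *)
Let S (u : V) : set R :=
  [set x | exists phi psi, (forall i j, u (i, j) <= phi i + psi j) /\
           x = \sum_i phi i * p i + \sum_j psi j * q j].

Let N (u : V) := inf (S u).

Let S0 u : S u !=set0.
Proof.
pose M := \sum_ij `|u ij|.
exists (\sum_i (cst M i) * p i + \sum_j (cst 0 j) * q j); exists (cst M), (cst 0).
split => // i j /=; rewrite addr0 (le_trans (ler_norm _))// /M.
by rewrite (bigD1 (i, j))//= lerDl sumr_ge0.
Qed.

(** Integration against the product plan bounds [S u] from below, which keeps the infimum finite. *)
Let S_lb (u : V) x : S u x -> \sum_i \sum_j u (i, j) * (p i * q j) <= x.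
Proof.
move=> [phi [psi [h ->]]].
apply: (@le_trans _ _ (\sum_i \sum_j (phi i + psi j) * (p i * q j))).
  apply: ler_sum => i _; apply: ler_sum => j _.
  by rewrite ler_wpM2r// mulr_ge0.
rewrite le_eqVlt; apply/orP; left; apply/eqP.
under eq_bigr do under eq_bigr do rewrite mulrDl.
under eq_bigr do rewrite big_split/=.
rewrite big_split/=; congr (_ + _).
  apply: eq_bigr => i _; under eq_bigr do rewrite mulrA.
  by rewrite -mulr_sumr q1 mulr1.
rewrite exchange_big/=; apply: eq_bigr => j _.
under eq_bigr do rewrite mulrCA.
by rewrite -mulr_suml p1 mul1r.
Qed.

Let S_hlb u : has_lbound (S u).
Proof. by eexists => x; exact: S_lb. Qed.

Let N_le (u : V) phi psi : (forall i j, u (i, j) <= phi i + psi j) ->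
  N u <= \sum_i phi i * p i + \sum_j psi j * q j.
Proof. by move=> h; apply: ge_inf => //; exists phi, psi. Qed.

Let N_ge (u : V) x : (forall phi psi, (forall i j, u (i, j) <= phi i + psi j) ->
  x <= \sum_i phi i * p i + \sum_j psi j * q j) -> x <= N u.
Proof. by move=> h; apply: lb_le_inf => // _ [phi [psi [? ->]]]; exact: h. Qed.

Let sublinearN : sublinear N.
Proof.
split=> [u v|t u t0].
  suff: N (u + v) - N v <= N u by lra.
  apply: N_ge => f f' hf; set a := (X in _ <= X).
  suff: N (u + v) - a <= N v by lra.
  apply: N_ge => g g' hg; rewrite lerBlDr; apply: (le_trans (N_le (phi := f \+ g) (psi := f' \+ g') _)).
    by move=> i j; rewrite ffunE/=; have := hf i j; have := hg i j; lra.
  under eq_bigr do rewrite mulrDl.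
  under [X in _ + X]eq_bigr do rewrite mulrDl.
  by rewrite /a !big_split/=; lra.
have h s v : 0 < s -> N (s *: v) <= s * N v.
  move=> s0; rewrite -ler_pdivrMl//; apply: N_ge => f g hfg.
  rewrite ler_pdivrMl//.
  apply: (le_trans (N_le (phi := fun i => s * f i) (psi := fun j => s * g j) _)).
    by move=> i j; rewrite ffunE/= -mulrDr ler_pM2l.
  rewrite mulrDr !mulr_sumr lerD// ler_sum// => ? _; by rewrite mulrA.
apply/eqP; rewrite eq_le h//=.
have := h t^-1 (t *: u); rewrite invr_gt0 => /(_ t0).
by rewrite scalerA mulVf ?gt_eqF// scale1r ler_pdivlMl.
Qed.

(* The optimal plan is a linear functional below [N] that touches it at [- c]. *)
Lemma finite_duality : exists k : I -> J -> R,
  [/\ forall i j, 0 <= k i j, forall i, \sum_j k i j = p i,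
      forall j, \sum_i k i j = q j & \sum_i \sum_j k i j * c i j <= K].
Proof.
pose mc : V := [ffun ij => - c ij.1 ij.2].
pose d ij : V := [ffun x => (x == ij)%:R].
(* The first step fixes the value at [- mc], which is the cost, to [- N mc]. The later steps go over
   the indicators [d ij], a basis, so that [L] becomes linear without exceeding this value. *)
have [N' [sN' N'N N'c N'Nc]] := sublinear_step mc sublinearN.
have [L [sL LN' Le]] := sublinear_linear_on [seq d ij | ij : I * J] sN'.
have LN v : L v <= N v by exact: le_trans (LN' v) (N'N v).
have Ld ij : L (- d ij) = - L (d ij) by apply: Le; apply/mapP; exists ij; rewrite ?mem_enum.
have Lsum (r : seq (I * J)) (a : I * J -> R) :
    L (\sum_(ij <- r) a ij *: d ij) = \sum_(ij <- r) a ij * L (d ij).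
  elim: r => [|ij r IH]; first by rewrite !big_nil sublinear0.
  rewrite !big_cons sublinear_linearD//.
    by rewrite IH sublinear_linearZ.
  by rewrite -scaleNr !(sublinear_linearZ _ sL)// mulNr.
have dec (v : V) : v = \sum_ij v ij *: d ij.
  apply/ffunP => x; rewrite sum_ffunE (bigD1 x)//= big1 ?addr0.
    by rewrite !ffunE eqxx [RHS]mulr1.
  by move=> y yx; rewrite !ffunE eq_sym (negbTE yx) [LHS]mulr0.
have LE v : L v = \sum_i \sum_j v (i, j) * L (d (i, j)).
  by rewrite [in LHS](dec v) Lsum pair_bigA/=; apply: eq_bigr => -[].
have LNv v : L (- v) = - L v.
  rewrite !LE -sumrN; apply: eq_bigr => i _; rewrite -sumrN.
  by apply: eq_bigr => j _; rewrite ffunE mulNr.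
(* Both [v] and [- v] have explicit separable majorants, so the value of [L] on separable functions
   is forced; this yields the marginals. *)
have Leq (v : V) phi psi : (forall i j, v (i, j) = phi i + psi j) ->
    L v = \sum_i phi i * p i + \sum_j psi j * q j.
  move=> h; apply/eqP; rewrite eq_le; apply/andP; split.
    by apply: le_trans (LN v) (N_le _) => i j; rewrite h.
  rewrite -lerN2 -LNv; apply: (le_trans (LN _)).
  apply: (le_trans (N_le (phi := \- phi) (psi := \- psi) _)).
    by move=> i j; rewrite ffunE h opprD.
  by rewrite opprD -!sumrN lerD// ler_sum// => ? _; rewrite mulNr.
exists (fun i j => L (d (i, j))); split.
- move=> i j; rewrite -oppr_le0 -LNv; apply: (le_trans (LN _)).
  apply: (le_trans (N_le (phi := cst 0) (psi := cst 0) _)).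
    by move=> i' j'; rewrite !ffunE addr0 oppr_le0.
  by rewrite !big1 ?addr0// => *; rewrite mul0r.
- move=> i; pose v : V := [ffun x => (x.1 == i)%:R].
  have <- : L v = p i.
    rewrite (@Leq v (fun x => (x == i)%:R) (cst 0)).
      rewrite (bigD1 i)//= eqxx mul1r !big1 ?addr0// => [*|k /negbTE ->];
        by rewrite mul0r.
    by move=> i' j; rewrite ffunE addr0.
  rewrite LE (bigD1 i)//= [X in _ = _ + X]big1 ?addr0.
    by apply: eq_bigr => j _; rewrite ffunE/= eqxx mul1r.
  by move=> k /negbTE ki; rewrite big1// => j _; rewrite ffunE/= ki mul0r.
- move=> j; pose v : V := [ffun x => (x.2 == j)%:R].
  have <- : L v = q j.
    rewrite (@Leq v (cst 0) (fun x => (x == j)%:R)).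
      rewrite [X in _ + X](bigD1 j)//= eqxx mul1r !big1 ?addr0 ?add0r// => [k /negbTE ->|*];
        by rewrite mul0r.
    by move=> i' j'; rewrite ffunE add0r.
  rewrite LE exchange_big/= (bigD1 j)//= [X in _ = _ + X]big1 ?addr0.
    by apply: eq_bigr => i _; rewrite ffunE/= eqxx mul1r.
  by move=> k /negbTE ki; rewrite big1// => i _; rewrite ffunE/= ki mul0r.
- have -> : \sum_i \sum_j L (d (i, j)) * c i j = - L mc.
    rewrite LE -sumrN; apply: eq_bigr => i _; rewrite -sumrN.
    by apply: eq_bigr => j _; rewrite ffunE/= mulNr opprK mulrC.
  rewrite -LNv; apply: (le_trans (LN' _)); rewrite N'Nc lerNl.
  apply: N_ge => phi psi h; rewrite lerNl.
  apply: le_trans (dual (phi := \- phi) (psi := \- psi) _).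
    by rewrite opprD -!sumrN lerD// ler_sum// => ? _; rewrite mulNr.
  by move=> i j /=; have := h i j; rewrite ffunE/=; lra.
Qed.

End finite_duality.

(* [h] is a version of the Radon-Nikodym derivative of [m'] with respect to [m]. *)
Lemma ge0_integral_density {d} {T : measurableType d} {R : realType}
    (m : {sigma_finite_measure set T -> \bar R}) (m' : {finite_measure set T -> \bar R})
    (h f : T -> \bar R) : measurable_fun setT h ->
  (forall A, measurable A -> m' A = \int[m]_(x in A) h x)%E ->
  measurable_fun setT f -> (forall x, 0 <= f x)%E ->
  (\int[m']_x f x = \int[m]_x (f x * h x))%E.
Proof.
move=> mh m'E mf f0.
have dom : m' `<< m.
  apply/null_content_dominatesP => A mA A0.
  by rewrite m'E// null_set_integral//; exact: measurable_funTS.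
have intg := Radon_Nikodym_SigmaFinite.f_integrable dom.
rewrite -(Radon_Nikodym_SigmaFinite.change_of_variables dom f0 measurableT mf).
apply: ae_eq_integral => //.
- by apply: emeasurable_funM => //; exact: measurable_int intg.
- exact: emeasurable_funM.
have : ae_eq m setT (Radon_Nikodym_SigmaFinite.f m' m) h.
  apply: integral_ae_eq => // A _ mA.
  by rewrite -m'E// -Radon_Nikodym_SigmaFinite.f_integral.
by apply: filterS => x /= hx _; rewrite hx.
Qed.

(** * Bounded measurable functions and their integrals *)

Section bounded_measurable.
Context {d} {T : measurableType d} {R : realType}.
Implicit Types (f g : T -> R).

(** Such functions are integrable against every probability, so one predicate serves [P], [Q],
    products and image laws alike. *)
Definition bmf f := measurable_fun setT f /\ exists M : R, forall x, `|f x| <= M.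

Lemma bmf_meas f : bmf f -> measurable_fun setT f. Proof. by case. Qed.

Lemma bmf_cst (k : R) : bmf (cst k).
Proof. by split=> //; exists `|k|. Qed.

Lemma bmfD f g : bmf f -> bmf g -> bmf (f \+ g).
Proof.
move=> [mf [M hM]] [mg [N hN]]; split; first exact: measurable_funD.
exists (M + N) => x; exact: le_trans (ler_normD _ _) (lerD _ _).
Qed.

Lemma bmfM f g : bmf f -> bmf g -> bmf (f \* g).
Proof.
move=> [mf [M hM]] [mg [N hN]]; split; first exact: measurable_funM.
by exists (M * N) => x; rewrite /= normrM ler_pM.
Qed.

Lemma bmfZ (k : R) f : bmf f -> bmf (fun x => k * f x).
Proof. by move=> bf; have := bmfM (bmf_cst k) bf. Qed.

Lemma bmf_indic (A : set T) : measurable A -> bmf (\1_A : T -> R).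
Proof.
move=> mA; split; first exact: measurable_indic.
by exists 1 => x; rewrite indicE; case: (_ \in _); rewrite ?normr1 ?normr0.
Qed.

Lemma bmf_cos f : measurable_fun setT f -> bmf (fun x => cos (f x)).
Proof.
move=> mf; split; last by exists 1 => x; rewrite ler_norml cos_geN1 cos_le1.
by apply: measurableT_comp mf; apply: continuous_measurable_fun; exact: continuous_cos.
Qed.

Lemma bmf_integrable (m : {finite_measure set T -> \bar R}) f :
  bmf f -> m.-integrable setT (EFin \o f).
Proof.
move=> [mf [M hM]]; apply: measurable_bounded_integrable => //.
  by rewrite ltey_eq fin_num_measure.
by exists M; split; [exact: num_real|move=> N MN x _; exact: le_trans (ltW MN)].
Qed.

Lemma EFin_Rintegral (m : {measure set T -> \bar R}) f :
  m.-integrable setT (EFin \o f) -> (\int[m]_x f x)%:E = (\int[m]_x (f x)%:E)%E.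
Proof. by move=> intf; rewrite fineK//; exact: integrable_fin_num. Qed.

Lemma Rintegral_prob_cst (m : probability T R) (k : R) : \int[m]_x k = k.
Proof. by rewrite Rintegral_cst//= probability_setT mulr1. Qed.

End bounded_measurable.

Lemma bmf_cvg {d} {T : measurableType d} {R : realType}
    (F : nat -> T -> R) (f : T -> R) (M : R) :
  (forall n, measurable_fun setT (F n)) -> (forall n x, `|F n x| <= M) ->
  (forall x, F n x @[n --> \oo] --> f x) -> bmf f.
Proof.
move=> mF FM Ff; split; first by apply: measurable_fun_cvg mF _ => x _; exact: Ff.
exists M => x.
have h : `|F n x| @[n --> \oo] --> `|f x| by apply: cvg_norm; exact: Ff.
rewrite -(cvg_lim (@Rhausdorff R) h).
by apply: limr_le; [apply/cvg_ex; eexists; exact: h|exact: nearW].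
Qed.

Lemma bounded_convergence {d} {T : measurableType d} {R : realType}
    (m : probability T R) (F : nat -> T -> R) (f : T -> R) (M : R) :
  (forall n, measurable_fun setT (F n)) -> (forall n x, `|F n x| <= M) ->
  (forall x, F n x @[n --> \oo] --> f x) ->
  bmf f /\ \int[m]_x F n x @[n --> \oo] --> \int[m]_x f x.
Proof.
move=> mF FM Ff; have bf := bmf_cvg mF FM Ff; have mf := bmf_meas bf.
split=> //.
have [//|||||_ _ h] := @dominated_convergence _ _ _ m setT measurableT
  (fun n => EFin \o F n) (EFin \o f) (cst M%:E).
- by move=> n; apply/measurable_EFinP; exact: mF.
- exact/measurable_EFinP.
- by apply: aeW => x _; apply: cvg_EFin; [exact: nearW|exact: Ff].
- exact: finite_measure_integrable_cst.
- by apply: aeW => x n _; rewrite lee_fin FM.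
apply/fine_cvg.
rewrite fineK//; apply: integrable_fin_num => //; exact: bmf_integrable.
Qed.

Section fubini_bounded.
Context {d1} {T1 : measurableType d1} {d2} {T2 : measurableType d2} {R : realType}.
Variables (m1 : probability T1 R) (m2 : probability T2 R) (f : T1 * T2 -> R).
Hypothesis bf : bmf f.

Lemma bmf_section x : bmf (fun y => f (x, y)).
Proof.
have [mf [M hM]] := bf; split; last by exists M.
by apply: (measurableT_comp mf); apply: measurable_fun_pair.
Qed.

Let intf : (m1 \x m2)%E.-integrable setT (EFin \o f).
Proof. exact: (@bmf_integrable _ _ _ (m1 \x m2 : probability _ _)%E). Qed.

Lemma bmf_Rintegral_section : bmf (fun x => \int[m2]_y f (x, y)).
Proof.
have [mf [M hM]] := bf; split.
  have := measurable_fubini_F intf.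
  by move=> h; exact: measurableT_comp h.
exists M => x; have ib := bmf_integrable m2 (bmf_section x).
rewrite (le_trans (le_normr_Rintegral measurableT ib))//.
rewrite -[leRHS](Rintegral_prob_cst m2); apply: le_Rintegral => //.
- exact: integrable_norm.
- exact: finite_measure_integrable_cst.
Qed.

Lemma Rintegral_prod :
  \int[m1]_x \int[m2]_y f (x, y) = \int[(m1 \x m2)%E]_z f z.
Proof.
rewrite /Rintegral -(integral12_prod_meas1 intf); congr fine.
apply: eq_integral => x _; rewrite fineK//.
by apply: integrable_fin_num => //; apply: bmf_integrable; exact: bmf_section.
Qed.

End fubini_bounded.

Section Rintegral_linear.
Context {d} {T : measurableType d} {R : realType} (m : {measure set T -> \bar R}).

Lemma integrable_RD (f g : T -> R) : m.-integrable setT (EFin \o f) ->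
  m.-integrable setT (EFin \o g) -> m.-integrable setT (EFin \o (fun x => f x + g x)).
Proof. by move=> intf intg; have := integrableD measurableT intf intg. Qed.

Lemma integrable_RZ (k : R) (f : T -> R) : m.-integrable setT (EFin \o f) ->
  m.-integrable setT (EFin \o (fun x => k * f x)).
Proof. by move=> intf; have := integrableZl measurableT k intf. Qed.

Lemma integrable_Rsum (I : Type) (s : seq I) (f : I -> T -> R) :
  (forall i, m.-integrable setT (EFin \o f i)) ->
  m.-integrable setT (EFin \o (fun x => \sum_(i <- s) f i x)).
Proof.
move=> intf; elim: s => [|i s IH].
  have -> : EFin \o (fun x => \sum_(i <- [::]) f i x) = cst 0%E.
    by apply/funext => x /=; rewrite big_nil.
  exact: integrable0.
have -> : EFin \o (fun x => \sum_(j <- i :: s) f j x) =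
    EFin \o (fun x => f i x + \sum_(j <- s) f j x).
  by apply/funext => x /=; rewrite big_cons.
exact: integrable_RD.
Qed.

Lemma Rintegral_sum (I : Type) (s : seq I) (f : I -> T -> R) :
  (forall i, m.-integrable setT (EFin \o f i)) ->
  \int[m]_x (\sum_(i <- s) f i x) = \sum_(i <- s) \int[m]_x f i x.
Proof.
move=> intf; elim: s => [|i s IH].
  rewrite big_nil; under eq_Rintegral do rewrite big_nil.
  by rewrite /Rintegral integral0.
under eq_Rintegral do rewrite big_cons.
by rewrite RintegralD ?big_cons ?IH//; exact: integrable_Rsum.
Qed.

Lemma integrable_Rdom (f g : T -> R) : measurable_fun setT f ->
  m.-integrable setT (EFin \o g) -> (forall x, `|f x| <= g x) ->
  m.-integrable setT (EFin \o f).
Proof.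
move=> mf intg fg; apply: le_integrable intg => //; first exact/measurable_EFinP.
by move=> x _ /=; rewrite lee_fin (le_trans (fg x))// ler_norm.
Qed.

Lemma ge0_integrable_R (f : T -> R) : measurable_fun setT f ->
  (forall x, 0 <= f x) -> (\int[m]_x (f x)%:E < +oo)%E ->
  m.-integrable setT (EFin \o f).
Proof.
move=> mf f0 fin; apply/integrableP; split; first exact/measurable_EFinP.
by under eq_integral do rewrite /= ger0_norm//.
Qed.

End Rintegral_linear.

(** * The Prekopa-Leindler inequality on the line *)

Section prekopa_leindler.
Context {R : realType}.
Local Notation mu := (@lebesgue_measure R).

(** AM-GM for the weights 1/4 and 3/4: in terms of [D = X - Y] the difference is a sum of squares.
    It converts the additive inequality between normalised functions into the multiplicative one. *)
Lemma AM_GM4 (X Y : R) : X * Y ^+ 3 <= ((X + 3 * Y) / 4) ^+ 4.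
Proof.
pose D := X - Y; have -> : X = Y + D by rewrite /D; lra.
rewrite -subr_ge0.
have -> : ((Y + D + 3 * Y) / 4) ^+ 4 - (Y + D) * Y ^+ 3 =
  (D * (Y + D / 12)) ^+ 2 * (3 / 8) + (D ^+ 2) ^+ 2 * (1/768) by field.
by apply: addr_ge0; (apply: mulr_ge0; [exact: sqr_ge0|lra]).
Qed.

Lemma measurable_level {d} {S : measurableType d} (w : S -> R) t :
  measurable_fun setT w -> measurable [set x | t < w x].
Proof.
move=> mw; rewrite (_ : mkset _ = setT `&` w @^-1` `]t, +oo[).
  by apply: mw => //; exact: measurable_itv.
by rewrite setTI; apply/seteqP; split=> x /=; rewrite in_itv/= andbT.
Qed.

Lemma measurable_hypograph (w : R -> R) : measurable_fun setT w ->
  measurable [set xt : R * R | xt.2 < w xt.1].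
Proof.
move=> mw; rewrite (_ : mkset _ = [set xt | 0 < w xt.1 - xt.2]); last first.
  by apply/seteqP; split=> -[x t] /=; rewrite subr_gt0.
by apply: measurable_level; apply: measurable_funB => //; exact: measurableT_comp.
Qed.

(** The truncation at 1 restricts the levels to []0, 1[], the range where the level sets of both
    normalised functions are nonempty and Brunn-Minkowski applies. *)
Lemma integral_layer_cake (u : R -> R) : measurable_fun setT u ->
  (forall x, 0 <= u x) ->
  (\int[mu]_x (Num.min (u x) 1)%:E =
   \int[mu]_(t in `]0%R, 1%R[) mu [set x | (t < u x)%R])%E.
Proof.
move=> mu_ u0.
pose f (xt : R * R) : \bar R := (\1_[set xt : R * R | 0 < xt.2 < 1 /\ xt.2 < u xt.1] xt)%:E.
have mf : measurable_fun setT f.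
  apply/measurable_EFinP; apply: measurable_indic.
  rewrite (_ : mkset _ = (snd @^-1` `]0, 1[%classic) `&`
    [set xt | xt.2 < u xt.1]); last first.
    by apply/seteqP; split=> -[x t] /=; rewrite in_itv/= => -[].
  apply: measurableI; last exact: measurable_hypograph.
  rewrite -[X in measurable X]setTI.
  by apply: measurable_snd => //; exact: measurable_itv.
have f0 x : (0 <= f x)%E by rewrite lee_fin.
transitivity (\int[mu]_x \int[mu]_t f (x, t))%E.
  apply: eq_integral => x _.
  transitivity (\int[mu]_t (\1_(`]0%R, Num.min (u x) 1[%classic) t)%:E)%E; last first.
    apply: eq_integral => t _; rewrite /f !indicE; congr ((_ : bool)%:R%:E).
    apply/idP/idP; rewrite !inE/= in_itv/= lt_min.
      by move=> /and3P[-> -> ->].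
    by move=> [/andP[-> ->] ->].
  rewrite integral_indic//= setIT.
  rewrite lebesgue_measure_itv/= lte_fin sube0.
  have [//|h] := ltP 0 (Num.min (u x) 1).
  by congr EFin; apply/eqP; rewrite eq_le h le_min u0 ler01.
rewrite fubini_tonelli//.
rewrite [RHS]integral_mkcond; apply: eq_integral => t _; rewrite patchE.
case: ifPn => [|/negP]; rewrite mem_setE in_itv/= => t01; last first.
  rewrite integral0_eq// => x _; rewrite /f indicE memNset//=.
  by move=> [].
have mlev : measurable [set x | t < u x] by exact: measurable_level.
rewrite -(setIT [set x | t < u x]) -integral_indic//.
apply: eq_integral => x _; rewrite /f !indicE; congr ((_ : bool)%:R%:E).
by apply/idP/idP; rewrite !inE/= => //; case.
Qed.

(* One-dimensional Brunn-Minkowski, trivial here because the set containing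
   [U/4 + 3V/4] is an interval. *)
Lemma brunn_minkowski_interval (U V I : set R) (B : R) :
  measurable U -> measurable V -> measurable I -> U !=set0 -> V !=set0 ->
  is_interval I -> (forall z, I z -> `|z| <= B) ->
  (forall x y, U x -> V y -> I ((x + 3 * y) / 4)) ->
  (mu U + 3%:E * mu V <= 4%:E * mu I)%E.
Proof.
move=> mU mV mI [x0 Ux0] [y0 Vy0] itI bI UVI.
have ubU : has_ubound U.
  by exists (4 * B - 3 * y0) => x Ux; have := bI _ (UVI _ _ Ux Vy0); rewrite ler_norml => /andP[]; lra.
have lbU : has_lbound U.
  by exists (- 4 * B - 3 * y0) => x Ux; have := bI _ (UVI _ _ Ux Vy0); rewrite ler_norml => /andP[]; lra.
have ubV : has_ubound V.
  by exists ((4 * B - x0) / 3) => y Vy; have := bI _ (UVI _ _ Ux0 Vy); rewrite ler_norml => /andP[]; lra.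
have lbV : has_lbound V.
  by exists ((- 4 * B - x0) / 3) => y Vy; have := bI _ (UVI _ _ Ux0 Vy); rewrite ler_norml => /andP[]; lra.
have msr (A : set R) x : measurable A -> A x -> has_ubound A -> has_lbound A ->
    inf A <= sup A /\ (mu A <= (sup A - inf A)%:E)%E.
  move=> mA Ax ubA lbA.
  have iA : inf A <= sup A by rewrite (le_trans (ge_inf lbA Ax))// ub_le_sup.
  split=> //.
  have -> : (sup A - inf A)%:E = mu `[inf A, sup A]%classic.
    rewrite lebesgue_measure_itv/= lte_fin; case: ltP => //.
    by move=> h; rewrite (_ : sup A = inf A) ?subrr//; apply/eqP; rewrite eq_le h iA.
  apply: le_measure; rewrite ?inE// => y Ay /=.
  by rewrite in_itv/= ge_inf// ub_le_sup.
have [iU leU] := msr _ _ mU Ux0 ubU lbU.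
have [iV leV] := msr _ _ mV Vy0 ubV lbV.
have mI_ge : (((sup U + 3 * sup V) / 4 - (inf U + 3 * inf V) / 4)%:E <= mu I)%E.
  have [h|h] := leP ((sup U + 3 * sup V) / 4) ((inf U + 3 * inf V) / 4).
    by apply: le_trans (measure_ge0 _ _); rewrite lee_fin subr_le0.
  have -> : ((sup U + 3 * sup V) / 4 - (inf U + 3 * inf V) / 4)%:E =
      mu `](inf U + 3 * inf V) / 4, (sup U + 3 * sup V) / 4[.
    by rewrite lebesgue_measure_itv/= lte_fin h.
  apply: le_measure; rewrite ?inE// => z /=; rewrite in_itv/= => /andP[z1 z2].
  pose e := z - (inf U + 3 * inf V) / 4.
  pose e' := (sup U + 3 * sup V) / 4 - z.
  have e0 : 0 < e by rewrite subr_gt0.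
  have e'0 : 0 < e' by rewrite subr_gt0.
  have [x1 Ux1 hx1] := inf_adherent e0 (conj (ex_intro _ x0 Ux0) lbU).
  have [y1 Vy1 hy1] := inf_adherent e0 (conj (ex_intro _ y0 Vy0) lbV).
  have [x2 Ux2 hx2] := sup_adherent e'0 (conj (ex_intro _ x0 Ux0) ubU).
  have [y2 Vy2 hy2] := sup_adherent e'0 (conj (ex_intro _ y0 Vy0) ubV).
  apply: (itI _ _ (UVI _ _ Ux1 Vy1) (UVI _ _ Ux2 Vy2)).
  by move: hx1 hy1 hx2 hy2; rewrite /e /e' => *; apply/andP; split; lra.
apply: (@le_trans _ _ ((sup U - inf U)%:E + 3%:E * (sup V - inf V)%:E)%E).
  by apply: leeD => //; apply: lee_pmul.
apply: (@le_trans _ _ (4%:E * ((sup U + 3 * sup V) / 4 - (inf U + 3 * inf V) / 4)%:E)%E).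
  by rewrite -!EFinM -EFinD lee_fin; lra.
by apply: lee_pmul => //; rewrite lee_fin; lra.
Qed.

(* Normalisation by the suprema makes the level sets [u > t] and [v > t]
   nonempty for all [t < 1] simultaneously. *)
Lemma prekopa_leindler_sup1 (u v h : R -> R) :
  measurable_fun setT u -> measurable_fun setT v -> measurable_fun setT h ->
  (forall x, 0 <= u x <= 1) -> (forall x, 0 <= v x <= 1) -> (forall x, 0 <= h x) ->
  (forall t, t < 1 -> exists x, t < u x) ->
  (forall t, t < 1 -> exists x, t < v x) ->
  (forall t, 0 < t -> is_interval [set x | t < h x]) ->
  (forall t, 0 < t -> exists B, forall x, t < h x -> `|x| <= B) ->
  (forall x y, u x * v y ^+ 3 <= h ((x + 3 * y) / 4) ^+ 4) ->
  (\int[mu]_x (u x)%:E + 3%:E * \int[mu]_x (v x)%:E <= 4%:E * \int[mu]_x (h x)%:E)%E.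
Proof.
move=> mu_ mv mh u01 v01 h0 su sv ih bh uvh.
have mm (w : R -> R) (mw : measurable_fun setT w) :
    measurable_fun (`]0, 1[%classic : set R) (fun t : R => mu [set x | t < w x]).
  apply: measurable_funTS.
  have := measurable_fun_ysection mu (measurable_hypograph mw).
  congr measurable_fun; apply/funext => t /=; congr mu.
  by apply/seteqP; split=> x /=; rewrite /ysection/= inE.
have cake (w : R -> R) : measurable_fun setT w -> (forall x, 0 <= w x <= 1) ->
   (\int[mu]_x (w x)%:E = \int[mu]_(t in `]0%R, 1%R[) mu [set x | (t < w x)%R])%E.
  move=> mw w01; rewrite -integral_layer_cake//; last by move=> x; case/andP: (w01 x).
  apply: eq_integral => x _; congr EFin; apply/esym/min_idPl.
  by case/andP: (w01 x).
apply: (@le_trans _ _ (4%:E * \int[mu]_x (Num.min (h x) 1)%:E)%E); last first.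
  apply: lee_pmul => //.
    by apply: integral_ge0 => x _; rewrite lee_fin le_min h0/=.
  apply: ge0_le_integral => //.
  - by move=> x _; rewrite lee_fin le_min h0/=.
  - by apply/measurable_EFinP; apply: measurable_minr.
  - exact/measurable_EFinP.
  - by move=> x _; rewrite lee_fin ge_min lexx.
rewrite cake// cake// integral_layer_cake//.
have [mmu mmv mmh] := And3 (mm _ mu_) (mm _ mv) (mm _ mh).
rewrite -!ge0_integralZl//.
rewrite -ge0_integralD//; last 2 first.
- by move=> x _; rewrite mule_ge0.
- exact: measurable_funeM.
apply: ge0_le_integral => //.
- by move=> t _; rewrite adde_ge0// mule_ge0.
- by apply: emeasurable_funD => //; exact: measurable_funeM.
- exact: measurable_funeM.
move=> t /=; rewrite in_itv/= => /andP[t0 t1].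
have [B hB] := bh _ t0.
apply: (@brunn_minkowski_interval _ _ _ B); last first.
- move=> x y /= ux vy; rewrite ltNge; apply/negP => ht.
  have := uvh x y; apply/negP; rewrite -ltNge.
  apply: (@le_lt_trans _ _ (t ^+ 4)).
    by rewrite ler_pXn2r// ?nnegrE// ltW.
  rewrite exprS; apply: ltr_pM => //; rewrite ?ltr_pXn2r ?nnegrE ?exprn_ge0// ltW//.
  exact: lt_trans t0 _.
- exact: hB.
- exact: ih.
- exact: sv.
- exact: su.
- exact: measurable_level.
- exact: measurable_level.
- exact: measurable_level.
Qed.

Let phi : R -> R := normal_pdf 0 1.

Let phiE x : phi x = normal_peak 1 * expR (- (x ^+ 2 / 2)).
Proof.
by rewrite /phi normal_pdfE ?oner_eq0// /normal_fun subr0 expr1n mulNr.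
Qed.

Let peak0 : 0 < normal_peak 1 :> R.
Proof. by rewrite normal_peak_gt0// oner_eq0. Qed.

Lemma integral_std_normal (f : R -> \bar R) : measurable_fun setT f ->
  (forall x, 0 <= f x)%E ->
  (\int[normal_prob 0 1]_x f x = \int[mu]_x (f x * (normal_pdf 0 1 x)%:E))%E.
Proof.
move=> mf f0; apply: ge0_integral_density => //.
by apply/measurable_EFinP; exact: measurable_normal_pdf.
Qed.

(** From [x^2/4 + 3 y^2/4 = ((x + 3 y)/4)^2 + 3/16 (x - y)^2] the density satisfies [phi x * phi y
    ^+ 3 = phi ((x + 3 y) / 4) ^+ 4 * expR (- 3/8 (x - y)^2)], and the last factor cancels the bound
    on [f] and [g]. The third function is a multiple of [phi] itself, whose level sets are bounded
    intervals. *)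
Lemma prekopa_leindler_normal (f g : R -> R) : bmf f -> bmf g ->
  (forall x, 0 <= f x) -> (forall x, 0 <= g x) ->
  (forall x y, f x * g y ^+ 3 <= expR (3 / 8 * (x - y) ^+ 2)) ->
  (\int[normal_prob 0 1]_x f x) * (\int[normal_prob 0 1]_x g x) ^+ 3 <= 1.
Proof.
move=> bf bg f0 g0 fg.
have int (w : R -> R) : bmf w -> (forall x, 0 <= w x) ->
    (\int[normal_prob 0 1]_x w x)%:E = (\int[mu]_x (w x * phi x)%:E)%E.
  move=> bw w0; rewrite EFin_Rintegral; last exact: bmf_integrable.
  by rewrite integral_std_normal//; apply/measurable_EFinP; case: bw.
have int0 (w : R -> R) : (forall x, 0 <= w x) -> ~ ~ (forall x, w x <= 0) ->
    \int[normal_prob 0 1]_x w x = 0.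
  move=> w0 zw; transitivity (\int[normal_prob 0 1]_x (0 : R)); last exact: Rintegral_prob_cst.
  by apply: eq_Rintegral => x _; apply/eqP; rewrite eq_le w0 andbT (contrapT zw).
have [/existsNP[x0 /negP fx0]|zf] := pselect (~ forall x, f x <= 0); last first.
  by rewrite int0// mul0r ler01.
have [/existsNP[y0 /negP gy0]|zg] := pselect (~ forall x, g x <= 0); last first.
  by rewrite (int0 g)// expr0n mulr0 ler01.
move: fx0 gy0; rewrite -!ltNge => fx0 gy0.
have phi0 x : 0 < phi x by rewrite phiE mulr_gt0// expR_gt0.
have mphi : measurable_fun setT phi by exact: measurable_normal_pdf.
have sup1 (w : R -> R) w0 : bmf w -> 0 < w w0 -> (forall x, 0 <= w x) -> exists a : R, [/\ 0 < a,
    forall x, 0 <= w x * phi x / a <= 1 & forall t, t < 1 -> exists x, t < w x * phi x / a].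
  move=> [mw [M hM]] w00 wge0; pose a := sup (range (fun x => w x * phi x)).
  have hs : has_sup (range (fun x => w x * phi x)).
    split; first by exists (w w0 * phi w0), w0.
    exists (M * normal_peak 1) => _ [x _ <-].
    apply: ler_pM => //; first exact: ltW.
      exact: le_trans (ler_norm _) (hM x).
    by rewrite normal_pdf_ub// oner_eq0.
  have ub x : w x * phi x <= a by apply: ub_le_sup; [exact: hs.2|exists x].
  have a0 : 0 < a by apply: lt_le_trans (ub w0); rewrite mulr_gt0.
  exists a; split=> // [x|t t1].
    rewrite divr_ge0 ?mulr_ge0 ?(ltW (phi0 _)) ?(ltW a0)//=.
    by rewrite ler_pdivrMr// mul1r.
  have e0 : 0 < a - t * a by rewrite subr_gt0 gtr_pMl.
  have [_ [x _ <-]] := sup_adherent e0 hs.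
  by rewrite subKr => h; exists x; rewrite ltr_pdivlMr.
have [a [a0 ua sa]] := sup1 f x0 bf fx0 f0.
have [b [b0 ub sb]] := sup1 g y0 bg gy0 g0.
(* The fourth root of [a * b ^+ 3], the factor by which the two normalisations change
   [f x * g y ^+ 3]. *)
pose c := Num.sqrt (Num.sqrt (a * b ^+ 3)).
have c4 : c ^+ 4 = a * b ^+ 3.
  rewrite (exprM c 2 2) !sqr_sqrtr ?sqrtr_ge0// mulr_ge0 ?exprn_ge0// ltW//.
have c0 : 0 < c by rewrite !sqrtr_gt0 mulr_gt0 ?exprn_gt0.
have := @prekopa_leindler_sup1 (fun x => f x * phi x / a) (fun x => g x * phi x / b)
  (fun x => phi x / c).
have mdiv (w : R -> R) (k : R) : measurable_fun setT w -> measurable_fun setT (fun x => w x * phi x / k).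
  by move=> mw; apply: measurable_funM => //; exact: measurable_funM.
move=> /(_ (mdiv _ _ (bmf_meas bf)) (mdiv _ _ (bmf_meas bg))).
have mh : measurable_fun setT (fun x => phi x / c) by exact: measurable_funM.
have h0 x : 0 <= phi x / c by rewrite divr_ge0// ltW.
move=> /(_ mh ua ub h0 sa sb).
have hlt t x : (t < phi x / c) = (t * c / normal_peak 1 < expR (- (x ^+ 2 / 2))).
  by rewrite ltr_pdivlMr// phiE ltr_pdivrMr// [X in _ = (_ < X)]mulrC.
have h1 t : 0 < t -> is_interval [set x | t < phi x / c].
  move=> t0 x y /= xt yt z /andP[xz zy].
  move: xt yt; rewrite !hlt => xt yt.
  have : z ^+ 2 <= Num.max (x ^+ 2) (y ^+ 2).
    rewrite le_max; apply/orP; have [z0|z0] := leP 0 z.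
      by right; rewrite ler_sqr// nnegrE// (le_trans z0).
    by left; rewrite -(sqrrN z) -(sqrrN x) ler_sqr ?nnegrE; lra.
  rewrite le_max => /orP[] h; [apply: (lt_le_trans xt)|apply: (lt_le_trans yt)];
    by rewrite ler_expR lerN2 ler_pM2r.
have h2 t : 0 < t -> exists B, forall x, t < phi x / c -> `|x| <= B.
  move=> t0; pose k := t * c / normal_peak 1.
  have k0 : 0 < k by rewrite divr_gt0// mulr_gt0.
  exists (1 + 2 / k) => x; rewrite hlt -/k expRN => h.
  have h3 : 1 + x ^+ 2 / 2 < k^-1.
    apply: le_lt_trans (expR_ge1Dx _) _.
    by rewrite -[ltLHS]invrK ltf_pV2 ?posrE ?invr_gt0 ?expR_gt0.
  apply: (@le_trans _ _ (1 + x ^+ 2)).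
    have := sqr_ge0 (`|x| - 1 / 2); rewrite sqrrB real_normK ?num_real//; lra.
  lra.
move=> /(_ h1 h2).
have h3 x y : f x * phi x / a * (g y * phi y / b) ^+ 3 <= (phi ((x + 3 * y) / 4) / c) ^+ 4.
  rewrite [X in _ <= X]expr_div_n c4 ler_pdivlMr ?mulr_gt0 ?exprn_gt0//.
  have -> : f x * phi x / a * (g y * phi y / b) ^+ 3 * (a * b ^+ 3) =
      f x * g y ^+ 3 * (phi x * phi y ^+ 3).
    by field; rewrite !gt_eqF.
  apply: (@le_trans _ _ (expR (3 / 8 * (x - y) ^+ 2) * (phi x * phi y ^+ 3))).
    by rewrite ler_wpM2r// ltW// mulr_gt0// exprn_gt0.
  have -> : phi x * phi y ^+ 3 =
      normal_peak 1 ^+ 4 * expR (- (x ^+ 2 / 2) + 3 * - (y ^+ 2 / 2)).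
    by rewrite !phiE expRD (expRM_natl 3%N); ring.
  rewrite mulrCA phiE exprMn ler_pM2l ?exprn_gt0// -expRD -(expRM_natl 4%N) ler_expR.
  by rewrite le_eqVlt; apply/orP; left; apply/eqP; field.
move=> /(_ h3).
have intE (w : R -> R) (k : R) : 0 < k -> bmf w -> (forall x, 0 <= w x) ->
    (\int[mu]_x (w x * phi x / k)%:E)%E = ((\int[normal_prob 0 1]_x w x) / k)%:E.
  move=> k0 bw w0; under eq_integral do rewrite EFinM.
  rewrite ge0_integralZr//; last 3 first.
  - by apply/measurable_EFinP; apply: measurable_funM => //; exact: bmf_meas.
  - by move=> x _; rewrite lee_fin mulr_ge0// ltW.
  - by rewrite lee_fin invr_ge0 ltW.
  by rewrite -int// -EFinM.
have intphi : (\int[mu]_x (phi x / c)%:E)%E = c^-1%:E.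
  under eq_integral do rewrite EFinM.
  rewrite ge0_integralZr//; last 3 first.
  - exact/measurable_EFinP.
  - by move=> x _; rewrite lee_fin ltW.
  - by rewrite lee_fin invr_ge0 ltW.
  by rewrite integral_normal_pdf mul1e.
rewrite !intE// intphi -!EFinM -EFinD lee_fin.
set A := \int[normal_prob 0 1]_x f x; set B := \int[normal_prob 0 1]_x g x => hAB.
have A0 : 0 <= A by exact: Rintegral_ge0.
have B0 : 0 <= B by exact: Rintegral_ge0.
have h4 : ((A / a + 3 * (B / b)) / 4) ^+ 4 <= c^-1 ^+ 4.
  have ? : 0 <= A / a by rewrite divr_ge0// ltW.
  have ? : 0 <= B / b by rewrite divr_ge0// ltW.
  rewrite ler_pXn2r// ?nnegrE ?invr_ge0 ?(ltW c0)//; lra.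
have := le_trans (AM_GM4 (A / a) (B / b)) h4.
rewrite exprVn c4 (_ : A / a * _ = A * B ^+ 3 / (a * b ^+ 3)); last first.
  by field; rewrite !gt_eqF.
by rewrite -[leRHS]mul1r ler_pM2r// invr_gt0 mulr_gt0// exprn_gt0.
Qed.

End prekopa_leindler.

(** * Affine substitutions, rotations and independent Gaussian variables *)

Section affine_change.
Context {R : realType}.
Local Notation mu := (@lebesgue_measure R).

Lemma ge0_integral_affine (a b : R) (f : R -> \bar R) : a != 0 ->
  measurable_fun setT f -> (forall x, 0 <= f x)%E ->
  (\int[mu]_x f x = `|a|%:E * \int[mu]_x f (a * x + b)%R)%E.
Proof.
move=> a0 mf f0.
pose F (x : measurableTypeR R) : measurableTypeR R := a * (x : R) + b.
have mF : measurable_fun setT F.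
  by apply: measurable_funD => //; exact: measurable_funM.
pose k : {nonneg R} := NngNum (normr_ge0 a).
pose m0 : {measure set (measurableTypeR R) -> \bar R} := mscale k (pushforward mu F).
pose m := m0 mF.
have muE (A : set R) (mA : measurable A) : mu A = m A.
  move: A mA; apply: (@lebesgue_measure_unique R m) => _ [[u v] _ <-].
  have -> : m `]u, v]%classic = (`|a|%:E * mu (F @^-1` `]u, v]%classic))%E by [].
  have [uv|vu] := ltP u v; last first.
    rewrite set_itv_ge ?preimage_set0 ?measure0 ?mule0//.
    by rewrite bnd_simp/= -leNgt.
  have [a_gt0|a_lt0|a00] := ltgtP 0 a; last by rewrite a00 eqxx in a0.
    rewrite (_ : F @^-1` _ = `](u - b) / a, (v - b) / a]%classic); last first.
      apply/seteqP; split=> x /=; rewrite !in_itv/=;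
      by rewrite ltr_pdivrMr// ler_pdivlMr// [x * a]mulrC ltrBlDr lerBrDr.
    rewrite !lebesgue_measure_itv/= !lte_fin uv ltr_pM2r ?invr_gt0// ltrD2r uv.
    rewrite -!EFinB -EFinM gtr0_norm//; congr EFin.
    by field.
  rewrite (_ : F @^-1` _ = `[(v - b) / a, (u - b) / a[%classic); last first.
    apply/seteqP; split=> x /=; rewrite !in_itv/=;
    by rewrite ler_ndivrMr// ltr_ndivlMr// [x * a]mulrC ltrBlDr lerBrDr andbC.
  rewrite !lebesgue_measure_itv/= !lte_fin uv ltr_nM2r ?invr_lt0// ltrD2r uv.
  rewrite -!EFinB -EFinM ltr0_norm//; congr EFin.
  by field.
rewrite (eq_measure_integral m); last by move=> A mA _; exact: muE.
rewrite ge0_integral_mscale// ge0_integral_pushforward//.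
Qed.

End affine_change.

Section rotation.
Context {R : realType}.
Local Notation mu := (@lebesgue_measure R).
Local Notation gamma := (@normal_prob R 0 1).

(** The sign of [s] is free, since the density depends on [s ^+ 2] only; the value [s = -1] later
    serves as the reflection. *)
Lemma ge0_integral_normal (m s : R) (f : R -> \bar R) : s != 0 ->
  measurable_fun setT f -> (forall x, 0 <= f x)%E ->
  (\int[mu]_x (f x * (normal_pdf m s x)%:E) =
   \int[gamma]_x f (m + s * x)%R)%E.
Proof.
move=> s0 mf f0.
have mpdf m' s' : measurable_fun setT (fun x => (normal_pdf m' s' x)%:E : \bar R).
  by apply/measurable_EFinP; exact: measurable_normal_pdf.
have maff : measurable_fun setT (fun x : R => m + s * x).
  by apply: measurable_funD; [|apply: measurable_funM].
have maff' : measurable_fun setT (fun x : R => s * x + m).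
  by apply: measurable_funD; [apply: measurable_funM|].
have mfa : measurable_fun setT (fun x => f (m + s * x)) := measurableT_comp mf maff.
rewrite (integral_std_normal mfa (fun x => f0 _)).
have mg : measurable_fun setT (fun x => f x * (normal_pdf m s x)%:E)%E.
  exact: emeasurable_funM.
have g0 x : (0 <= f x * (normal_pdf m s x)%:E)%E.
  by rewrite mule_ge0// lee_fin normal_pdf_ge0.
rewrite (ge0_integral_affine m s0 mg g0).
have s0' : (0 <= `|s|%:E)%E by rewrite lee_fin.
rewrite -(ge0_integralZl mu measurableT (measurableT_comp mg maff') (fun x _ => g0 _) s0').
apply: eq_integral => x _; rewrite muleCA [s * x + m]addrC; congr (_ * _)%E.
rewrite -EFinM !normal_pdfE ?oner_eq0//; congr EFin.
rewrite /normal_fun addrAC subrr add0r subr0 expr1n /normal_peak expr1n.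
have -> : - (s * x) ^+ 2 / (s ^+ 2 *+ 2) = - x ^+ 2 / (1 *+ 2) by field.
rewrite mulrA; congr (_ * _).
rewrite -mulrnAr sqrtrM ?sqr_ge0// sqrtr_sqr mul1r.
by rewrite invfM mulrA divff ?mul1r// normr_eq0.
Qed.

(** Given [x], the variable [al x + be y] has density [normal_pdf (al x) be], and this kernel is
    reversible for the standard normal density [phi]: [phi x * normal_pdf (al x) be z = phi z *
    normal_pdf (al z) be x]. Tonelli then integrates [x] out. For [be = 0] the kernel has no
    density, hence the separate case. *)
Lemma normal_rotation (al be : R) (h : R -> R) : al ^+ 2 + be ^+ 2 = 1 ->
  measurable_fun setT h -> (forall x, 0 <= h x) ->
  (\int[gamma]_x \int[gamma]_y (h (al * x + be * y))%:E = \int[gamma]_z (h z)%:E)%E.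
Proof.
move=> ab mh h0.
have meh : measurable_fun setT (fun x => (h x)%:E) by exact/measurable_EFinP.
have eh0 x : (0 <= (h x)%:E)%E by rewrite lee_fin.
have [be0|be0] := eqVneq be 0.
  have al1 : al ^+ 2 = 1 by rewrite -ab be0 expr0n addr0.
  have al0 : al != 0 by rewrite -sqrf_eq0 al1 oner_eq0.
  transitivity (\int[gamma]_x (h (0 + al * x))%:E)%E.
    apply: eq_integral => x _; rewrite add0r.
    transitivity (\int[gamma]_y (cst (h (al * x))%:E) y)%E.
      by apply: eq_integral => y _; rewrite be0 mul0r addr0.
    by rewrite integral_cst// [X in (_ * X)%E](@probability_setT _ _ _ gamma) mule1.
  rewrite -(@ge0_integral_normal 0 al (fun x => (h x)%:E) al0 meh eh0).
  rewrite (integral_std_normal meh eh0); apply: eq_integral => x _; congr (_ * _%:E)%E.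
  by rewrite !normal_pdfE ?oner_eq0// /normal_peak /normal_fun al1 expr1n.
transitivity (\int[gamma]_x \int[mu]_z ((h z)%:E * (normal_pdf (al * x) be z)%:E))%E.
  apply: eq_integral => x _.
  by rewrite (@ge0_integral_normal (al * x) be (fun x => (h x)%:E) be0 meh eh0).
have mpdf2 : measurable_fun setT (fun xz : R * R => (normal_pdf (al * xz.1) be xz.2)%:E).
  apply/measurable_EFinP; rewrite (_ : (fun _ => _) = (fun xz : R * R => normal_pdf 0 be (xz.2 - al * xz.1))); last first.
    by apply/funext => -[x z]; rewrite !normal_pdfE// /normal_fun/= subr0.
  apply: measurableT_comp; first exact: measurable_normal_pdf.
  apply: measurable_funB => //.
  by apply: measurable_funM => //.
have mf : measurable_fun setT (fun xz : R * R => (h xz.2)%:E * (normal_pdf (al * xz.1) be xz.2)%:E)%E.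
  by apply: emeasurable_funM => //; apply: (measurableT_comp meh).
have f0 (xz : R * R) : (0 <= (h xz.2)%:E * (normal_pdf (al * xz.1) be xz.2)%:E)%E.
  by rewrite mule_ge0// lee_fin// normal_pdf_ge0.
rewrite (@fubini_tonelli _ _ _ _ _ gamma mu _ mf f0)/=.
rewrite (integral_std_normal meh eh0); apply: eq_integral => z _.
have mz : measurable_fun setT (fun x => (normal_pdf (al * x) be z)%:E).
  have mp : measurable_fun setT (fun x : R => (x, z)).
    by apply: measurable_fun_pair; [exact: measurable_id|exact: measurable_cst].
  exact: (measurableT_comp mpdf2 mp).
have z0 x : (0 <= (normal_pdf (al * x) be z)%:E)%E by rewrite lee_fin normal_pdf_ge0.
rewrite (ge0_integralZl gamma measurableT mz (fun x _ => z0 x) (eh0 z)).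
congr (_ * _)%E; rewrite (integral_std_normal mz z0).
transitivity (\int[mu]_x ((normal_pdf 0 1 z)%:E * (normal_pdf (al * z) be x)%:E))%E; last first.
  have my : measurable_fun setT (fun x : R => (normal_pdf (al * z) be x)%:E).
    by apply/measurable_EFinP; exact: measurable_normal_pdf.
  have p0 m s x : (0 <= (normal_pdf m s x : R)%:E)%E by rewrite lee_fin normal_pdf_ge0.
  rewrite (ge0_integralZl mu measurableT my (fun x _ => p0 _ _ x) (p0 _ _ z)).
  by rewrite integral_normal_pdf mule1.
apply: eq_integral => x _; rewrite -!EFinM !normal_pdfE ?oner_eq0//; congr EFin.
rewrite mulrACA [RHS]mulrACA; congr (_ * _); first by rewrite mulrC.
rewrite /normal_fun -!expRD; congr expR; rewrite !subr0 expr1n.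
transitivity ((- be ^+ 2 * x ^+ 2 - (z - al * x) ^+ 2) / (be ^+ 2 *+ 2)); first by field.
transitivity ((- be ^+ 2 * z ^+ 2 - (x - al * z) ^+ 2) / (be ^+ 2 *+ 2)); last by field.
congr (_ / _); have -> : be ^+ 2 = 1 - al ^+ 2 by rewrite -ab; ring.
by ring.
Qed.

Lemma Rintegral_cos_rotation (a s c : R) :
  \int[gamma]_x \int[gamma]_y cos (a * x + s * y + c) =
  \int[gamma]_z cos (Num.sqrt (a ^+ 2 + s ^+ 2) * z + c).
Proof.
set t := Num.sqrt _.
have t2 : t ^+ 2 = a ^+ 2 + s ^+ 2 by rewrite sqr_sqrtr// addr_ge0 ?sqr_ge0.
have [t0|t0] := eqVneq t 0.
  have /andP[/eqP a0 /eqP s0] : (a == 0) && (s == 0).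
    by move: t2; rewrite t0 expr0n => /esym/eqP; rewrite paddr_eq0 ?sqr_ge0// !sqrf_eq0.
  have -> : (fun z => cos (t * z + c)) = cst (cos c).
    by apply/funext => z; rewrite t0 mul0r add0r.
  have -> : (fun x => \int[gamma]_y cos (a * x + s * y + c)) = cst (cos c).
    apply/funext => x /=; rewrite -[RHS](Rintegral_prob_cst gamma).
    by apply: eq_Rintegral => y _; rewrite a0 s0 !mul0r !add0r.
  by [].
have ab1 : (a / t) ^+ 2 + (s / t) ^+ 2 = 1.
  by rewrite !expr_div_n -mulrDl -t2 divff// expf_neq0.
have maff (k l : R) : measurable_fun setT (fun x : R => k * x + l).
  by apply: measurable_funD; [apply: measurable_funM|].
(* Adding 1 makes the cosine nonnegative, as the Tonelli form of rotation invariance requires. *)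
pose h u := cos (t * u + c) + 1.
have bh : bmf h.
  have := bmfD (bmf_cos (maff t c)) (bmf_cst 1); exact.
have h0 u : 0 <= h u by rewrite /h -lerBlDr sub0r cos_geN1.
have := normal_rotation ab1 (bmf_meas bh) h0.
rewrite -(EFin_Rintegral (bmf_integrable gamma bh)).
have hE x y : h (a / t * x + s / t * y) = cos (s * y + (a * x + c)) + 1.
  by rewrite /h; congr (cos _ + 1); field.
have byh x : bmf (fun y => cos (s * y + (a * x + c)) + 1).
  have := bmfD (bmf_cos (maff s (a * x + c))) (bmf_cst 1); exact.
have int1 x : (\int[gamma]_y (h (a / t * x + s / t * y))%:E)%E =
    (\int[gamma]_y cos (a * x + s * y + c) + 1)%:E.
  under eq_integral do rewrite hE.
  rewrite -(EFin_Rintegral (bmf_integrable gamma (byh x))).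
  congr EFin; rewrite RintegralD//; last 2 first.
  - by apply: bmf_integrable; apply: bmf_cos; exact: maff.
  - by apply: bmf_integrable; exact: bmf_cst.
  rewrite Rintegral_prob_cst; congr (_ + _); apply: eq_Rintegral => y _.
  by congr cos; ring.
under eq_integral do rewrite int1.
have bb : bmf (fun xy : R * R => cos (a * xy.1 + s * xy.2 + c)).
  apply: bmf_cos; apply: measurable_funD => //; apply: measurable_funD.
    by apply: measurable_funM.
  by apply: measurable_funM.
have bi := bmf_Rintegral_section gamma gamma bb.
rewrite -(EFin_Rintegral (bmf_integrable gamma (bmfD bi (bmf_cst 1)))).
move=> [].
rewrite RintegralD//; last 2 first.
- by apply: bmf_integrable.
- by apply: bmf_integrable; exact: bmf_cst.
rewrite Rintegral_prob_cst [X in _ = X]RintegralD//; last 2 first.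
- by apply: bmf_integrable; apply: bmf_cos; exact: maff.
- by apply: bmf_integrable; exact: bmf_cst.
by rewrite Rintegral_prob_cst => /addIr.
Qed.

(** The space is left abstract: only the law of linear combinations and the tensorised inequality
    are used. In the induction step the first coordinates [x], [x'] are frozen and [f] is multiplied
    by [expR (- k)] with [k = 3/8 (x - x')^2]; the inequality on the fibres is then the
    one-dimensional hypothesis for the fibre integrals. *)
Lemma std_gaussian_source r :
  exists d (E : measurableType d) (m : probability E R) (G : 'I_r -> E -> R),
  [/\ forall j, measurable_fun setT (G j),
     forall a c, \int[m]_x cos (\sum_j a j * G j x + c) =
       \int[gamma]_x cos (Num.sqrt (\sum_j a j ^+ 2) * x + c) &
     forall f g : E -> R, bmf f -> bmf g ->
       (forall x, 0 <= f x) -> (forall x, 0 <= g x) ->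
       (forall x y, f x * g y ^+ 3 <= expR (3 / 8 * \sum_j (G j x - G j y) ^+ 2)) ->
       (\int[m]_x f x) * (\int[m]_x g x) ^+ 3 <= 1].
Proof.
elim: r => [|r [d [E [m [G [mG cosG PL]]]]]].
  exists _, unit, (dirac tt : probability _ _), (fun _ _ => 0); split.
  - by [].
  - move=> a c; rewrite !big_ord0 sqrtr0.
    have -> : (fun x : R => cos (0 * x + c)) = cst (cos c).
      by apply/funext => x; rewrite mul0r add0r.
    by rewrite add0r (Rintegral_prob_cst gamma) (Rintegral_prob_cst (dirac tt : probability unit R)).
  - move=> f g bf bg f0 g0 /(_ tt tt).
    rewrite big_ord0 mulr0 expR0.
    have e (h : unit -> R) : \int[dirac tt : probability _ R]_x h x = h tt.
      rewrite -[RHS](Rintegral_prob_cst (dirac tt : probability unit R)).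
      by apply: eq_Rintegral => -[] _.
    by rewrite !e.
pose R' := measurableTypeR R.
pose G' (j : 'I_r.+1) (x : R' * E) : R := oapp (fun j' => G j' x.2) x.1 (unlift ord0 j).
exists _, (R' * E)%type, ((gamma : probability _ _) \x m : probability _ _)%E, G'.
have G0 x : G' ord0 x = x.1 by rewrite /G' unlift_none.
have GS x j : G' (lift ord0 j) x = G j x.2 by rewrite /G' liftK.
have mG' j : measurable_fun setT (G' j).
  rewrite /G'; case: unliftP => [j' _|_] /=; last exact: measurable_fst.
  exact: (measurableT_comp (mG j')).
split=> //.
- move=> a c.
  have bb : bmf (fun x : R' * E => cos (\sum_j a j * G' j x + c)).
    apply: bmf_cos.
    apply: measurable_funD; last exact: measurable_cst.
    apply: measurable_sum => i.
    by apply: measurable_funM; [exact: measurable_cst|exact: mG'].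
  rewrite -(Rintegral_prod gamma m bb).
  rewrite big_ord_recl; set s := \sum_(i < r) _.
  have s0 : 0 <= s by apply: sumr_ge0 => j _; exact: sqr_ge0.
  rewrite -(sqr_sqrtr s0) -Rintegral_cos_rotation.
  apply: eq_Rintegral => x _.
  under eq_Rintegral => y _.
    rewrite big_ord_recl G0/= addrAC addrC -/(x).
    under eq_bigr do rewrite GS/=.
    over.
  rewrite cosG; apply: eq_Rintegral => y _; congr cos; rewrite -/s; ring.
- move=> f g bf bg f0 g0 fg.
  have int (h : R' * E -> R) : bmf h -> \int[(gamma \x m)%E]_z h z =
      \int[gamma]_x \int[m]_y h (x, y).
    by move=> bh; rewrite Rintegral_prod.
  rewrite !int//; apply: prekopa_leindler_normal.
  - exact: (bmf_Rintegral_section gamma m bf).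
  - exact: (bmf_Rintegral_section gamma m bg).
  - by move=> x; exact: Rintegral_ge0.
  - by move=> x; exact: Rintegral_ge0.
  move=> x x'; set k := 3 / 8 * _.
  have bfx := bmf_section bf x; have bgx := bmf_section bg x'.
  have := PL (fun y => expR (- k) * f (x, y)) (fun y => g (x', y)).
  move=> /(_ (bmfZ _ bfx) bgx) h.
  have := h (fun y => mulr_ge0 (expR_ge0 _) (f0 _)) (fun y => g0 _).
  rewrite RintegralZl//; last exact: bmf_integrable.
  rewrite -mulrA expRN ler_pdivrMl ?expR_gt0// mulr1; apply.
  move=> y y'; rewrite /= -mulrA. rewrite ler_pdivrMl ?expR_gt0// -expRD.
  have := fg (x, y) (x', y'); rewrite big_ord_recl !G0/=.
  by under eq_bigr do rewrite !GS/=; rewrite mulrDr.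
Qed.

End rotation.

(** * Characteristic functions determine laws of random vectors *)

Section smoothstep.
Context {R : realType}.

(** A polynomial, so it acts on any algebra of functions. It fixes 0, 1/2 and 1, and its iterates
    drive [[0, 1/2[] to 0 and []1/2, 1]] to 1: indicators of level sets arise as limits of
    polynomials. *)
Definition smoothstep (t : R) := 3 * t ^+ 2 - 2 * t ^+ 3.

Lemma smoothstep01 t : 0 <= t <= 1 -> 0 <= smoothstep t <= 1.
Proof.
move=> /andP[t0 t1]; rewrite /smoothstep; apply/andP; split.
  have -> : 3 * t ^+ 2 - 2 * t ^+ 3 = t ^+ 2 * (3 - 2 * t) by ring.
  by rewrite mulr_ge0 ?sqr_ge0//; lra.
rewrite -subr_ge0.
have -> : 1 - (3 * t ^+ 2 - 2 * t ^+ 3) = (1 - t) ^+ 2 * (1 + 2 * t) by ring.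
by rewrite mulr_ge0 ?sqr_ge0//; lra.
Qed.

Lemma smoothstep_onem t : smoothstep (1 - t) = 1 - smoothstep t.
Proof. by rewrite /smoothstep; ring. Qed.

Lemma iter_smoothstep01 n t : 0 <= t <= 1 -> 0 <= iter n smoothstep t <= 1.
Proof. by move=> t01; elim: n => //= n; exact: smoothstep01. Qed.

Lemma iter_smoothstep_onem n t :
  iter n smoothstep (1 - t) = 1 - iter n smoothstep t.
Proof. by elim: n => //= n ->; rewrite smoothstep_onem. Qed.

Lemma cvg_iter_smoothstep_lt t : 0 <= t < 1 / 2 ->
  iter n smoothstep t @[n --> \oo] --> (0 : R).
Proof.
(* [smoothstep s = s * (s * (3 - 2 * s))], and the second factor is at most [q] on [[0, t]]. As
   [1 - q = (1 - t) (1 - 2 t) > 0], the convergence is geometric. *)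
move=> /andP[t0 t2]; pose q := t * (3 - 2 * t).
have q01 : 0 <= q < 1.
  apply/andP; split; first by rewrite mulr_ge0//; lra.
  rewrite -subr_gt0 (_ : 1 - q = (1 - t) * (1 - 2 * t)); last by rewrite /q; ring.
  by rewrite mulr_gt0//; lra.
have h n : 0 <= iter n smoothstep t <= t * q ^+ n.
  elim: n => [|n /andP[h0 h1]]; first by rewrite expr0 mulr1 t0/=.
  have ht : iter n smoothstep t <= t.
    apply: le_trans h1 _; rewrite ler_piMr// exprn_ile1//; lra.
  have ht1 : 0 <= iter n smoothstep t <= 1 by apply/andP; split=> //; lra.
  have /andP[hs _] := smoothstep01 ht1.
  rewrite iterS hs/= exprSr mulrA.
  have -> : smoothstep (iter n smoothstep t) =
     iter n smoothstep t * (iter n smoothstep t * (3 - 2 * iter n smoothstep t)).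
    by rewrite /smoothstep; ring.
  apply: ler_pM => //.
    by rewrite mulr_ge0//; lra.
  rewrite /q -subr_ge0; set s := iter _ _ _.
  have -> : t * (3 - 2 * t) - s * (3 - 2 * s) = (t - s) * (3 - 2 * (t + s)) by ring.
  by rewrite mulr_ge0//; move: ht; rewrite -/s; lra.
apply: (@squeeze_cvgr _ _ _ _ (cst 0) (fun n => t * q ^+ n)).
- by apply: nearW => n; exact: h.
- exact: cvg_cst.
- rewrite -[X in _ --> X](mulr0 t); apply: cvgMr; apply: cvg_expr.
  by rewrite ger0_norm; lra.
Qed.

Lemma cvg_iter_smoothstep t : 0 <= t <= 1 ->
  iter n smoothstep t @[n --> \oo] --> (((1 / 2 < t)%R%:R + (1 / 2 <= t)%R%:R) / 2 : R).
Proof.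
move=> /andP[t0 t1]; have [t2|t2|t2] := ltgtP (1 / 2) t.
- rewrite (_ : (_ + _) / 2 = 1 - 0); last by rewrite /=; field.
  rewrite (_ : (fun n => _) = (fun n => 1 - iter n smoothstep (1 - t))); last first.
    by apply/funext => n; rewrite iter_smoothstep_onem subKr.
  by apply: cvgB; [exact: cvg_cst|apply: cvg_iter_smoothstep_lt; lra].
- rewrite (_ : (_ + _) / 2 = 0); last by rewrite /=; field.
  by apply: cvg_iter_smoothstep_lt; rewrite t0.
- rewrite (_ : (_ + _) / 2 = 1 / 2); last by rewrite /=; field.
  rewrite (_ : (fun n => _) = cst (1 / 2)); first exact: cvg_cst.
  by apply/funext => n; rewrite -t2; elim: n => //= n ->; rewrite /smoothstep; field.
Qed.

End smoothstep.

Section charfun.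
Context {R : realType} {N : nat}.
Local Notation E := (N.-tuple R).

(* The smallest algebra of functions containing the trigonometric functions
   and closed under bounded pointwise limits. *)
Inductive trig_closure : (E -> R) -> Prop :=
| trig_cos (a : 'I_N -> R) (c : R) :
    trig_closure (fun z => cos (\sum_i a i * tnth z i + c))
| trig_lin (k : R) f g : trig_closure f -> trig_closure g ->
    trig_closure (fun z => k * f z + g z)
| trig_lim (F : nat -> E -> R) f M : (forall n, trig_closure (F n)) ->
    (forall n z, `|F n z| <= M) -> (forall z, F n z @[n --> \oo] --> f z) ->
    trig_closure f.

Lemma trig_cst k : trig_closure (cst k).
Proof.
have h := trig_cos (cst 0) 0.
have {h} h : trig_closure (cst 1).
  move: h; congr trig_closure; apply/funext => z /=.
  by rewrite big1 ?addr0 ?cos0// => i _; rewrite mul0r.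
have h0 : trig_closure (cst 0).
  have := trig_lin (-1) h h; congr trig_closure; apply/funext => z /=.
  by rewrite mulN1r addNr.
have := trig_lin k h h0; congr trig_closure; apply/funext => z /=.
by rewrite mulr1 addr0.
Qed.

Lemma trigD f g : trig_closure f -> trig_closure g -> trig_closure (fun z => f z + g z).
Proof.
move=> hf hg; have := trig_lin 1 hf hg; congr trig_closure.
by apply/funext => z; rewrite mul1r.
Qed.

Lemma trigZ k f : trig_closure f -> trig_closure (fun z => k * f z).
Proof.
move=> hf; have := trig_lin k hf (trig_cst 0); congr trig_closure.
by apply/funext => z; rewrite addr0.
Qed.

Lemma trig_bmf f : trig_closure f -> bmf f.
Proof.
elim=> [a c|k {}f g _ bf _ bg|F {}f M hF bF FM Ff].
- apply: bmf_cos; apply: measurable_funD; last exact: measurable_cst.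
  apply: measurable_sum => i.
  by apply: measurable_funM; [exact: measurable_cst|exact: measurable_tnth].
- by apply: bmfD => //; exact: bmfZ.
- exact: bmf_cvg (fun n => bmf_meas (bF n)) FM Ff.
Qed.

(** Products are not a constructor of the closure, which keeps inductions over it linear. For
    generators the product-to-sum formula applies; linear combinations and bounded limits commute
    with multiplication. *)
Lemma trig_mul_cos a c f : trig_closure f ->
  trig_closure (fun z => cos (\sum_i a i * tnth z i + c) * f z).
Proof.
elim=> [a' c'|k {}f g _ hf _ hg|F {}f M _ hF FM Ff].
- pose s := trig_cos (fun i => a i + a' i) (c + c').
  pose s' := trig_cos (fun i => a i - a' i) (c - c').
  have := trigZ (1 / 2) (trigD s s'); congr trig_closure; apply/funext => z.
  under eq_bigr do rewrite mulrDl.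
  under [X in cos (X + (c - c'))]eq_bigr do rewrite mulrBl.
  rewrite big_split sumrB/= addrACA [X in _ + cos X](_ : _ =
    (\sum_i a i * tnth z i + c) - (\sum_i a' i * tnth z i + c')); last ring.
  by rewrite cosB cosD; field.
- have := trig_lin k hf hg; congr trig_closure; apply/funext => z.
  by rewrite mulrDr mulrCA.
- apply: (trig_lim (M := M) hF) => [n z|z].
    rewrite normrM -[leRHS]mul1r ler_pM//.
    by rewrite ler_norml cos_geN1 cos_le1.
  by apply: cvgMr; exact: Ff.
Qed.

Lemma trigM f g : trig_closure f -> trig_closure g -> trig_closure (fun z => f z * g z).
Proof.
move=> + hg; elim=> [a c|k {}f f' _ hf _ hf'|F {}f M _ hF FM Ff].
- exact: trig_mul_cos.
- have := trig_lin k hf hf'; congr trig_closure; apply/funext => z.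
  by rewrite mulrDl mulrA.
- have [_ [K hK]] := trig_bmf hg.
  apply: (trig_lim (M := M * K) hF) => [n z|z].
    by rewrite normrM ler_pM.
  by apply: cvgMl; exact: Ff.
Qed.

Lemma trigX f n : trig_closure f -> trig_closure (fun z => f z ^+ n).
Proof.
move=> hf; elim: n => [|n IH]; first exact: trig_cst.
by have := trigM hf IH; congr trig_closure; apply/funext => z; rewrite exprS.
Qed.

(** The iterated smoothstep of [f] tends to the indicator, except for the value 1/2 where [f = 1/2];
    powers of this limit send 1/2 to 0. *)
Lemma trig_level f : trig_closure f -> (forall z, 0 <= f z <= 1) ->
  trig_closure (fun z => (1 / 2 < f z)%R%:R).
Proof.
move=> hf f01.
have hn n : trig_closure (fun z => iter n smoothstep (f z)).
  elim: n => //= n IH.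
  have := trigD (trigZ 3 (trigX 2 IH)) (trigZ (-2) (trigX 3 IH)).
  by congr trig_closure; apply/funext => z; rewrite /smoothstep mulNr.
have h : trig_closure (fun z => ((1 / 2 < f z)%R%:R + (1 / 2 <= f z)%R%:R) / 2).
  apply: (trig_lim (M := 1) hn) => [n z|z]; last exact: cvg_iter_smoothstep.
  by have /andP[? ?] := iter_smoothstep01 n (f01 z); rewrite ger0_norm.
apply: (trig_lim (M := 1) (fun n => trigX n.+1 h)) => [n z|z].
  set x := _ / 2.
  have x0 : 0 <= x.
    by rewrite /x; case: (1 / 2 < f z)%R; case: (1 / 2 <= f z)%R => /=; lra.
  have x1 : x <= 1.
    by rewrite /x; case: (1 / 2 < f z)%R; case: (1 / 2 <= f z)%R => /=; lra.
  by rewrite normrX exprn_ile1// ger0_norm.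
have [_|_|_] := ltgtP (1 / 2) (f z).
- apply: cvg_near_cst; apply: nearW => n /=.
  have -> : (1 + 1) / 2 = 1 :> R by field.
  by rewrite expr1n.
- apply: cvg_near_cst; apply: nearW => n /=.
  by rewrite addr0 mul0r expr0n.
have -> : (false%:R + true%:R) / 2 = 1 / 2 :> R by rewrite /= add0r.
have : (GRing.exp (1 / 2 : R)) @ \oo --> (0 : R).
  by apply: cvg_expr; rewrite ger0_norm; lra.
by rewrite -cvg_shiftS.
Qed.

(** [sin ((tnth z i - q) / n.+1)] has the sign of [tnth z i - q] once [n] is large; the phase
    [- pi / 2] turns the cosine into this sine. *)
Lemma trig_ray i q : trig_closure (fun z => (q < tnth z i)%R%:R).
Proof.
pose a n j : R := if j == i then n.+1%:R^-1 else 0.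
have aE n z : \sum_j a n j * tnth z j = tnth z i / n.+1%:R.
  rewrite (bigD1 i)//= /a eqxx big1 ?addr0 1?mulrC// => j /negbTE ->.
  by rewrite mul0r.
pose f n z : R := (1 + cos (\sum_j a n j * tnth z j + (- q / n.+1%:R - pi / 2))) / 2.
have hf n : trig_closure (f n).
  have := trigZ (1 / 2) (trigD (trig_cst 1) (trig_cos (a n) (- q / n.+1%:R - pi / 2))).
  by congr trig_closure; apply/funext => z /=; rewrite /f; field; rewrite ?gt_eqF ?ltr0n.
have fE n z : f n z = (1 + sin ((tnth z i - q) / n.+1%:R)) / 2.
  by rewrite /f aE addrA -mulrDl cosBpihalf.
have f01 n z : 0 <= f n z <= 1.
  rewrite /f; set x := cos _.
  have : -1 <= x by exact: cos_geN1.
  have : x <= 1 by exact: cos_le1.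
  lra.
apply: (trig_lim (M := 1) (fun n => trig_level (hf n) (f01 n))) => [n z|z].
  by case: (_ < _); rewrite ?normr1 ?normr0.
apply: cvg_near_cst; have := pi_gt0 R => pi0.
near=> n.
have hn : `|tnth z i - q| / n.+1%:R < pi.
  rewrite ltr_pdivrMr ?ltr0n// -ltr_pdivrMl//.
  apply: (@lt_trans _ _ n%:R); last by rewrite ltr_nat.
  near: n; exact: nbhs_infty_gtr.
congr (_ : bool)%:R; rewrite fE.
rewrite (_ : (1 / 2 < _) = (0 < sin ((tnth z i - q) / n.+1%:R))); last first.
  by apply/idP/idP => h; lra.
have [h|h|->] := ltgtP q (tnth z i).
- apply: sin_gt0_pi; rewrite divr_gt0 ?subr_gt0//=.
  by move: hn; rewrite gtr0_norm ?subr_gt0.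
- apply/negbTE; rewrite -leNgt -oppr_ge0 -sinN; apply: ltW; apply: sin_gt0_pi.
  rewrite -mulNr opprB divr_gt0 ?subr_gt0//=.
  by move: hn; rewrite distrC gtr0_norm ?subr_gt0.
- by rewrite subrr mul0r sin0 ltxx.
Unshelve. all: by end_near. Qed.

Let D : set (set E) := [set A | trig_closure (\1_A)].

(** Closure under products replaces a Dynkin class argument: [1 - \prod (1 - \1_(A k))] is the
    indicator of a finite union, and countable unions are bounded limits. *)
Let sigma_algebraD : sigma_algebra setT D.
Proof.
split.
- by rewrite /D/=; have := trig_cst 0; congr trig_closure; apply/funext => z; rewrite indic0.
- move=> A DA; rewrite /D/=.
  have := trig_lin (-1) DA (trig_cst 1); congr trig_closure; apply/funext => z /=.
  rewrite setTD !indicE in_setC; case: (_ \in _) => /=; ring.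
- move=> A DA.
  have h n : trig_closure (fun z => 1 - \prod_(k < n) (1 - \1_(A k) z)).
    have : trig_closure (fun z => \prod_(k < n) (1 - \1_(A k) z)).
      elim: n => [|n IH].
        by have := trig_cst 1; congr trig_closure; apply/funext => z; rewrite big_ord0.
      have := trigM IH (trig_lin (-1) (DA n) (trig_cst 1)); congr trig_closure.
      by apply/funext => z; rewrite big_ord_recr/= mulN1r addrC.
    move=> h; have := trig_lin (-1) h (trig_cst 1); congr trig_closure.
    by apply/funext => z /=; rewrite mulN1r addrC.
  have e0 k z : (0 : R) <= 1 - \1_(A k) z <= (1 : R).
    by rewrite indicE; case: (_ \in _) => /=; lra.
  apply: (trig_lim (M := 1) h) => [n z|z].
    have : 0 <= \prod_(k < n) (1 - \1_(A k) z : R) by apply: prodr_ge0 => k _; case/andP: (e0 k z).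
    have : \prod_(k < n) (1 - \1_(A k) z : R) <= 1.
      by apply: prodr_ile1 => k _; exact: e0.
    by rewrite ler_norml => *; apply/andP; split; lra.
  apply: cvg_near_cst; have [[k _ Ak]|nA] := pselect ((\bigcup_k A k) z).
    exists k.+1 => // n /= kn; rewrite indicE mem_set//; last by exists k.
    by rewrite (bigD1 (Ordinal kn))//= indicE mem_set// subrr mul0r subr0.
  apply: nearW => n; rewrite indicE memNset//.
  rewrite big1 ?subrr// => k _; rewrite indicE memNset ?subr0//.
  by move=> Ak; apply: nA; exists k.
Qed.

Lemma measurable_trig_closure (A : set E) : measurable A -> trig_closure (\1_A).
Proof.
suff h : @measurable _ E `<=` D by exact: h.
apply: smallest_sub; first exact: sigma_algebraD.
rewrite -bigcup_seq => B [i _] [C mC <-]; rewrite setTI.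
pose F : set (set R) := [set C | D ((@tnth N R ^~ i) @^-1` C)].
suff : @measurable _ R `<=` F by apply.
rewrite [X in X `<=` _](RGenOInfty.measurableE R); apply: smallest_sub.
  have [D0 DC DU] := sigma_algebraD; split.
  - by rewrite /F/= preimage_set0.
  - by move=> X FX; rewrite /F/= setTD preimage_setC -setTD; exact: DC.
  - by move=> X FX; rewrite /F/= preimage_bigcup; exact: DU.
move=> _ [q ->]; rewrite /F /D/=.
have := trig_ray i q; congr trig_closure; apply/funext => z.
rewrite indicE; congr (_ : bool)%:R.
by apply/idP/idP; rewrite inE/= in_itv/= andbT.
Qed.

(** The free phase [c] carries both the real and the imaginary part. Equality of integrals is
    preserved by each constructor of [trig_closure], which contains all indicators. *)
Lemma charfun_unique (m1 m2 : probability E R) :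
  (forall a c, \int[m1]_z cos (\sum_i a i * tnth z i + c) =
               \int[m2]_z cos (\sum_i a i * tnth z i + c)) ->
  forall A, measurable A -> m1 A = m2 A.
Proof.
move=> m12 A mA.
have h f : trig_closure f -> \int[m1]_z f z = \int[m2]_z f z.
  elim=> [//|k {}f g hf f12 hg g12|F {}f M hF F12 FM Ff].
    have int (m : probability E R) u : trig_closure u -> m.-integrable setT (EFin \o u).
      by move=> /trig_bmf; exact: bmf_integrable.
    rewrite !RintegralD//; try exact: int; try by apply: int; exact: trigZ.
    by rewrite !RintegralZl ?g12 ?f12//; exact: int.
  have mF n : measurable_fun setT (F n) by apply: bmf_meas; exact: trig_bmf.
  have [_ h1] := bounded_convergence m1 mF FM Ff.
  have [_ h2] := bounded_convergence m2 mF FM Ff.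
  apply: (@cvg_unique _ (@Rhausdorff R) _ _ _ _ h1).
  by rewrite (_ : (fun n => _) = (fun n => \int[m2]_x F n x))//; apply/funext => n.
have hA := measurable_trig_closure mA.
have e (m : probability E R) : m A = (\int[m]_z \1_A z)%:E.
  rewrite EFin_Rintegral; last by apply: bmf_integrable; exact: trig_bmf.
  by rewrite integral_indic// setIT.
by rewrite !e h.
Qed.

End charfun.

(** * Moments of Gaussian variables and laws of Gaussian vectors *)

Section normal_moments.
Context {R : realType}.
Local Notation mu := (@lebesgue_measure R).
Local Notation gamma := (@normal_prob R 0 1).

Lemma integral_normal_expR (s : R) : 0 < s ->
  (\int[gamma]_x (expR ((1 - s ^- 2) * x ^+ 2 / 2))%:E = s%:E)%E.
Proof.
move=> s0; have s0' : s != 0 by rewrite gt_eqF.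
rewrite integral_std_normal; last 2 first.
- apply/measurable_EFinP; apply: measurableT_comp; first exact: measurable_expR.
  apply: measurable_funM; last exact: measurable_cst.
  by apply: measurable_funM; [exact: measurable_cst|exact: measurable_funX].
- by move=> x; rewrite lee_fin expR_ge0.
transitivity (\int[mu]_x (s%:E * (normal_pdf 0 s x)%:E))%E.
  apply: eq_integral => x _; rewrite -!EFinM !normal_pdfE ?oner_eq0//; congr EFin.
  rewrite /normal_fun !subr0 mulrCA -expRD.
  have -> : (1 - s ^- 2) * x ^+ 2 / 2 + - x ^+ 2 / (1 ^+ 2 *+ 2) =
    - x ^+ 2 / (s ^+ 2 *+ 2) by field.
  rewrite mulrA; congr (_ * _); rewrite /normal_peak expr1n mul1r.
  rewrite -mulrnAr sqrtrM ?sqr_ge0// sqrtr_sqr gtr0_norm//.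
  by rewrite invfM mulrA divff// mul1r.
rewrite ge0_integralZl//.
- by rewrite integral_normal_pdf mule1.
- by apply/measurable_EFinP; exact: measurable_normal_pdf.
- by move=> x _; rewrite lee_fin normal_pdf_ge0.
- by rewrite lee_fin ltW.
Qed.

(* [1 + k x ^+ 2 <= expR (k x ^+ 2)] with [k = (1 - s ^- 2) / 2] bounds the
   second moment from above if [s > 1] and from below if [s < 1]; let [s] tend
   to [1]. *)
Lemma integral_normal_sqr : (\int[gamma]_x (x ^+ 2)%:E = 1)%E.
Proof.
pose e k (x : R) := expR (k * x ^+ 2 / 2).
have me k : measurable_fun setT (fun x : R => (e k x)%:E : \bar R).
  apply/measurable_EFinP; apply: measurableT_comp; first exact: measurable_expR.
  apply: measurable_funM; last exact: measurable_cst.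
  by apply: measurable_funM; [exact: measurable_cst|exact: measurable_funX].
have ie s : 0 < s -> gamma.-integrable setT (EFin \o e (1 - s ^- 2)) /\
    \int[gamma]_x e (1 - s ^- 2) x = s.
  move=> s0; have E := integral_normal_expR s0; split; last by rewrite /Rintegral E.
  apply: ge0_integrable_R; last by rewrite E ltry.
    by apply/measurable_EFinP; exact: me.
  by move=> x; exact: expR_ge0.
have isq : gamma.-integrable setT (EFin \o (fun x : R => x ^+ 2)).
  have [i2 _] := ie 2 ltac:(lra).
  apply: (@integrable_Rdom _ _ _ gamma _ (fun x => 8 / 3 * e (1 - 2 ^- 2) x)).
  - exact: measurable_funX.
  - exact: integrable_RZ.
  move=> x; rewrite ger0_norm ?sqr_ge0//.
  have := expR_ge1Dx ((1 - 2 ^- 2) * x ^+ 2 / 2); rewrite -/(e _ _); lra.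
rewrite -EFin_Rintegral//; congr EFin; set m := Rintegral _ _ _.
have key s : 0 < s -> (s ^+ 2 - 1) * m <= 2 * s ^+ 2 * (s - 1).
  move=> s0; have [ints es] := ie s s0.
  pose k := (1 - s ^- 2) / 2.
  have h : \int[gamma]_x (1 + k * x ^+ 2) <= \int[gamma]_x e (1 - s ^- 2) x.
    apply: le_Rintegral => //.
      by apply: integrable_RD (integrable_RZ k isq); exact: finite_measure_integrable_cst.
    move=> x _; have := expR_ge1Dx ((1 - s ^- 2) * x ^+ 2 / 2).
    by rewrite -/(e _ _) /k; lra.
  rewrite RintegralD// ?RintegralZl// in h; last first.
  - exact: integrable_RZ.
  - exact: finite_measure_integrable_cst.
  rewrite Rintegral_prob_cst es -/m /k in h.
  have := ler_wpM2l (sqr_ge0 s) h.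
  have -> : s ^+ 2 * (1 + (1 - s ^- 2) / 2 * m) = s ^+ 2 + (s ^+ 2 - 1) * m / 2.
    by field; rewrite gt_eqF.
  lra.
apply/eqP; rewrite eq_le; apply/andP; split; rewrite leNgt; apply/negP => m1.
  (* Since [m >= 1 + 4 t], the number [(2 + t) m] is at least [2 + 9 t + 4 t^2], above the bound
     [2 + 4 t + 2 t^2] obtained from [s = 1 + t]. The other side is symmetric. *)
  pose t := Num.min ((m - 1) / 4) (1 / 2).
  have t0 : 0 < t by rewrite lt_min; lra.
  have [t1 t2] : t <= (m - 1) / 4 /\ t <= 1 / 2 by split; rewrite ge_min lexx ?orbT.
  have := key (1 + t) ltac:(lra).
  have -> : ((1 + t) ^+ 2 - 1) * m = t * ((2 + t) * m) by ring.
  have -> : 2 * (1 + t) ^+ 2 * (1 + t - 1) = t * (2 + 4 * t + 2 * t ^+ 2) by ring.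
  rewrite ler_pM2l//; nra.
pose t := Num.min ((1 - m) / 4) (1 / 2).
have t0 : 0 < t by rewrite lt_min; lra.
have [t1 t2] : t <= (1 - m) / 4 /\ t <= 1 / 2 by split; rewrite ge_min lexx ?orbT.
have := key (1 - t) ltac:(lra).
have -> : ((1 - t) ^+ 2 - 1) * m = - t * ((2 - t) * m) by ring.
have -> : 2 * (1 - t) ^+ 2 * (1 - t - 1) = - t * (2 - 4 * t + 2 * t ^+ 2) by ring.
have m0 : 0 <= m by apply: Rintegral_ge0 => x _; exact: sqr_ge0.
rewrite !mulNr lerN2 ler_pM2l//; nra.
Qed.

End normal_moments.

Section cholesky.
Context {R : realType}.

(** Elimination of the first coordinate leaves the Schur complement [K'], again positive
    semidefinite. Zero pivots are allowed: positivity then makes the first column vanish, and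
    [0^-1 = 0] lets the same formulas stand. *)
Lemma cholesky N (K : 'I_N -> 'I_N -> R) : (forall i j, K i j = K j i) ->
  (forall a : 'I_N -> R, 0 <= \sum_i \sum_j a i * a j * K i j) ->
  exists A : 'I_N -> 'I_N -> R, forall i j, K i j = \sum_k A i k * A j k.
Proof.
elim: N K => [|N IH] K Ksym Kpsd.
  by exists (fun _ _ => 0) => -[].
pose k := K ord0 ord0.
pose s i := lift ord0 i : 'I_N.+1.
have expand (c : R) (a : 'I_N -> R) :
    0 <= c ^+ 2 * k + 2 * c * (\sum_i a i * K (s i) ord0) +
         \sum_i \sum_j a i * a j * K (s i) (s j).
  have := Kpsd (fun i => oapp a c (unlift ord0 i)).
  rewrite big_ord_recl big_ord_recl unlift_none/= -/k.
  under eq_bigr do rewrite liftK/=.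
  under [X in _ + X]eq_bigr => i _.
    rewrite big_ord_recl unlift_none liftK/=.
    under eq_bigr do rewrite liftK/=.
    over.
  rewrite big_split/=.
  have -> : \sum_i c * a i * K ord0 (s i) = c * \sum_i a i * K (s i) ord0.
    by rewrite mulr_sumr; apply: eq_bigr => i _; rewrite Ksym mulrA.
  have -> : \sum_i a i * c * K (s i) ord0 = c * \sum_i a i * K (s i) ord0.
    by rewrite mulr_sumr; apply: eq_bigr => i _; rewrite mulrA [c * _]mulrC.
  by rewrite /s => h; apply: (le_trans h); rewrite le_eqVlt; apply/orP; left; apply/eqP; ring.
have k0 : 0 <= k.
  have := expand 1 (fun=> 0).
  by rewrite !big1 ?mulr0 ?addr0 ?expr1n ?mul1r// => i _; rewrite ?big1 ?mul0r// => j _; rewrite !mul0r.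
have kz : k = 0 -> forall j, K (s j) ord0 = 0.
  move=> kk j; apply/eqP; apply/negPn/negP => nz.
  pose b := K (s j) (s j); pose x := K (s j) ord0.
  (* This coefficient makes the quadratic form equal to [-1]. *)
  have := expand (- (b + 1) / (2 * x)) (fun i => (i == j)%:R).
  have -> : \sum_i (i == j)%:R * K (s i) ord0 = x.
    rewrite (bigD1 j)//= eqxx mul1r big1 ?addr0// => i /negbTE ->.
    by rewrite mul0r.
  have -> : \sum_i \sum_l (i == j)%:R * (l == j)%:R * K (s i) (s l) = b.
    rewrite (bigD1 j)//= [X in _ + X]big1 ?addr0; last first.
      by move=> i /negbTE ->; rewrite big1// => l _; rewrite !mul0r.
    rewrite (bigD1 j)//= eqxx !mul1r big1 ?addr0// => i /negbTE ->.
    by rewrite mulr0 mul0r.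
  rewrite kk mulr0 add0r.
  have -> : 2 * (- (b + 1) / (2 * x)) * x = - (b + 1) by field; exact: nz.
  lra.
pose v i := K (s i) ord0 / Num.sqrt k.
pose K' i j := K (s i) (s j) - v i * v j.
have vv i j : v i * v j = K (s i) ord0 * K (s j) ord0 / k.
  rewrite /v mulrACA -invfM -expr2 sqr_sqrtr//.
have [A' hA'] : exists A : 'I_N -> 'I_N -> R, forall i j, K' i j = \sum_k A i k * A j k.
  apply: IH => [i j|a]; first by rewrite /K' Ksym [v i * _]mulrC.
  pose B := \sum_i a i * K (s i) ord0.
  (* For [k != 0] the first coefficient [- B / k] minimises the form, and the minimum is the form of
     [K']. *)
  apply: (le_trans (expand (- B / k) a)); rewrite -/B.
  have -> : \sum_i \sum_j a i * a j * K' i j =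
      \sum_i \sum_j a i * a j * K (s i) (s j) - B ^+ 2 / k.
    rewrite /K' expr2 {1}/B !mulr_suml -sumrB; apply: eq_bigr => i _.
    rewrite mulr_sumr mulr_suml -sumrB; apply: eq_bigr => j _.
    by rewrite vv; ring.
  have [kk|kk] := eqVneq k 0; first by rewrite kk invr0; lra.
  rewrite le_eqVlt; apply/orP; left; apply/eqP; field.
  exact: kk.
pose A (i j : 'I_N.+1) : R :=
  match unlift ord0 i, unlift ord0 j with
  | None, None => Num.sqrt k
  | None, Some _ => 0
  | Some i', None => v i'
  | Some i', Some j' => A' i' j'
  end.
have sk0 j : Num.sqrt k * v j = K (s j) ord0.
  have [kk|kk] := eqVneq k 0; first by rewrite kk sqrtr0 mul0r kz.
  by rewrite /v mulrCA divff ?mulr1// sqrtr_eq0 -ltNge lt_neqAle eq_sym kk.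
exists A => i j; rewrite big_ord_recl.
case: (unliftP ord0 i) => [i'|] ->; case: (unliftP ord0 j) => [j'|] ->.
- rewrite /A !liftK unlift_none; under eq_bigr do rewrite liftK.
  by rewrite -hA' /K' addrCA subrr addr0.
- rewrite /A !liftK !unlift_none; under eq_bigr do rewrite liftK.
  by rewrite big1 ?addr0 => [|*]; rewrite ?mulr0// mulrC sk0.
- rewrite /A !liftK !unlift_none; under eq_bigr do rewrite liftK.
  by rewrite big1 ?addr0 => [|*]; rewrite ?mul0r// sk0 Ksym.
- rewrite /A !unlift_none; under eq_bigr do rewrite liftK.
  by rewrite big1 ?addr0 => [|*]; rewrite ?mul0r// -expr2 sqr_sqrtr.
Qed.

End cholesky.

Section gaussian_variable.
Context {R : realType} {d} {Omega : measurableType d} (P : probability Omega R).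
Local Notation mu := (@lebesgue_measure R).
Local Notation gamma := (@normal_prob R 0 1).
Variables (U : Omega -> R) (m s : R).
Hypothesis mU : measurable_fun setT U.
Hypothesis lawU : forall A, measurable A -> P (U @^-1` A) = gaussian_law m s A.

Lemma ge0_integral_gaussian (h : R -> \bar R) : measurable_fun setT h ->
  (forall x, 0 <= h x)%E ->
  (\int[P]_w h (U w) = \int[gamma]_x h (m + s * x)%R)%E.
Proof.
move=> mh h0.
pose U' (w : Omega) : measurableTypeR R := U w.
have mU' : measurable_fun setT U' by exact: mU.
have -> : (\int[P]_w h (U w) = \int[pushforward P U']_x h x)%E.
  by rewrite ge0_integral_pushforward.
have [s0|s0] := eqVneq s 0.
  transitivity (\int[dirac (m : measurableTypeR R)]_x h x)%E.
    apply: eq_measure_integral => A mA _; rewrite /pushforward/=.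
    by have := lawU mA; rewrite /gaussian_law s0 eqxx.
  rewrite integral_dirac// diracT mul1e.
  have -> : (fun x => h (m + s * x)) = cst (h m).
    by apply/funext => x; rewrite s0 mul0r addr0.
  by rewrite integral_cst// [X in (_ * X)%E](@probability_setT _ _ _ gamma) mule1.
rewrite -(ge0_integral_normal m s0 mh h0).
have mp : measurable_fun setT (fun x : R => (normal_pdf m s x)%:E).
  by apply/measurable_EFinP; exact: measurable_normal_pdf.
have p0 x : (0 <= (normal_pdf m s x)%:E)%E by rewrite lee_fin normal_pdf_ge0.
have -> : (\int[mu]_x (h x * (normal_pdf m s x)%:E) =
    \int[(normal_prob m s : probability _ _)]_x h x)%E.
  by apply/esym; apply: (@ge0_integral_density _ (measurableTypeR R)).
apply: eq_measure_integral => A mA _; rewrite /pushforward/=.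
by have := lawU mA; rewrite /gaussian_law (negbTE s0).
Qed.

Lemma Rintegral_gaussian (h : R -> R) : bmf h ->
  \int[P]_w h (U w) = \int[gamma]_x h (m + s * x).
Proof.
move=> [mh [M hM]]; pose g x := h x + M.
have M0 : 0 <= M by exact: le_trans (hM 0).
have bg : bmf g by apply: (@bmfD _ _ _ h (cst M)); [split=> //; exists M|exact: bmf_cst].
have g0 x : (0 <= (g x)%:E)%E.
  by rewrite lee_fin /g; have := hM x; rewrite ler_norml => /andP[]; lra.
have bgc d' (T : measurableType d') (u : T -> R) : measurable_fun setT u ->
    bmf (fun x => h (u x)).
  by move=> mu_; split; [exact: (measurableT_comp mh)|exists M => x].
have mg : measurable_fun setT (EFin \o g) by apply/measurable_EFinP; exact: bmf_meas.
have maff : measurable_fun setT (fun x : R => m + s * x).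
  by apply: measurable_funD; [exact: measurable_cst|apply: measurable_funM].
have bh1 := bgc _ _ U mU.
have bh2 : bmf (fun x : measurableTypeR R => h (m + s * x)) by exact: bgc maff.
have := ge0_integral_gaussian mg g0 => /=.
have b1 := bmfD bh1 (bmf_cst M); have b2 := bmfD bh2 (bmf_cst M).
rewrite -(EFin_Rintegral (bmf_integrable P b1)) -(EFin_Rintegral (bmf_integrable gamma b2)) => -[].
rewrite RintegralD//; last 2 first.
- exact: bmf_integrable.
- exact: bmf_integrable (bmf_cst _).
rewrite [X in _ = X]RintegralD//; last 2 first.
- exact: bmf_integrable.
- exact: bmf_integrable (bmf_cst _).
by rewrite Rintegral_prob_cst (Rintegral_prob_cst gamma) => /addIr.
Qed.

End gaussian_variable.

Section gaussian_moments.
Context {R : realType}.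
Local Notation mu := (@lebesgue_measure R).
Local Notation gamma := (@normal_prob R 0 1).

Let intsq : gamma.-integrable setT (EFin \o (fun x : R => x ^+ 2)).
Proof.
apply: ge0_integrable_R => [|x|]; first exact: measurable_funX.
  exact: sqr_ge0.
by rewrite integral_normal_sqr ltry.
Qed.

Let intcst (k : R) : gamma.-integrable setT (EFin \o cst k).
Proof. exact: (bmf_integrable gamma (bmf_cst k)). Qed.

Let intid : gamma.-integrable setT (EFin \o (fun x : R => x)).
Proof.
apply: (@integrable_Rdom _ (measurableTypeR R) R gamma _ (fun x => 1 + x ^+ 2)) => //.
  exact: integrable_RD (intcst 1) intsq.
move=> x; have := sqr_ge0 (`|x| - 1 / 2).
rewrite sqrrB real_normK ?num_real//; lra.
Qed.

Let int2 (a b c : R) :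
  gamma.-integrable setT (EFin \o (fun x : R => a + (b * x + c * x ^+ 2))).
Proof.
by apply: integrable_RD; [exact: intcst|apply: integrable_RD; exact: integrable_RZ].
Qed.

Let Rint2 (a b c : R) :
  \int[gamma]_x (a + (b * x + c * x ^+ 2)) = a + (b * \int[gamma]_x x + c).
Proof.
have i1 := integrable_RZ b intid; have i2 := integrable_RZ c intsq.
have i0 := intcst a; have i12 := integrable_RD i1 i2.
rewrite (RintegralD measurableT i0 i12) (RintegralD measurableT i1 i2).
rewrite (Rintegral_prob_cst gamma).
rewrite (RintegralZl b measurableT intid) (RintegralZl c measurableT intsq).
by rewrite [X in c * X](_ : _ = 1) ?mulr1// /Rintegral integral_normal_sqr.
Qed.

(** The reflection [s = -1] changes the sign of the linear term of [1 + x + x^2], a nonnegative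
    function to which the substitution applies. *)
Lemma Rintegral_normal_id : \int[gamma]_x x = 0.
Proof.
pose h (x : R) : R := 1 + (1 * x + 1 * x ^+ 2).
have h0 x : (0 <= (h x)%:E)%E.
  by rewrite lee_fin /h; have := sqr_ge0 (x + 1 / 2); rewrite sqrrD; lra.
have mh : measurable_fun setT (fun x => (h x)%:E) by case/integrableP : (int2 1 1 1).
have N10 : -1 != 0 :> R by rewrite oppr_eq0 oner_eq0.
have := ge0_integral_normal 0 N10 mh h0.
have -> : normal_pdf 0 (-1) = normal_pdf 0 1 :> (R -> R).
  by apply/funext => x; rewrite !normal_pdfE ?oner_eq0// /normal_peak /normal_fun sqrrN.
rewrite -(integral_std_normal mh h0).
rewrite -(EFin_Rintegral (int2 1 1 1)).
have hN : (fun x : R => (h (0 + -1 * x))%:E) = (fun x : R => (1 + (-1 * x + 1 * x ^+ 2))%:E).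
  by apply/funext => x; rewrite /h; congr EFin; ring.
rewrite hN -(EFin_Rintegral (int2 1 (-1) 1)) !Rint2 => -[]; lra.
Qed.

Context {d} {Omega : measurableType d} (P : probability Omega R).
Variables (U : Omega -> R) (m s : R).
Hypothesis mU : measurable_fun setT U.
Hypothesis lawU : forall A, measurable A -> P (U @^-1` A) = gaussian_law m s A.

Let mU2 : measurable_fun setT (fun w => U w ^+ 2).
Proof. exact: measurable_funX. Qed.

Let E2 : (\int[P]_w (U w ^+ 2)%:E = (m ^+ 2 + s ^+ 2)%:E)%E.
Proof.
have msq : measurable_fun setT (fun x : R => (x ^+ 2)%:E : \bar R).
  by apply/measurable_EFinP; exact: measurable_funX.
rewrite (ge0_integral_gaussian mU lawU msq) => [|x]; last by rewrite lee_fin sqr_ge0.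
have -> : (fun x : R => ((m + s * x) ^+ 2)%:E) =
    (fun x => (m ^+ 2 + (2 * m * s * x + s ^+ 2 * x ^+ 2))%:E).
  by apply/funext => x; congr EFin; ring.
by rewrite -(EFin_Rintegral (int2 _ _ _)) Rint2 Rintegral_normal_id mulr0 add0r.
Qed.

Lemma integrable_gaussian_sqr : P.-integrable setT (EFin \o (fun w => U w ^+ 2)).
Proof. by apply: ge0_integrable_R => // [w|]; rewrite ?sqr_ge0// E2 ltry. Qed.

Lemma integrable_gaussian : P.-integrable setT (EFin \o U).
Proof.
apply: (@integrable_Rdom _ _ _ P U (fun w => 1 + U w ^+ 2)) => //.
  apply: integrable_RD integrable_gaussian_sqr.
  exact: (bmf_integrable P (bmf_cst 1)).
move=> w; have := sqr_ge0 (`|U w| - 1 / 2).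
rewrite sqrrB real_normK ?num_real//; lra.
Qed.

Lemma Rintegral_gaussian_sqr : \int[P]_w (U w ^+ 2) = m ^+ 2 + s ^+ 2.
Proof. by rewrite /Rintegral E2. Qed.

Lemma Rintegral_gaussian_mean : \int[P]_w (U w) = m.
Proof.
pose h (x : R) : R := 1 + (1 * x + 1 * x ^+ 2).
have h0 x : (0 <= (h x)%:E)%E.
  by rewrite lee_fin /h; have := sqr_ge0 (x + 1 / 2); rewrite sqrrD; lra.
have mh : measurable_fun setT (fun x => (h x)%:E) by case/integrableP : (int2 1 1 1).
have i1 := integrable_RZ 1 integrable_gaussian.
have i2 := integrable_RZ 1 integrable_gaussian_sqr.
have i12 := integrable_RD i1 i2.
have i0 := bmf_integrable P (bmf_cst 1).
have := ge0_integral_gaussian mU lawU mh h0.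
rewrite -(EFin_Rintegral (integrable_RD i0 i12)).
have -> : (fun x : R => (h (m + s * x))%:E) =
    (fun x => ((1 + m + m ^+ 2) + ((s + 2 * m * s) * x + s ^+ 2 * x ^+ 2))%:E).
  by apply/funext => x; rewrite /h; congr EFin; ring.
rewrite -(EFin_Rintegral (int2 _ _ _)) Rint2 Rintegral_normal_id mulr0 add0r.
move=> -[]; rewrite (RintegralD measurableT i0 i12) Rintegral_prob_cst.
rewrite (RintegralD measurableT i1 i2) (RintegralZl 1 measurableT integrable_gaussian).
rewrite (RintegralZl 1 measurableT integrable_gaussian_sqr).
rewrite Rintegral_gaussian_sqr; lra.
Qed.

End gaussian_moments.

Section cauchy_schwarz.
Context {R : realType}.

Lemma normr_dotv_le d (u v : 'rV[R]_d) : `|dotv u v| <= enorm u * enorm v.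
Proof.
rewrite ler_norml dotv_le andbT lerNl; have := dotv_le (- u) v.
by rewrite -scaleN1r dotvZl enormZ normrN1 mul1r mulN1r.
Qed.

Lemma dotv_sqr_le d (u v : 'rV[R]_d) : dotv u v ^+ 2 <= dotv u u * dotv v v.
Proof.
rewrite -real_normK ?num_real// -!sqr_enorm -exprMn.
by rewrite ler_pXn2r ?normr_dotv_le// nnegrE// mulr_ge0 ?enorm_ge0.
Qed.

Lemma sum_sqr_le n (x y : 'I_n -> R) :
  (\sum_i x i * y i) ^+ 2 <= (\sum_i x i ^+ 2) * (\sum_i y i ^+ 2).
Proof.
have := dotv_sqr_le (\row_i x i) (\row_i y i).
have e (a b : 'I_n -> R) : dotv (\row_i a i) (\row_i b i) = \sum_i a i * b i.
  by apply: eq_bigr => i _; rewrite !mxE.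
rewrite !e; congr (_ <= _ * _); by apply: eq_bigr => i _; rewrite expr2.
Qed.

End cauchy_schwarz.

Lemma Rintegral_distribution {d1 d2} {T1 : measurableType d1}
    {T2 : measurableType d2} {R : realType} (P : probability T1 R)
    (X : {mfun T1 >-> T2}) (h : T2 -> R) : bmf h ->
  \int[distribution P X]_y h y = \int[P]_w h (X w).
Proof.
move=> [mh [M hM]]; rewrite /Rintegral; congr fine.
rewrite integral_pushforward//; first exact/measurable_EFinP.
apply: bmf_integrable; split; last by exists M => x; exact: hM.
exact: (measurableT_comp mh).
Qed.

Section gaussian_vector.
Context {R : realType} {d} {Omega : measurableType d} (P : probability Omega R).
Local Notation gamma := (@normal_prob R 0 1).
Context {N : nat} (Z : 'I_N -> Omega -> R).
Hypothesis mZ : forall i, measurable_fun setT (Z i).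
Hypothesis gaussZ : forall a : 'I_N -> R,
  is_gaussian P (fun w => \sum_i a i * Z i w).

Definition lin_var (a : 'I_N -> R) : R :=
  \int[P]_w (\sum_i a i * Z i w) ^+ 2 - (\int[P]_w (\sum_i a i * Z i w)) ^+ 2.

Let mlin a : measurable_fun setT (fun w => \sum_i a i * Z i w).
Proof.
by apply: measurable_sum => i; apply: measurable_funM; [exact: measurable_cst|].
Qed.

Let ZE i : Z i = (fun w => \sum_j (j == i)%:R * Z j w).
Proof.
apply/funext => w; rewrite (bigD1 i)//= eqxx mul1r big1 ?addr0// => j /negbTE ->.
by rewrite mul0r.
Qed.

Let intZ i : P.-integrable setT (EFin \o Z i).
Proof.
have [m [s h]] := gaussZ (fun j => (j == i)%:R).
by rewrite (ZE i); exact: (integrable_gaussian (mlin _) h).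
Qed.

Let intZ2 i : P.-integrable setT (EFin \o (fun w => Z i w ^+ 2)).
Proof.
have [m [s h]] := gaussZ (fun j => (j == i)%:R).
by rewrite (ZE i); exact: (integrable_gaussian_sqr (mlin _) h).
Qed.

Let intZZ i j : P.-integrable setT (EFin \o (fun w => Z i w * Z j w)).
Proof.
apply: (@integrable_Rdom _ _ _ P _ (fun w => Z i w ^+ 2 + Z j w ^+ 2)).
- exact: measurable_funM.
- exact: integrable_RD.
move=> w; rewrite normrM -[X in _ <= X + _]real_normK ?num_real//.
rewrite -[X in _ <= _ + X]real_normK ?num_real//.
have := sqr_ge0 (`|Z i w| - `|Z j w|); have := sqr_ge0 (`|Z i w|); have := sqr_ge0 (`|Z j w|).
rewrite sqrrB; lra.
Qed.

Let mean i := \int[P]_w Z i w.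
Let cov i j := \int[P]_w (Z i w * Z j w) - mean i * mean j.

Let mean_lin a : \int[P]_w (\sum_i a i * Z i w) = \sum_i a i * mean i.
Proof.
rewrite Rintegral_sum => [|i]; last exact: integrable_RZ.
by apply: eq_bigr => i _; rewrite RintegralZl.
Qed.

Let lin_varE a : lin_var a = \sum_i \sum_j a i * a j * cov i j.
Proof.
rewrite /lin_var mean_lin.
have -> : (fun w => (\sum_i a i * Z i w) ^+ 2) =
    (fun w => \sum_i \sum_j (a i * a j) * (Z i w * Z j w)).
  apply/funext => w; rewrite expr2 mulr_suml; apply: eq_bigr => i _.
  by rewrite mulr_sumr; apply: eq_bigr => j _; rewrite mulrACA.
rewrite Rintegral_sum => [|i]; last first.
  by apply: integrable_Rsum => j; exact: integrable_RZ.
rewrite expr2 mulr_suml -sumrB; apply: eq_bigr => i _.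
rewrite Rintegral_sum => [|j]; last exact: integrable_RZ.
rewrite mulr_sumr -sumrB; apply: eq_bigr => j _.
by rewrite RintegralZl// /cov; ring.
Qed.

Lemma lin_var_law a m s : (forall A, measurable A ->
    P ((fun w => \sum_i a i * Z i w) @^-1` A) = gaussian_law m s A) ->
  lin_var a = s ^+ 2 /\ \int[P]_w (\sum_i a i * Z i w) = m.
Proof.
move=> h; rewrite /lin_var (Rintegral_gaussian_sqr (mlin a) h).
by rewrite (Rintegral_gaussian_mean (mlin a) h) addrAC subrr add0r.
Qed.

Lemma lin_var_ge0 a : 0 <= lin_var a.
Proof. by have [m [s /lin_var_law[-> _]]] := gaussZ a; exact: sqr_ge0. Qed.

Definition vec (w : Omega) : N.-tuple R := [tuple Z i w | i < N].

Let charZ a c : \int[P]_w cos (\sum_i a i * Z i w + c) =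
  \int[gamma]_x cos (Num.sqrt (lin_var a) * x + (\sum_i a i * mean i + c)).
Proof.
have [m [s h]] := gaussZ a.
have [-> ms] := lin_var_law h.
have bcos c' : bmf (fun x : R => cos (x + c')).
  apply: bmf_cos.
  by apply: measurable_funD; [exact: measurable_id|exact: measurable_cst].
rewrite (Rintegral_gaussian (mlin a) h (bcos c)) -mean_lin ms.
have := Rintegral_cos_rotation s 0 (m + c).
rewrite expr0n addr0 => <-; apply: eq_Rintegral => x _.
rewrite -[LHS](Rintegral_prob_cst gamma); apply: eq_Rintegral => y _.
by congr cos; ring.
Qed.

(** The least admissible [r] is the squared Cameron-Martin norm of [z - z']; its dual description
    covers singular covariances. In law the vector is [mean + A G] with [A] from Cholesky, and for
    two such points [r = \sum_j (G j x - G j y)^2] is admissible by Cauchy-Schwarz, so that the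
    inequality for independent variables applies. *)
Lemma gaussian_prekopa_leindler (f g : N.-tuple R -> R) : bmf f -> bmf g ->
  (forall z, 0 <= f z) -> (forall z, 0 <= g z) ->
  (forall z z' r, 0 <= r ->
    (forall a, (\sum_i a i * (tnth z i - tnth z' i)) ^+ 2 <= r * lin_var a) ->
    f z * g z' ^+ 3 <= expR (3 / 8 * r)) ->
  (\int[P]_w f (vec w)) * (\int[P]_w g (vec w)) ^+ 3 <= 1.
Proof.
move=> bf bg f0 g0 fg.
have [A hA] : exists A : 'I_N -> 'I_N -> R, forall i j, cov i j = \sum_k A i k * A j k.
  apply: cholesky => [i j|a]; last by rewrite -lin_varE lin_var_ge0.
  by rewrite /cov [mean i * _]mulrC; congr (_ - _); apply: eq_Rintegral => w _; rewrite mulrC.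
have lin_varA a : lin_var a = \sum_k (\sum_i a i * A i k) ^+ 2.
  rewrite lin_varE; under eq_bigr do under eq_bigr do rewrite hA mulr_sumr.
  under eq_bigr do rewrite exchange_big/=.
  rewrite exchange_big/=; apply: eq_bigr => k _.
  rewrite expr2 mulr_suml; apply: eq_bigr => i _; rewrite mulr_sumr.
  by apply: eq_bigr => j _; ring.
have [dE [E [mE [G [mG charG PL]]]]] := @std_gaussian_source R N.
pose V (x : E) : N.-tuple R := [tuple mean i + \sum_j A i j * G j x | i < N].
have mvec : measurable_fun setT vec.
  apply/measurable_fun_tnthP => i.
  by rewrite (_ : _ \o _ = Z i)//; apply/funext => w; rewrite /= tnth_mktuple.
have mV : measurable_fun setT V.
  apply/measurable_fun_tnthP => i.
  rewrite (_ : _ \o _ = (fun x => mean i + \sum_j A i j * G j x)); last first.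
    by apply/funext => w; rewrite /= tnth_mktuple.
  apply: measurable_funD; first exact: measurable_cst.
  apply: measurable_sum => j; apply: measurable_funM; last exact: mG.
  exact: measurable_cst.
pose vec' : {mfun Omega >-> N.-tuple R} := HB.pack vec (isMeasurableFun.Build _ _ _ _ _ mvec).
pose V' : {mfun E >-> N.-tuple R} := HB.pack V (isMeasurableFun.Build _ _ _ _ _ mV).
have blin a c : bmf (fun z : N.-tuple R => cos (\sum_i a i * tnth z i + c)).
  exact/trig_bmf/trig_cos.
have law : forall B, measurable B -> distribution P vec' B = distribution mE V' B.
  apply: charfun_unique => a c.
  rewrite !Rintegral_distribution//.
  transitivity (\int[P]_w cos (\sum_i a i * Z i w + c)).
    apply: eq_Rintegral => w _; congr (cos (_ + _)).
    by apply: eq_bigr => i _; rewrite tnth_mktuple.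
  rewrite charZ lin_varA -charG; apply: eq_Rintegral => x _; congr cos.
  rewrite addrA; congr (_ + _).
  under [RHS]eq_bigr do rewrite tnth_mktuple mulrDr.
  rewrite big_split/= addrC; congr (_ + _).
  under [RHS]eq_bigr do rewrite mulr_sumr.
  rewrite exchange_big/=; apply: eq_bigr => j _; rewrite mulr_suml.
  by apply: eq_bigr => i _; rewrite mulrA.
have int (h : N.-tuple R -> R) : bmf h -> \int[P]_w h (vec w) = \int[mE]_x h (V x).
  move=> bh; rewrite -(Rintegral_distribution P vec' bh).
  rewrite -(Rintegral_distribution mE V' bh) /Rintegral; congr fine.
  by apply: eq_measure_integral => B mB _; exact: law.
have bV (h : N.-tuple R -> R) : bmf h -> bmf (h \o V).
  by move=> [mh [M hM]]; split; [exact: measurableT_comp|exists M => x; exact: hM].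
rewrite !int//; apply: PL; [exact: bV|exact: bV|by move=> x; exact: f0|by move=> x; exact: g0|].
move=> x y; apply: fg.
  by apply: sumr_ge0 => j _; exact: sqr_ge0.
move=> a; rewrite mulrC lin_varA.
have -> : \sum_i a i * (tnth (V x) i - tnth (V y) i) =
    \sum_k (\sum_i a i * A i k) * (G k x - G k y).
  under eq_bigr do rewrite !tnth_mktuple opprD addrACA subrr add0r -sumrB mulr_sumr.
  rewrite exchange_big/=; apply: eq_bigr => k _; rewrite mulr_suml.
  by apply: eq_bigr => i _; ring.
exact: sum_sqr_le.
Qed.

End gaussian_vector.

(** * Lipschitz estimate for the equation driven by a path *)

Section barrier.
Context {R : realType}.

(** The sign of [dv] is constrained only above the level [M]. If [v t1 > M], then [v > M] after the
    last time [s0] before [t1] with [v s0 <= M], and the mean value theorem on [[s0, t1]] gives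
    [v t1 <= v s0]. *)
Lemma le_barrier (v dv : R -> R) (M T : R) :
  (forall t, 0 <= t <= T -> is_derive t 1 v (dv t)) -> v 0 <= M ->
  (forall t, 0 < t <= T -> M < v t -> dv t <= 0) ->
  forall t, 0 <= t <= T -> v t <= M.
Proof.
move=> dvP v0 dv0 t1 /andP[t10 t1T]; rewrite leNgt; apply/negP => Mv.
have cont t : 0 <= t <= T -> {for t, continuous v}.
  move=> /dvP h; apply: differentiable_continuous; apply/derivable1_diffP.
  by case: h.
pose S := [set s | 0 <= s <= t1 /\ v s <= M].
have S0 : S 0 by rewrite /S/= lexx t10.
have hsup : has_sup S.
  by split; [exists 0|exists t1 => s [] /andP[]].
pose s0 := sup S.
have s00 : 0 <= s0 by apply: sup_upper_bound.
have s0t : s0 <= t1 by apply: ge_sup; [exists 0|move=> s [] /andP[]].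
have s0T : 0 <= s0 <= T by rewrite s00 (le_trans s0t).
have vs0 : v s0 <= M.
  rewrite leNgt; apply/negP => h.
  have /cvgr_dist_lt/(_ (v s0 - M)) := cont _ s0T.
  rewrite subr_gt0 => /(_ h) [e /= e0 he].
  have [s Ss hs] := sup_adherent e0 hsup.
  have ss0 : s <= s0 by apply: sup_upper_bound.
  have := he s; rewrite /= ger0_norm ?subr_ge0// ltrBlDr -ltrBlDl => /(_ hs).
  by have := Ss.2; have := ler_norm (v s0 - v s); lra.
have s0lt : s0 < t1.
  by rewrite lt_neqAle s0t andbT; apply/eqP => e; move: Mv; rewrite -e ltNge vs0.
have dvs x : x \in `]s0, t1[%R -> is_derive x 1 v (dv x).
  rewrite in_itv/= => /andP[x1 x2]; apply: dvP.
  by rewrite (ltW (le_lt_trans s00 x1)) (ltW (lt_le_trans x2 t1T)).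
have cvs : {within `[s0, t1], continuous v}.
  apply: continuous_in_subspaceT => x; rewrite inE/= in_itv/= => /andP[x1 x2].
  by apply: cont; rewrite (le_trans s00 x1) (le_trans x2 t1T).
have [c] := MVT s0lt dvs cvs.
rewrite in_itv/= => /andP[c1 c2] e.
have vc : M < v c.
  rewrite ltNge; apply/negP => vc.
  have : c <= s0.
    apply: sup_upper_bound => //; split=> //.
    by rewrite (ltW (le_lt_trans s00 c1)) ltW.
  by rewrite leNgt c1.
have dc : dv c <= 0.
  by apply: dv0 => //; rewrite (le_lt_trans s00 c1) (ltW (lt_le_trans c2 t1T)).
have : dv c * (t1 - s0) <= 0 by rewrite mulr_le0_ge0// subr_ge0.
by rewrite -e; lra.
Qed.

End barrier.

Section one_sided_lipschitz.
Context {R : realType} {d : nat}.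
Variables (b : 'rV[R]_d -> 'rV[R]_d) (C1 C2 : R).
Hypothesis hC : 0 <= C1 + C2.
Hypothesis hb1 : forall eta zeta : 'rV[R]_d,
  dotv (b eta - b zeta) (eta - zeta) <= C1 * enorm (eta - zeta) ^+ 2.
Hypothesis hb2 : forall eta zeta : 'rV[R]_d, eta - zeta != 0 ->
  enorm (b eta - b zeta
    - (dotv (b eta - b zeta) (eta - zeta) / enorm (eta - zeta) ^+ 2)
      *: (eta - zeta)) <= C2 * enorm (eta - zeta).

Lemma dotvDr (u v w : 'rV[R]_d) : dotv u (v + w) = dotv u v + dotv u w.
Proof. by rewrite dotvC dotvDl !(dotvC _ u). Qed.

Lemma dotvZr a (u v : 'rV[R]_d) : dotv u (a *: v) = a * dotv u v.
Proof. by rewrite dotvC dotvZl dotvC. Qed.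

Lemma dotvNl (u v : 'rV[R]_d) : dotv (- u) v = - dotv u v.
Proof. by rewrite -scaleN1r dotvZl mulN1r. Qed.

Lemma dotvNr (u v : 'rV[R]_d) : dotv u (- v) = - dotv u v.
Proof. by rewrite dotvC dotvNl dotvC. Qed.

(* The increment of the drift makes an angle with [- Z], [Z = eta - zeta],
   controlled by the constants, and [W = Z - D] is too small to turn [Z] away from [D]. *)
Lemma drift_dotv_le (eta zeta D : 'rV[R]_d) (w : R) : 0 <= w ->
  enorm (eta - zeta - D) <= w -> 9 / 4 * w ^+ 2 <= dotv D D ->
  dotv D (b eta - b zeta) <= 5 / 3 * (C1 + C2) * dotv D D.
Proof.
move=> w0 Ww Dw; have [Z ZE] : exists Z, Z = eta - zeta by exists (eta - zeta).
rewrite -ZE in Ww.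
have D0 : 0 <= dotv D D by exact: dotvv_ge0.
have [Z0|Z0] := eqVneq Z 0.
  have /eqP -> : eta == zeta by rewrite -subr_eq0 -ZE Z0.
  rewrite subrr (_ : dotv D 0 = 0); first by rewrite mulr_ge0// mulr_ge0.
  by rewrite dotvC -(scale0r D) dotvZl mul0r.
set B := b eta - b zeta.
pose z2 := dotv Z Z; pose p := dotv D Z; pose d2 := dotv D D.
have z20 : 0 < z2.
  by rewrite lt_neqAle dotvv_ge0 andbT eq_sym; apply: contra_neq Z0 => /dotvv_eq0.
have hB1 : dotv B Z <= C1 * z2 by have := hb1 eta zeta; rewrite -ZE sqr_enorm.
(* Radial coefficient and, with [r], tangential part of [B] with respect to [Z]. [hb1] bounds [lam]
   from above only, so the sign of [p = dotv D Z] matters; [hb2] bounds [r]. *)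
pose lam := dotv B Z / z2.
pose r := B - lam *: Z.
have hr : enorm r <= C2 * enorm Z by have := @hb2 eta zeta; rewrite -ZE sqr_enorm; exact.
have eZ0 : 0 < enorm Z by rewrite sqrtr_gt0.
have C20 : 0 <= C2 by rewrite -(pmulr_lge0 _ eZ0) (le_trans (enorm_ge0 r)).
have hr2 : dotv r r <= C2 ^+ 2 * z2.
  rewrite -sqr_enorm /z2 -[dotv Z Z]sqr_enorm -exprMn ler_pXn2r// nnegrE ?enorm_ge0//.
  by rewrite mulr_ge0 ?enorm_ge0.
have rZ : dotv r Z = 0.
  by rewrite /r dotvDl dotvNl dotvZl /lam divfK ?subrr// gt_eqF.
have W2 : z2 - 2 * p + d2 <= w ^+ 2.
  have : enorm (Z - D) ^+ 2 <= w ^+ 2 by rewrite ler_pXn2r// nnegrE enorm_ge0.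
  rewrite sqr_enorm dotvDl !dotvDr !dotvNl !dotvNr (dotvC Z D) -/z2 -/p -/d2; lra.
have p0 : 0 <= p.
  have : dotv D (D - Z) ^+ 2 <= d2 * w ^+ 2.
    apply: (le_trans (dotv_sqr_le _ _)); apply: ler_wpM2l => //.
    by move: W2; rewrite dotvDl !dotvDr !dotvNl !dotvNr (dotvC Z D) -/z2 -/p -/d2; lra.
  rewrite dotvDr dotvNr -/p -/d2 => h.
  rewrite leNgt; apply/negP => pn.
  have d20 : 0 <= d2 by [].
  have h2 : d2 ^+ 2 < (d2 - p) ^+ 2.
    have p2 : 0 < p ^+ 2 by rewrite exprn_even_gt0//= lt_eqF.
    have : 0 <= - p * d2 by rewrite mulr_ge0// oppr_ge0 ltW.
    rewrite sqrrB mulNr; lra.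
  have : d2 * w ^+ 2 <= d2 * d2.
    by apply: ler_wpM2l => //; rewrite -/d2 in Dw; have := sqr_ge0 w; lra.
  by rewrite -expr2; lra.
(* The squared distance of [D] from the line through [Z]; it is at most [|Z - D|^2], hence at most
   [w^2]. *)
pose q2 := d2 - p ^+ 2 / z2.
have hq : dotv (D - (p / z2) *: Z) (D - (p / z2) *: Z) = q2.
  rewrite dotvDl !dotvDr !dotvNl !dotvNr !dotvZl !dotvZr (dotvC Z D) -/z2 -/p -/d2 /q2.
  by field; rewrite gt_eqF.
have q20 : 0 <= q2 by rewrite -hq dotvv_ge0.
have qw : q2 <= w ^+ 2.
  apply: le_trans W2.
  have : 0 <= (z2 - p) ^+ 2 / z2 by rewrite divr_ge0 ?sqr_ge0// ltW.
  have -> : (z2 - p) ^+ 2 / z2 = z2 - 2 * p + p ^+ 2 / z2 by field; rewrite gt_eqF.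
  rewrite /q2; lra.
have Drq : dotv D r ^+ 2 <= q2 * (C2 ^+ 2 * z2).
  have -> : dotv D r = dotv (D - (p / z2) *: Z) r.
    by rewrite dotvDl dotvNl dotvZl (dotvC Z r) rZ mulr0 subr0.
  by apply: (le_trans (dotv_sqr_le _ _)); rewrite hq; apply: ler_wpM2l.
(* The angle between [D] and [Z] is at most 45 degrees, so the tangential part of [D], the only one
   that [r] sees, is no longer than its radial part. *)
have q2p : q2 * z2 <= p ^+ 2.
  have : 2 * q2 <= d2 by rewrite -/d2 in Dw; have := sqr_ge0 w; lra.
  rewrite /q2 => h.
  have : d2 <= 2 * (p ^+ 2 / z2) by lra.
  rewrite -(ler_pM2r z20) mulrA divfK ?gt_eqF// => h3.
  by rewrite mulrBl divfK ?gt_eqF//; lra.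
have DrC : dotv D r <= C2 * p.
  rewrite (le_trans (ler_norm _))// -[leRHS]ger0_norm ?mulr_ge0//.
  rewrite -(@ler_pXn2r _ 2)// ?nnegrE// !real_normK ?num_real//.
  apply: (le_trans Drq); rewrite mulrCA exprMn; apply: ler_wpM2l => //.
  exact: sqr_ge0.
have -> : dotv D B = lam * p + dotv D r.
  by rewrite /r dotvDr dotvNr dotvZr -/p addrC subrK.
have lamC : lam <= C1 by rewrite ler_pdivrMr.
have h1 : lam * p + dotv D r <= (C1 + C2) * p.
  by rewrite mulrDl lerD// ler_wpM2r.
apply: (le_trans h1); rewrite [5 / 3 * _]mulrC -mulrA; apply: ler_wpM2l => //.
(* [(p - d2) ^ 2 <= d2 w ^ 2 <= 4/9 d2 ^ 2] *)
have h2 : dotv D (Z - D) ^+ 2 <= (2 / 3 * d2) ^+ 2.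
  apply: (le_trans (dotv_sqr_le _ _)); rewrite exprMn -/d2 [d2 ^+ 2]expr2 mulrCA.
  apply: ler_wpM2l => //.
  have : dotv (Z - D) (Z - D) <= w ^+ 2.
    by move: W2; rewrite dotvDl !dotvDr !dotvNl !dotvNr (dotvC Z D) -/z2 -/p -/d2; lra.
  by rewrite -/d2 in Dw; lra.
have : `|dotv D (Z - D)| <= 2 / 3 * d2.
  rewrite -(@ler_pXn2r _ 2)// ?nnegrE ?mulr_ge0//.
  by rewrite real_normK ?num_real.
rewrite dotvDr dotvNr -/p -/d2 ler_norml => /andP[_]; lra.
Qed.

End one_sided_lipschitz.

Section flow_lipschitz.
Context {R : realType} {d : nat} {T : R}.
Hypothesis hT : 0 < T.
Local Notation mu := (@lebesgue_measure R).

(** Paths are extended to the line by their end values rather than by 0: the integrands become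
    continuous on the whole line and agree with those of [path_ext] on [[0, T]]. *)
Let clamp (s : R) : R := Num.max 0 (Num.min s T).

Let clamp_in s : clamp s \in `[0, T]%classic.
Proof.
rewrite inE/= in_itv/= /clamp le_max lexx/= ge_max ltW//= ge_min lexx orbT//.
Qed.

Let clampK s : 0 <= s <= T -> clamp s = s.
Proof. by move=> /andP[s0 sT]; rewrite /clamp (min_idPl sT) (max_idPr s0). Qed.

Definition to_horizon (s : R) : horizon T := exist _ (clamp s) (clamp_in s).

Lemma val_to_horizon s : 0 <= s <= T -> val (to_horizon s) = s.
Proof. exact: clampK. Qed.

Lemma to_horizonK (t : horizon T) : to_horizon (val t) = t.
Proof.
apply: val_inj; rewrite /= clampK//.
by have := set_valP t; rewrite /= in_itv.
Qed.

Lemma continuous_to_horizon : continuous to_horizon.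
Proof.
apply: continuous_comp_initial => s.
rewrite (_ : _ \o _ = clamp); last exact/funext.
have c0 : {for s, continuous (fun _ : R => 0 : R^o)} by exact: cst_continuous.
have c1 : {for s, continuous (fun s : R => s : R^o)} by exact: cvg_id.
have c2 : {for s, continuous (fun _ : R => T : R^o)} by exact: cst_continuous.
exact: (continuous_max c0 (continuous_min c1 c2)).
Qed.

Lemma path_extE (y : horizon T -> 'rV[R]_d) s : 0 <= s <= T ->
  path_ext y s = y (to_horizon s).
Proof.
move=> s0T; rewrite /path_ext insubT/=; first by rewrite inE/= in_itv.
by move=> h; congr y; apply: val_inj; rewrite /= clampK.
Qed.

Variables (b : 'rV[R]_d -> 'rV[R]_d) (C1 C2 : R).
Hypothesis hb : continuous b.
Hypothesis hC : 0 <= C1 + C2.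
Hypothesis hb1 : forall eta zeta : 'rV[R]_d,
  dotv (b eta - b zeta) (eta - zeta) <= C1 * enorm (eta - zeta) ^+ 2.
Hypothesis hb2 : forall eta zeta : 'rV[R]_d, eta - zeta != 0 ->
  enorm (b eta - b zeta
    - (dotv (b eta - b zeta) (eta - zeta) / enorm (eta - zeta) ^+ 2)
      *: (eta - zeta)) <= C2 * enorm (eta - zeta).
Variables (xi : 'rV[R]_d) (x x' : c0path d T) (y y' : cxipath T xi).
Hypothesis hy : is_solution b x y.
Hypothesis hy' : is_solution b x' y'.

Let bt (z : cxipath T xi) (i : 'I_d) (s : R) : R := b (z (to_horizon s)) 0 i.

Let continuous_bt z i : continuous (bt z i).
Proof.
move=> s; apply: (@continuous_comp _ _ _ (fun s => b (z (to_horizon s)))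
    (fun v : 'rV[R]_d => v 0 i)); last exact: coord_continuous.
apply: (@continuous_comp _ _ _ (fun s => z (to_horizon s)) b); last exact: hb.
apply: (@continuous_comp _ _ _ to_horizon (z : cpath d T)).
  exact: continuous_to_horizon.
exact: cpath_continuous.
Qed.

Let del i s := bt y i s - bt y' i s.

Let continuous_del i : continuous (del i).
Proof. by move=> s; apply: cvgB; exact: continuous_bt. Qed.

Let intc (f : R -> R) (a c : R) : continuous f -> mu.-integrable `[a, c] (EFin \o f).
Proof.
move=> cf; apply: continuous_compact_integrable; first exact: segment_compact.
exact: continuous_subspaceT.
Qed.

(** The lower limit [-1] makes 0 an interior point, so the two-sided derivative exists there as
    well. On [[0, T]] this is the difference of the drift integrals. *)
Let D i (t : R) : R := \int[mu]_(s in `[-1, t]) del i s - \int[mu]_(s in `[-1, 0]) del i s.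

Let derD (i : 'I_d) (t : R) : 0 <= t -> is_derive t 1 (D i) (del i t).
Proof.
move=> t0; have h : -1 < t by lra.
have t1 : t < t + 1 by rewrite ltrDl.
have [d1 d2] := continuous_FTC1_closed t1 (intc (-1) (t + 1) (@continuous_del i)) h
  (@continuous_del i t).
rewrite -[del i t]subr0; apply: is_deriveB.
by apply: DeriveDef; [exact: d1|rewrite -derive1E; exact: d2].
Qed.

Let D0 i : D i 0 = 0. Proof. by rewrite /D subrr. Qed.

Let DE i (t : horizon T) : D i (val t) = (y t - y' t) 0 i
  - (x t - x' t) 0 i.
Proof.
have /andP[t0 tT] : 0 <= val t <= T by have := set_valP t; rewrite /= in_itv.
have Dt : D i (val t) = \int[mu]_(s in `[0, val t]) del i s.
  rewrite /D Rintegral_itvB ?bnd_simp//; last exact: intc.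
  - rewrite Rintegral_itv_obnd_cbnd//.
    apply: (integrableS _ _ _ (intc 0 (val t) (@continuous_del i))) => //.
    exact: subset_itv_oc_cc.
have e (z : cxipath T xi) : \int[mu]_(s in `[0, val t]) b (path_ext z s) 0 i =
    \int[mu]_(s in `[0, val t]) bt z i s.
  apply: eq_Rintegral => s; rewrite inE/= in_itv/= => /andP[s0 st].
  by rewrite /bt path_extE// s0 (le_trans st).
rewrite Dt RintegralB//; try exact: intc.
rewrite hy hy' !mxE !e; ring.
Qed.

(** [Y - Y'] need not be differentiable, but [D = (Y - Y') - (X - X')] is. The barrier for
    [|D|^2 expR (- 10/3 k s)], at height [(3/2 w)^2], gives [|D| <= 3/2 w expR (5/3 k T)]; rounding
    5/3 up to 2 and adding [|X - X'| <= w] gives the constant 5/2. *)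
Lemma solution_lipschitz :
  `|(y : cpath d T) - (y' : cpath d T)| <= 5 / 2 * expR (2 * T * (C1 + C2)) * `|x - x'|.
Proof.
set w := `|x - x'|; set k := C1 + C2.
have w0 : 0 <= w by exact: normr_ge0.
have xw t : enorm (x t - x' t) <= w by exact: (supnorm_ub (c0path_val (x - x')) t).
apply: supnorm_le => [|t]; first by rewrite !mulr_ge0 ?expR_ge0.
pose u (s : R) := \sum_(i < d) D i s ^+ 2.
pose Dv s : 'rV[R]_d := \row_i D i s.
have uE s : u s = dotv (Dv s) (Dv s).
  by apply: eq_bigr => i _; rewrite !mxE expr2.
pose al := 10 / 3 * k.
pose v s := u s * expR (- al * s).
pose du s := \sum_(i < d) 2 * D i s * del i s.
pose dv s := u s * (- al * expR (- al * s)) + expR (- al * s) * du s.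
have dvP (s : R) : 0 <= s <= T -> is_derive s 1 v (dv s).
  move=> /andP[s0 _].
  have hu : is_derive s 1 u (du s).
    have -> : u = \sum_(i < d) (D i ^+ 2).
      by apply/funext => r; rewrite fct_sumE.
    apply: is_derive_sum => i.
    exact: (@is_deriveX _ _ (D i) 2 s 1 _ (derD i s0)).
  have he : is_derive s 1 (fun s : R => expR (- al * s)) (- al * expR (- al * s)).
    have hl : is_derive s 1 (fun s : R => - al * s) (- al).
      have := @is_deriveZ _ _ _ id (- al) s 1 1 (is_derive_id _ _).
      by rewrite [- al *: 1](mulr1 (- al)).
    have := @is_derive1_comp R expR (fun s : R => - al * s) s _ _ (is_derive_expR _) hl.
    by rewrite mulrC.
  exact: is_deriveM.
have v0 : v 0 <= 9 / 4 * w ^+ 2.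
  rewrite /v /u big1 => [|i _]; first by rewrite mul0r mulr_ge0 ?sqr_ge0.
  by rewrite D0 expr0n.
have dv0 s : 0 < s <= T -> 9 / 4 * w ^+ 2 < v s -> dv s <= 0.
  move=> /andP[s0 sT] hv.
  have k0 : 0 <= al by rewrite mulr_ge0.
  have u0 : 0 <= u s by apply: sumr_ge0 => i _; exact: sqr_ge0.
  have us : 9 / 4 * w ^+ 2 <= dotv (Dv s) (Dv s).
    rewrite -uE (le_trans (ltW hv))// /v ler_piMr// -[leRHS]expR0 ler_expR.
    by rewrite mulNr oppr_le0 mulr_ge0// ltW.
  have sE : s = val (to_horizon s) by rewrite val_to_horizon// ltW.
  have DvE : Dv s = (y (to_horizon s) - y' (to_horizon s)) -
      (x (to_horizon s) - x' (to_horizon s)).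
    by apply/rowP => i; rewrite mxE {1}sE DE [RHS]mxE [X in _ = _ + X]mxE.
  have hZ : enorm ((y (to_horizon s) - y' (to_horizon s)) - Dv s) <= w.
    by rewrite DvE subKr; exact: xw.
  have := drift_dotv_le hC hb1 hb2 w0 hZ us.
  rewrite -uE => h.
  have duE : du s = 2 * dotv (Dv s) (b (y (to_horizon s)) - b (y' (to_horizon s))).
    rewrite /du /dotv mulr_sumr; apply: eq_bigr => i _.
    by rewrite !mxE mulrA.
  have -> : dv s = expR (- al * s) * (du s - al * u s) by rewrite /dv; ring.
  rewrite pmulr_rle0 ?expR_gt0// duE /al; move: h; rewrite -/k; lra.
have tT : 0 <= val t <= T by have := set_valP t; rewrite /= in_itv.
have hv := le_barrier dvP v0 dv0 tT.
have hu : enorm (Dv (val t)) <= 3 / 2 * w * expR (2 * T * k).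
  have r0 : 0 <= 3 / 2 * w * expR (2 * T * k) by rewrite !mulr_ge0 ?expR_ge0.
  rewrite -(@ler_pXn2r _ 2)// ?nnegrE ?enorm_ge0// sqr_enorm -uE exprMn -expRM_natl.
  have : u (val t) <= 9 / 4 * w ^+ 2 * expR (al * val t).
    by rewrite -ler_pdivrMr ?expR_gt0// -expRN -mulNr.
  move=> /le_trans; apply.
  rewrite (_ : (3 / 2 * w) ^+ 2 = 9 / 4 * w ^+ 2); last by field.
  rewrite ler_wpM2l ?mulr_ge0 ?sqr_ge0// ler_expR /al.
  have -> : 2%:R * (2 * T * k) = 4 * k * T by ring.
  apply: ler_pM; rewrite ?mulr_ge0//.
  - by case/andP: tT.
  - by rewrite ler_wpM2r//; lra.
  - by case/andP: tT.
have -> : ((y : cpath d T) - (y' : cpath d T)) t = Dv (val t) + (x t - x' t).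
  by apply/rowP => i; rewrite [RHS]mxE [X in _ = X + _]mxE DE subrK.
apply: (le_trans (ler_enormD _ _)).
have e1 : 1 <= expR (2 * T * k).
  by rewrite -expR0 ler_expR !mulr_ge0// ltW.
have : w <= w * expR (2 * T * k) by rewrite ler_peMr.
have := xw t; lra.
Qed.

End flow_lipschitz.

(** * Measurability and discretization of path functionals *)

Section path_functionals.
Context {R : realType} {d : nat} {T : R}.
Hypothesis hT : 0 < T.
Local Notation C0 := (c0path d T).

Lemma enorm0 : enorm (0 : 'rV[R]_d) = 0.
Proof. by rewrite -(scale0r (0 : 'rV[R]_d)) enormZ normr0 mul0r. Qed.

Lemma enormN (u : 'rV[R]_d) : enorm (- u) = enorm u.
Proof. by rewrite -scaleN1r enormZ normrN1 mul1r. Qed.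

Lemma lipschitz_continuous (phi : C0 -> R) (C : R) :
  (forall x y, phi x - phi y <= C * `|x - y|) -> continuous phi.
Proof.
move=> lip x; have FF : Filter (nbhs (x : C0)) by exact: nbhs_filter.
rewrite /continuous_at; apply/(@cvgrPdist_lt _ _ _ (nbhs (x : C0)) FF) => e e0.
pose K := `|C| + 1.
have K0 : 0 < K by rewrite ltr_wpDl.
near=> y.
have h : `|x - y| < e / K.
  near: y; have := @nbhsx_ballx _ C0 x (e / K) (divr_gt0 e0 K0).
  by apply: filterS => y; rewrite -ball_normE.
have hC (u v : C0) : phi u - phi v <= K * `|u - v|.
  apply: (le_trans (lip u v)); rewrite ler_wpM2r//.
  by rewrite (le_trans (ler_norm _))// lerDl.
have := hC x y; have := hC y x; rewrite -(distrC x y) => h1 h2.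
have h3 : K * `|x - y| < e by rewrite mulrC -ltr_pdivlMr.
by rewrite ltr_norml; apply/andP; split; lra.
Unshelve. all: by end_near. Qed.

Lemma lipschitz_measurable (phi : C0 -> R) (C : R) :
  (forall x y, phi x - phi y <= C * `|x - y|) -> measurable_fun setT phi.
Proof.
move=> /lipschitz_continuous cphi.
apply: (measurability _ (RGenOInfty.measurableE R)).
move=> _ [_ [q ->] <-]; rewrite setTI; apply: sub_sigma_algebra.
by move/continuousP: cphi; apply; exact: interval_open.
Qed.

Lemma measurable_c0norm : measurable_fun setT (fun x : C0 => `|x| : R).
Proof.
apply: (@lipschitz_measurable _ 1) => x y; rewrite mul1r.
by rewrite lerBlDr -{1}(subrK y x) ler_normD.
Qed.

Lemma coord_le_enorm (u : 'rV[R]_d) i : `|u 0 i| <= enorm u.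
Proof.
rewrite -(@ler_pXn2r _ 2)// ?nnegrE ?enorm_ge0// sqr_enorm real_normK ?num_real//.
rewrite /dotv (bigD1 i)//= -expr2 lerDl; apply: sumr_ge0 => j _.
by rewrite -expr2 sqr_ge0.
Qed.

Lemma enorm_le_sum (u : 'rV[R]_d) : enorm u <= \sum_i `|u 0 i|.
Proof.
have s0 : 0 <= \sum_i `|u 0 i| by apply: sumr_ge0.
rewrite -(@ler_pXn2r _ 2)// ?nnegrE ?enorm_ge0// sqr_enorm.
rewrite expr2 mulr_suml; apply: ler_sum => i _.
rewrite -expr2 -real_normK ?num_real// expr2; apply: ler_wpM2l => //.
by rewrite (bigD1 i)//= lerDl sumr_ge0.
Qed.

Lemma enorm_le_enorm (u v : 'rV[R]_d) : (forall i, `|u 0 i| <= `|v 0 i|) ->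
  enorm u <= enorm v.
Proof.
move=> h; rewrite ler_sqrt ?dotvv_ge0//; apply: ler_sum => i _.
rewrite -!expr2 -real_normK ?num_real// -[leRHS]real_normK ?num_real//.
by rewrite ler_pXn2r// nnegrE.
Qed.

Lemma path_coord_le (x : C0) t i : `|x t 0 i| <= `|x|.
Proof. exact: le_trans (coord_le_enorm _ _) (supnorm_ub x t). Qed.

Lemma measurable_path_coord (t : horizon T) i :
  measurable_fun setT (fun x : C0 => x t 0 i).
Proof.
apply: (@lipschitz_measurable _ 1) => x y; rewrite mul1r.
apply: le_trans (path_coord_le (x - y) t i).
apply: le_trans (ler_norm _); rewrite le_eqVlt; apply/orP; left; apply/eqP.
by rewrite [in RHS](_ : (c0path_val (x - y)) t = x t - y t)// !mxE.
Qed.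

Definition modulus_set n (x : cpath d T) : set R :=
  [set r | exists s t : horizon T, `|val s - val t| <= T / n.+1%:R /\ r = enorm (x s - x t)].

Definition modulus n (x : cpath d T) : R := sup (modulus_set n x).

Let modulus_set_ub n x : ubound (modulus_set n x) (2 * supnorm x).
Proof.
move=> _ [s [t [_ ->]]]; apply: (le_trans (ler_enormD _ _)); rewrite enormN.
have := supnorm_ub x s; have := supnorm_ub x t; lra.
Qed.

Let modulus_set0 n x : modulus_set n x !=set0.
Proof.
pose t := to_horizon hT 0.
exists (enorm (x t - x t)), t, t; split=> //.
by rewrite subrr normr0 divr_ge0// ltW.
Qed.

Lemma modulus_ub n (x : cpath d T) s t : `|val s - val t| <= T / n.+1%:R ->
  enorm (x s - x t) <= modulus n x.
Proof.
move=> st; apply: ub_le_sup; first by exists (2 * supnorm x); exact: modulus_set_ub.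
by exists s, t.
Qed.

Lemma modulus_le n (x : cpath d T) M : (forall s t, `|val s - val t| <= T / n.+1%:R ->
  enorm (x s - x t) <= M) -> modulus n x <= M.
Proof.
move=> h; apply: ge_sup; first exact: modulus_set0.
by move=> _ [s [t [st ->]]]; exact: h.
Qed.

Lemma modulus_ge0 n (x : cpath d T) : 0 <= modulus n x.
Proof.
pose t := to_horizon hT 0; apply: le_trans (@modulus_ub n x t t _).
  exact: enorm_ge0.
by rewrite subrr normr0 divr_ge0// ltW.
Qed.

Lemma modulus_le_supnorm n (x : cpath d T) : modulus n x <= 2 * supnorm x.
Proof.
apply: modulus_le => s t st.
exact: (@modulus_set_ub n x _ (ex_intro _ s (ex_intro _ t (conj st erefl)))).
Qed.

Lemma measurable_modulus n : measurable_fun setT (fun x : C0 => modulus n x).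
Proof.
apply: (@lipschitz_measurable _ 2) => x y; rewrite lerBlDr.
apply: modulus_le => s t st.
have -> : x s - x t =
    (((c0path_val (x - y)) s - (c0path_val (x - y)) t)) +
    (y s - y t).
  rewrite [(c0path_val (x - y)) s](_ : _ = x s - y s)//.
  rewrite [(c0path_val (x - y)) t](_ : _ = x t - y t)//.
  by apply/rowP => i; rewrite !mxE; ring.
apply: (le_trans (ler_enormD _ _)); rewrite lerD ?modulus_ub//.
exact: (@modulus_set_ub n (c0path_val (x - y)) _ (ex_intro _ s (ex_intro _ t (conj st erefl)))).
Qed.

(** Heine-Cantor as a near-covering: around each time [s0] the bound holds jointly for [s] near [s0]
    and [n] large, and compactness of [[0, T]] yields one range of [n] for all times. *)
Lemma cvg_modulus (x : cpath d T) : modulus n x @[n --> \oo] --> (0 : R).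
Proof.
pose f (s : R) := x (to_horizon hT s).
have cf : continuous f.
  move=> s; apply: continuous_comp; first exact: continuous_to_horizon.
  exact: cpath_continuous.
apply/cvgrPdist_le => e e0.
pose P (n : nat) (s : R) := forall t, `|s - t| <= T / n.+1%:R -> enorm (f s - f t) <= e.
have hcov : \forall n \near \oo, `[0, T]%classic `<=` P n.
  apply: (iffLR (compact_near_coveringP _) (@segment_compact R 0 T)) => s0 _.
  have : \forall s \near s0, enorm (f s - f s0) < e / 2.
    have cg : {for s0, continuous (fun s => enorm (f s - f s0))}.
      apply: (@continuous_comp _ _ _ (fun s => f s - f s0) enorm).
        by apply: cvgB; [exact: cf|exact: cvg_cst].
      exact: enorm_continuous.
    have e2 : 0 < e / 2 by rewrite divr_gt0.
    have := cvgr_lt _ cg (e / 2); rewrite subrr enorm0; exact.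
  move=> /nbhs_ballP[r /= r0 hr].
  have r20 : 0 < r / 2 by rewrite divr_gt0.
  exists (ball s0 (r / 2), [set n | T / n.+1%:R < r / 2]); first split=> /=.
  - exact: nbhsx_ballx.
  - near=> n; rewrite /= ltr_pdivrMr ?ltr0n// -ltr_pdivrMl//.
    apply: (@lt_trans _ _ n%:R); last by rewrite ltr_nat.
    near: n; exact: nbhs_infty_gtr.
  - move=> [s n] /= [bs hn] t st.
    have hs : enorm (f s - f s0) < e / 2.
      by apply: hr; rewrite /ball/= in bs *; lra.
    have ht : enorm (f t - f s0) < e / 2.
      apply: hr; rewrite /ball/= in bs *.
      have : `|s0 - t| <= `|s0 - s| + `|s - t|.
        by rewrite -[s0 - t](subrKA s) ler_normD.
      have hst : `|s - t| < r / 2 by exact: le_lt_trans st hn.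
      by move=> /le_lt_trans; apply; rewrite [ltRHS](splitr r) ltrD.
    have -> : f s - f t = (f s - f s0) + - (f t - f s0) by rewrite opprB addrA subrK.
    by apply: (le_trans (ler_enormD _ _)); rewrite enormN; lra.
near=> n; rewrite sub0r normrN ger0_norm ?modulus_ge0//.
apply: modulus_le => s t st.
rewrite -(to_horizonK hT s) -(to_horizonK hT t).
have hn : `[0, T]%classic `<=` P n by near: n.
by apply: hn => //; exact: set_valP.
Unshelve. all: by end_near. Qed.

End path_functionals.

Section time_grid.
Context {R : realType} {T : R}.
Hypothesis hT : 0 < T.

(** There are [n + 2] nodes: the [n + 1] cells of length [T / (n + 1)] with both endpoints. *)
Definition grid n (i : 'I_n.+2) : horizon T := to_horizon hT (i%:R * (T / n.+1%:R)).

Lemma grid_close n (t : horizon T) :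
  exists i : 'I_n.+2, `|val t - val (grid i)| <= T / n.+1%:R.
Proof.
have /andP[t0 tT] : 0 <= val t <= T by have := set_valP t; rewrite /= in_itv.
have h0 : 0 < T / n.+1%:R by rewrite divr_gt0// ltr0n.
have q0 : 0 <= val t / (T / n.+1%:R) by rewrite divr_ge0// ltW.
have /andP[h1 h2] := truncn_itv q0.
set i := Num.truncn _ in h1 h2.
have iT : i%:R * (T / n.+1%:R) <= val t by rewrite -ler_pdivlMr.
have i_lt : (i < n.+2)%N.
  rewrite ltnS -(ler_nat R) (le_trans h1)// ler_pdivrMr//.
  by rewrite mulrC divfK// gt_eqF ?ltr0n.
exists (Ordinal i_lt); rewrite val_to_horizon/=; last first.
  by rewrite mulr_ge0 ?(ltW h0)//= (le_trans iT).
rewrite ger0_norm ?subr_ge0// lerBlDl -{2}[T / _]mul1r -mulrDl natr1.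
by rewrite -ler_pdivrMr// ltW.
Qed.

End time_grid.

Section grid_sup.
Context {R : realType} {d : nat} {T : R}.
Hypothesis hT : 0 < T.

Definition grid_sup n (x : cpath d T) : R := \big[Num.max/0]_(i < n.+2) enorm (x (grid hT i)).

Lemma grid_sup_le n x : grid_sup n x <= `|x|.
Proof. by apply: bigmax_le => // i _; exact: supnorm_ub. Qed.

Lemma le_grid_sup n x : `|x| <= grid_sup n x + modulus n x.
Proof.
apply: supnorm_le => [|t].
  apply: addr_ge0; last exact: modulus_ge0.
  by rewrite /grid_sup; elim/big_ind: _ => [|a b a0 b0|i _]; rewrite ?le_max ?a0 ?enorm_ge0.
have [i hi] := grid_close hT n t.
rewrite -[x t](subrK (x (grid hT i))).
apply: (le_trans (ler_enormD _ _)); rewrite addrC; apply: lerD.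
  exact: (le_bigmax _ (fun i => enorm (x (grid hT i))) i).
exact: modulus_ub.
Qed.

(** The norm becomes a limit of functionals of finitely many values; this carries inequalities for
    Gaussian vectors over to paths and gives measurability on products. *)
Lemma cvg_grid_sup x : grid_sup n x @[n --> \oo] --> (`|x| : R).
Proof.
apply: (@squeeze_cvgr _ _ _ _ (fun n => `|x| - modulus n x) (fun=> `|x|)).
- by apply: nearW => n; rewrite grid_sup_le andbT lerBlDr le_grid_sup.
- rewrite -[X in _ --> X]subr0; apply: cvgB; first exact: cvg_cst.
  exact: cvg_modulus.
- exact: cvg_cst.
Qed.

End grid_sup.

Section measurable_bigmax.
Context {d} {S : measurableType d} {R : realType}.

Lemma measurable_bigmax (I : Type) (s : seq I) (h : I -> S -> R) :
  (forall i, measurable_fun setT (h i)) ->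
  measurable_fun setT (fun x => \big[Num.max/0]_(i <- s) h i x).
Proof.
move=> mh; elim: s => [|i s IH].
  by under eq_fun do rewrite big_nil; exact: measurable_cst.
under eq_fun do rewrite big_cons.
exact: measurable_maxr.
Qed.

End measurable_bigmax.

Lemma measurable_enorm {d} {S : measurableType d} {R : realType} {k} (u : S -> 'rV[R]_k) :
  (forall i, measurable_fun setT (fun x => u x 0 i)) ->
  measurable_fun setT (fun x => enorm (u x)).
Proof.
move=> mu; apply: (@measurableT_comp _ _ _ _ _ _ (@Num.sqrt R)).
  by apply: continuous_measurable_fun; exact: sqrt_continuous.
by apply: measurable_sum => i; exact: measurable_funM.
Qed.

Section grid_vectors.
Context {R : realType} {d m : nat}.
Local Notation N := #|{: 'I_m * 'I_d}|.

Lemma sum_block (F : 'I_N -> R) :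
  \sum_j F j = \sum_i \sum_k F (enum_rank (i, k)).
Proof.
rewrite pair_bigA/= (reindex (@enum_rank _)); last exact/onW_bij/enum_rank_bij.
by apply: eq_bigr => -[].
Qed.

Definition block (z : N.-tuple R) (i : 'I_m) : 'rV[R]_d :=
  \row_k tnth z (enum_rank (i, k)).

Definition block_norm (z : N.-tuple R) : R := \big[Num.max/0]_i enorm (block z i).

Lemma block_norm_le z (B : R) : 0 <= B -> (forall i, enorm (block z i) <= B) ->
  block_norm z <= B.
Proof. by move=> B0 h; apply: bigmax_le. Qed.

Lemma block_norm_ub z i : enorm (block z i) <= block_norm z.
Proof. exact: le_bigmax. Qed.

Lemma measurable_block_norm : measurable_fun setT block_norm.
Proof.
apply: measurable_bigmax => i; apply: measurable_enorm => k.
by under eq_fun do rewrite mxE; exact: measurable_tnth.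
Qed.

End grid_vectors.

(** * Variances of a Gaussian process and Fernique's bound *)

Section gaussian_paths.
Context {R : realType} {d : nat} {T : R}.
Hypothesis hT : 0 < T.
Context {dO} {Omega : measurableType dO} (P : probability Omega R).
Variable X : {mfun Omega >-> c0path d T}.
Hypothesis hX : gaussian_process P X.

Definition path_var (t : horizon T) (v : 'rV[R]_d) : R :=
  \int[P]_w (dotv v (X w t)) ^+ 2 - (\int[P]_w dotv v (X w t)) ^+ 2.

Lemma gaussian_marginal t (v : 'rV[R]_d) : is_gaussian P (fun w => dotv v (X w t)).
Proof.
have := hX (fun _ : 'I_1 => t) (fun=> v); congr is_gaussian.
by apply/funext => w; rewrite big_ord1.
Qed.

Lemma measurable_marginal_coord t k : measurable_fun setT (fun w => X w t 0 k).
Proof.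
by apply: (@measurableT_comp _ _ _ _ _ _ (fun x : c0path d T => x t 0 k));
  [exact: measurable_path_coord|exact: measurable_funPT].
Qed.

Lemma measurable_marginal t (v : 'rV[R]_d) :
  measurable_fun setT (fun w => dotv v (X w t)).
Proof.
apply: measurable_sum => k; apply: measurable_funM; first exact: measurable_cst.
exact: measurable_marginal_coord.
Qed.

Lemma measurable_normX : measurable_fun setT (fun w => `|X w| : R).
Proof.
by apply: (@measurableT_comp _ _ _ _ _ _ (fun x : c0path d T => `|x| : R));
  [exact: measurable_c0norm|exact: measurable_funPT].
Qed.

Lemma path_var_law t v m s : (forall A, measurable A ->
    P ((fun w => dotv v (X w t)) @^-1` A) = gaussian_law m s A) ->
  path_var t v = s ^+ 2.
Proof.
move=> h; rewrite /path_var.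
rewrite (Rintegral_gaussian_sqr (measurable_marginal t v) h).
by rewrite (Rintegral_gaussian_mean (measurable_marginal t v) h) addrAC subrr add0r.
Qed.

Lemma normX_leE M : [set w | `|X w| <= M] = setT `&` (fun w => `|X w| : R) @^-1` `]-oo, M].
Proof. by rewrite setTI; apply/seteqP; split=> w /=; rewrite in_itv. Qed.

Lemma measurable_normX_le M : measurable [set w | `|X w| <= M].
Proof. by rewrite normX_leE; exact: measurable_normX. Qed.

Lemma normX_half : exists2 M : R, 0 <= M & ((1 / 2)%:E <= P [set w | (`|X w| <= M)%R])%E.
Proof.
pose U : {mfun Omega >-> R} :=
  HB.pack (fun w => `|X w| : R) (isMeasurableFun.Build _ _ _ _ _ measurable_normX).
have h := @cvg_ccdfy0 _ _ _ P U.
have [M M0 hM] : exists2 M, 0 <= M & (@ccdf _ _ _ P U M < (1 / 2)%:E)%E.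
  have : \forall M \near +oo%R, (@ccdf _ _ _ P U M < (1 / 2)%:E)%E.
    apply: (h [set x | (x < (1 / 2)%:E)%E]).
    change (\forall r \near (0 : R), (r%:E < (1 / 2)%:E)%E).
    apply/nbhs_ballP; exists (1 / 2); rewrite //= => x.
    rewrite /ball/= => hx; rewrite lte_fin.
    by move: hx; rewrite ltr_norml => /andP[+ _]; lra.
  move=> hh; near (+oo%R : set_system R) => M.
  by exists M; [near: M; exact: nbhs_pinfty_ge|near: M].
exists M => //.
have := @cdf_ccdf_1 _ _ _ P U M; rewrite /cdf => e.
have hc : (P [set w | (`|X w| <= M)%R] + @ccdf _ _ _ P U M = 1)%E.
  by rewrite -e normX_leE setTI.
have cf : @ccdf _ _ _ P U M \is a fin_num.
  by rewrite ge0_fin_numE ?measure_ge0// (lt_trans hM)// ltry.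
move: hM hc; rewrite -(fineK cf) lte_fin.
have pf : P [set w | (`|X w| <= M)%R] \is a fin_num.
  by apply: fin_num_measure; exact: measurable_normX_le.
rewrite -(fineK pf) -EFinD => h1 [] h2; rewrite lee_fin; lra.
Unshelve. all: by end_near. Qed.

(** A normal density is at most [1 / |s|], so mass 1/2 on [[- B, B]] with [B = enorm v * M] forces
    [|s| <= 4 B]. The added 1 keeps the bound positive when [M = 0]. This variance bound is finite
    without any information on the weak variance. *)
Lemma path_var_bound : exists2 s2 : R, 0 < s2 &
  forall t v, path_var t v <= s2 * dotv v v.
Proof.
have [M M0 hM] := normX_half.
exists (16 * M ^+ 2 + 1) => [|t v].
  by rewrite ltr_wpDl// mulr_ge0// sqr_ge0.
have [m [s hs]] := gaussian_marginal t v.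
rewrite (path_var_law hs).
have [->|s0] := eqVneq s 0.
  by rewrite expr0n mulr_ge0 ?dotvv_ge0// addr_ge0 ?mulr_ge0 ?sqr_ge0.
pose B := enorm v * M.
pose I : set R := `[- B, B]%classic.
have B0 : 0 <= B by rewrite mulr_ge0 ?enorm_ge0.
have h1 : ((1 / 2)%:E <= normal_prob m s I)%E.
  apply: (le_trans hM).
  have := hs I (measurable_itv _).
  rewrite /gaussian_law (negbTE s0) => <-.
  apply: le_measure; rewrite ?inE.
  - exact: measurable_normX_le.
  - by rewrite -[X in measurable X]setTI; exact: (measurable_marginal t v measurableT (measurable_itv _)).
  move=> w /= hw; rewrite /I/= in_itv/= -ler_norml.
  have hx : enorm (X w t) <= M.
    exact: le_trans (supnorm_ub _ t) hw.
  have := normr_dotv_le v (X w t).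
  by move=> /le_trans; apply; rewrite ler_wpM2l ?enorm_ge0.
have h2 : (normal_prob m s I <= (normal_peak s * (2 * B))%:E)%E.
  rewrite /normal_prob.
  apply: (@le_trans _ _ (\int[lebesgue_measure]_(x in I) (cst (normal_peak s)%:E) x)%E).
    apply: ge0_le_integral => //.
    - exact: measurable_itv.
    - by move=> x _; rewrite lee_fin normal_pdf_ge0.
    - by apply/measurable_EFinP; apply: measurable_funTS; exact: measurable_normal_pdf.
    - by move=> x _; rewrite /= lee_fin normal_pdf_ub.
  rewrite integral_cst/=; last exact: measurable_itv.
  rewrite /I lebesgue_measure_itv/= lte_fin.
  case: ltP => [_|_]; first by rewrite -EFinB -EFinM lee_fin opprK; lra.
  by rewrite mule0 lee_fin; apply: mulr_ge0; [exact: normal_peak_ge0|rewrite mulr_ge0].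
have := le_trans h1 h2; rewrite lee_fin => h3.
have h4 : normal_peak s <= `|s|^-1.
  rewrite /normal_peak lef_pV2 ?posrE ?normr_gt0 ?sqrtr_gt0//; last first.
    by rewrite mulrn_wgt0// mulr_gt0 ?pi_gt0// exprn_even_gt0.
  rewrite -sqrtr_sqr ler_sqrt; last first.
    by rewrite mulrn_wge0// mulr_ge0 ?sqr_ge0// ltW// pi_gt0.
  rewrite -mulr_natr -mulrA ler_peMr ?sqr_ge0//.
  have := pi_ge2 R; lra.
have h5 : `|s| <= 4 * B.
  have : 1 / 2 <= `|s|^-1 * (2 * B).
    by apply: (le_trans h3); rewrite ler_wpM2r// mulr_ge0.
  by rewrite ler_pdivlMl ?normr_gt0//; lra.
rewrite -real_normK ?num_real//.
have : `|s| ^+ 2 <= (4 * B) ^+ 2 by apply: lerXn2r; rewrite ?nnegrE ?normr_ge0 ?(mulr_ge0 _ B0).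
rewrite /B !exprMn sqr_enorm => /le_trans; apply.
have := dotvv_ge0 v; have := sqr_ge0 M.
rewrite mulrDl mul1r; lra.
Qed.

End gaussian_paths.

Section grid_prekopa_leindler.
Context {R : realType} {d : nat} {T : R}.
Hypothesis hT : 0 < T.
Context {dO} {Omega : measurableType dO} (P : probability Omega R).
Variable X : {mfun Omega >-> c0path d T}.
Hypothesis hX : gaussian_process P X.
Variable s2 : R.
Hypothesis s2_gt0 : 0 < s2.
Hypothesis var_le : forall t v, path_var P X t v <= s2 * dotv v v.
Context {m : nat} (tau : 'I_m -> horizon T).
Local Notation N := #|{: 'I_m * 'I_d}|.

Definition grid_coord (j : 'I_N) (w : Omega) : R :=
  X w (tau (enum_val j).1) 0 (enum_val j).2.

Definition grid_vec w : N.-tuple R := vec grid_coord w.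

Lemma block_grid_vec w i : block (grid_vec w) i = X w (tau i).
Proof. by apply/rowP => k; rewrite mxE tnth_mktuple /grid_coord enum_rankK. Qed.

Lemma measurable_grid_coord j : measurable_fun setT (grid_coord j).
Proof. exact: measurable_marginal_coord. Qed.

Lemma measurable_grid_vec : measurable_fun setT grid_vec.
Proof.
apply/measurable_fun_tnthP => i.
rewrite (_ : _ \o _ = grid_coord i); first exact: measurable_grid_coord.
by apply/funext => w; rewrite /= tnth_mktuple.
Qed.

Lemma grid_coord_sum (a : 'I_N -> R) w : \sum_j a j * grid_coord j w =
  \sum_i dotv (\row_k a (enum_rank (i, k))) (X w (tau i)).
Proof.
rewrite sum_block; apply: eq_bigr => i _; apply: eq_bigr => k _.
by rewrite mxE /grid_coord enum_rankK.
Qed.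

Lemma grid_coord_gaussian (a : 'I_N -> R) :
  is_gaussian P (fun w => \sum_j a j * grid_coord j w).
Proof.
under eq_fun do rewrite grid_coord_sum.
exact: (hX tau).
Qed.

Let block_weight i (v : 'rV[R]_d) (j : 'I_N) : R :=
  if (enum_val j).1 == i then v 0 (enum_val j).2 else 0.

Let sum_block_weight i v (F : 'I_N -> R) :
  \sum_j block_weight i v j * F j = \sum_k v 0 k * F (enum_rank (i, k)).
Proof.
rewrite sum_block (bigD1 i)//= [X in _ + X]big1 ?addr0 => [|i' i'i].
  by apply: eq_bigr => k _; rewrite /block_weight enum_rankK eqxx.
by apply: big1 => k _; rewrite /block_weight enum_rankK (negbTE i'i) mul0r.
Qed.

(** Tested with the functional [z |-> dotv v (block z i)] in the direction
    [v = block z i - block z' i], the admissibility of [r] reads [|v|^4 <= r s2 |v|^2], that is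
    [|v|^2 <= s2 r] for each [i]. *)
Lemma grid_prekopa_leindler (f g : N.-tuple R -> R) : bmf f -> bmf g ->
  (forall z, 0 <= f z) -> (forall z, 0 <= g z) ->
  (forall z z' r, 0 <= r ->
    (forall i, dotv (block z i - block z' i) (block z i - block z' i) <= r) ->
    f z * g z' ^+ 3 <= expR (3 / (8 * s2) * r)) ->
  (\int[P]_w f (grid_vec w)) * (\int[P]_w g (grid_vec w)) ^+ 3 <= 1.
Proof.
move=> bf bg f0 g0 fg.
apply: (gaussian_prekopa_leindler measurable_grid_coord grid_coord_gaussian bf bg f0 g0).
move=> z z' r r0 hr.
have -> : 3 / 8 * r = 3 / (8 * s2) * (s2 * r).
  by field; rewrite gt_eqF.
apply: fg => [|i]; first by rewrite mulr_ge0// ltW.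
set v := _ - _; set q := dotv v v.
have q0 : 0 <= q by exact: dotvv_ge0.
have h : q ^+ 2 <= r * (s2 * q).
  have -> : q = \sum_j block_weight i v j * (tnth z j - tnth z' j).
    rewrite sum_block_weight; apply: eq_bigr => k _.
    by congr (_ * _); rewrite !mxE.
  apply: (le_trans (hr _)); rewrite ler_wpM2l//.
  have -> : lin_var P grid_coord (block_weight i v) = path_var P X (tau i) v.
    have e w : \sum_j block_weight i v j * grid_coord j w = dotv v (X w (tau i)).
      rewrite sum_block_weight; apply: eq_bigr => k _.
      by rewrite /grid_coord enum_rankK.
    rewrite /lin_var /path_var; congr (_ - _ ^+ 2).
      by apply: eq_Rintegral => w _; rewrite e.
    by apply: eq_Rintegral => w _; rewrite e.
  rewrite (_ : \sum_j _ = q); first exact: var_le.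
  rewrite sum_block_weight; apply: eq_bigr => k _.
  by congr (_ * _); rewrite !mxE.
have [->|qn0] := eqVneq q 0; first by rewrite mulr_ge0// ltW.
rewrite -(@ler_pM2r _ q) ?lt_neqAle ?(eq_sym 0) ?qn0//.
by rewrite -expr2 (le_trans h)//; lra.
Qed.

End grid_prekopa_leindler.

Section fernique.
Context {R : realType} {d : nat} {T : R}.
Hypothesis hT : 0 < T.
Context {dO} {Omega : measurableType dO} (P : probability Omega R).
Variable X : {mfun Omega >-> c0path d T}.
Hypothesis hX : gaussian_process P X.

Definition excess (M x : R) : R := Num.max (x - M) 0.

(** The cut-off at [K] keeps the function bounded; the estimates are uniform in [K], so that it can
    be removed in the limit. *)
Definition truncated_exp (al M K x : R) : R := expR (al * Num.min (excess M x ^+ 2) K).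

Lemma continuous_truncated_exp al M K : continuous (truncated_exp al M K).
Proof.
move=> x; apply: (@continuous_comp _ _ _ (fun x => al * Num.min (excess M x ^+ 2) K) expR).
  apply: cvgM; first exact: cvg_cst.
  apply: (@continuous_min R R (fun x => excess M x ^+ 2) (cst K)); last exact: cvg_cst.
  apply: (@continuous_comp _ _ _ (excess M) (fun y => y ^+ 2)); last exact: exprn_continuous.
  apply: (@continuous_max R R (fun x => x - M) (cst 0)); last exact: cvg_cst.
  by apply: cvgB; [exact: cvg_id|exact: cvg_cst].
exact: continuous_expR.
Qed.

Lemma measurable_truncated_exp al M K : measurable_fun setT (truncated_exp al M K).
Proof. by apply: continuous_measurable_fun; exact: continuous_truncated_exp. Qed.

Lemma truncated_exp_ge0 al M K x : 0 <= truncated_exp al M K x.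
Proof. exact: expR_ge0. Qed.

Lemma truncated_exp_le al M K x : 0 <= al -> truncated_exp al M K x <= expR (al * K).
Proof. by move=> al0; rewrite ler_expR ler_wpM2l// ge_min lexx orbT. Qed.

Local Notation gvec n := (grid_vec X (@grid _ _ hT n)).

Lemma block_norm_grid_vec n w : block_norm (gvec n w) = grid_sup hT n (X w).
Proof. by apply: eq_bigr => i _; rewrite block_grid_vec. Qed.

(** [f] is the truncated exponential of the squared excess over [M] and [g] the indicator of the
    ball of radius [M]. If [z'] lies in the ball, the excess of [z] is at most its distance to [z'],
    so the pair is admissible; the ball has mass at least 1/2, whence [8 = 2^3]. *)
Lemma fernique_truncated : exists2 al : R, 0 < al & exists2 M : R, 0 <= M &
  forall K, 0 <= K -> \int[P]_w truncated_exp al M K `|X w| <= 8.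
Proof.
have [s2 s20 hvar] := path_var_bound hX.
have [M M0 hM] := normX_half P X.
pose al := 3 / (8 * s2).
have al0 : 0 < al by rewrite divr_gt0// mulr_gt0.
exists al => //; exists M => // K K0.
pose F n w := truncated_exp al M K (block_norm (gvec n w)).
have mgv n : measurable_fun setT (fun w => gvec n w) by exact: measurable_grid_vec.
have mbn n : measurable_fun setT (fun w => block_norm (gvec n w)).
  by apply: measurableT_comp; [exact: measurable_block_norm|exact: mgv].
have gcvg w : block_norm (gvec n w) @[n --> \oo] --> (`|X w| : R).
  under eq_fun do rewrite block_norm_grid_vec.
  exact: cvg_grid_sup.
have [_ h] : bmf (fun w => truncated_exp al M K `|X w|) /\
    \int[P]_w F n w @[n --> \oo] --> \int[P]_w truncated_exp al M K `|X w|.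
  apply: (@bounded_convergence _ _ _ P F _ (expR (al * K))).
  - move=> n; apply: (measurableT_comp (@measurable_truncated_exp al M K)); exact: mbn.
  - by move=> n w; rewrite ger0_norm ?truncated_exp_ge0// truncated_exp_le// ltW.
  - move=> w; apply: (cvg_comp _ (truncated_exp al M K) (gcvg w)).
    exact: continuous_truncated_exp.
rewrite -(cvg_lim (@Rhausdorff R) h).
apply: limr_le; first by apply/cvg_ex; eexists; exact: h.
apply: nearW => n; rewrite /F.
pose f (z : #|{: 'I_n.+2 * 'I_d}|.-tuple R) := truncated_exp al M K (block_norm z).
pose g (z : #|{: 'I_n.+2 * 'I_d}|.-tuple R) : R := \1_[set z | block_norm z <= M] z.
have bf : bmf f.
  split; first exact: (measurableT_comp (@measurable_truncated_exp al M K) measurable_block_norm).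
  exists (expR (al * K)) => z.
  by rewrite ger0_norm ?truncated_exp_ge0// truncated_exp_le// ltW.
have mA : measurable [set z : #|{: 'I_n.+2 * 'I_d}|.-tuple R | block_norm z <= M].
  rewrite (_ : [set z | _] = setT `&` (@block_norm R d n.+2) @^-1` `]-oo, M]).
    by apply: measurable_block_norm => //; exact: measurable_itv.
  by rewrite setTI; apply/seteqP; split=> w /=; rewrite in_itv.
have bg : bmf g by exact: bmf_indic.
have g0 z : 0 <= g z by rewrite /g indicE ler0n.
have fg z z' r : 0 <= r ->
    (forall i, dotv (block z i - block z' i) (block z i - block z' i) <= r) ->
    f z * g z' ^+ 3 <= expR (3 / (8 * s2) * r).
  move=> r0 hr; rewrite /g indicE; have [|_] := boolP (_ \in _); last first.
    by rewrite expr0n mulr0 expR_ge0.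
  rewrite inE/= => hz'; rewrite expr1n mulr1 /f ler_expR ler_wpM2l ?(ltW al0)//.
  rewrite ge_min; apply/orP; left.
  rewrite -[leRHS](sqr_sqrtr r0) ler_pXn2r ?nnegrE ?sqrtr_ge0//; last first.
    by rewrite le_max lexx orbT.
  rewrite ge_max sqrtr_ge0 andbT lerBlDr.
  apply: block_norm_le => [|i]; first by rewrite addr_ge0 ?sqrtr_ge0.
  rewrite -[block z i](subrK (block z' i)).
  apply: (le_trans (ler_enormD _ _)); rewrite lerD//.
    by rewrite /enorm ler_sqrt.
  exact: le_trans (block_norm_ub _ _) hz'.
have PL := grid_prekopa_leindler hX s20 hvar (@grid _ _ hT n) bf bg
  (fun z => truncated_exp_ge0 _ _ _ _) g0 fg.
have hg : 1 / 2 <= \int[P]_w g (gvec n w).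
  have -> : \int[P]_w g (gvec n w) = fine (P [set w | block_norm (gvec n w) <= M]).
    rewrite -[RHS](_ : \int[P]_w \1_[set w | block_norm (gvec n w) <= M] w = _); last first.
      rewrite /Rintegral integral_indic ?setIT//.
      rewrite -[X in measurable X]setTI; exact: (mgv n measurableT _ mA).
    apply: eq_Rintegral => w _; rewrite /g !indicE; congr (_%:R); congr nat_of_bool.
  rewrite -lee_fin fineK; last first.
    apply: fin_num_measure; rewrite -[X in measurable X]setTI.
    exact: (mgv n measurableT _ mA).
  apply: (le_trans hM); apply: le_measure; rewrite ?inE.
  - exact: measurable_normX_le.
  - rewrite -[X in measurable X]setTI; exact: (mgv n measurableT _ mA).
  move=> w /= hw; apply: le_trans hw.
  by rewrite block_norm_grid_vec; exact: grid_sup_le.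
set I := \int[P]_w _; have I0 : 0 <= I.
  by apply: Rintegral_ge0 => w _; exact: truncated_exp_ge0.
move: PL; rewrite -/I; set J := \int[P]_w _ in hg * => PL.
have : (1 / 2) ^+ 3 <= J ^+ 3 by rewrite lerXn2r ?nnegrE// (le_trans _ hg).
move=> h3; have := ler_wpM2l I0 h3; nra.
Qed.

End fernique.

(** * Relative entropy and the tilted measure *)

Lemma measurable_lne {R : realType} : measurable_fun setT (@lne R).
Proof.
rewrite (_ : @lne R = fun x => if (x <= 0)%E then -oo%E else
    if (x == +oo)%E then +oo%E else (ln (fine x))%:E); last first.
  by apply/funext => -[r| |]//=; rewrite ?leye_eq ?leNye ?lee_fin.
apply: measurable_fun_ifT.
- by apply: measurable_fun_lee; [exact: measurable_id|exact: measurable_cst].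
- exact: measurable_cst.
apply: measurable_fun_ifT.
- by apply: measurable_fun_eqe; [exact: measurable_id|exact: measurable_cst].
- exact: measurable_cst.
apply/measurable_EFinP; apply: (measurableT_comp (@measurable_ln R)).
exact: fine_measurable.
Qed.

Section entropy.
Context {R : realType}.

(** The negative part of [t ln t] is bounded, so the entropy integral can only diverge upwards. *)
Lemma ln_lower (t : R) : 0 <= t -> Num.max (- ln t) 0 * t <= 1.
Proof.
rewrite le_eqVlt => /predU1P[<-|t0]; first by rewrite mulr0.
have h : ln t^-1 < t^-1 by apply: ln_sublinear; rewrite invr_gt0.
rewrite lnV ?posrE// in h.
have : (- ln t) * t <= 1.
  by rewrite -ler_pdivlMr// mul1r ltW.
by rewrite /Num.max; case: ifP; rewrite ?mul0r.
Qed.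

(** Passes from the extended-real definition to a finite density with [g ln g] integrable: its
    negative part is bounded, and its positive part has a finite integral because the entropy is
    finite. *)
Lemma entropy_density_law {d} {E : measurableType d} (nu mu : probability E R) :
  (relative_entropy nu mu < +oo)%E ->
  exists g : E -> R, [/\ measurable_fun setT g, forall x, 0 <= g x,
    forall A, measurable A -> nu A = (\int[mu]_(x in A) (g x)%:E)%E,
    mu.-integrable setT (fun x => (g x * ln (g x))%:E) &
    relative_entropy nu mu = (\int[mu]_x (g x * ln (g x)))%:E].
Proof.
rewrite /relative_entropy; case: asboolP => // numu.
set RN := Radon_Nikodym _ _.
pose f := Radon_Nikodym_SigmaFinite.f nu mu.
have f0 : forall x, (0 <= f x)%E by exact: Radon_Nikodym_SigmaFinite.f_ge0.
have ffin : forall x, f x \is a fin_num by exact: Radon_Nikodym_SigmaFinite.f_fin_num.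
have intf : mu.-integrable setT f by exact: Radon_Nikodym_SigmaFinite.f_integrable.
have nuf A : measurable A -> nu A = (\int[mu]_(x in A) f x)%E.
  by move=> mA; exact: Radon_Nikodym_SigmaFinite.f_integral.
have mf : measurable_fun setT f by exact: measurable_int intf.
pose g x := fine (f x).
have gE x : (g x)%:E = f x by rewrite fineK.
have mg : measurable_fun setT g by apply: (measurableT_comp _ mf); exact: fine_measurable.
have g0 x : 0 <= g x by rewrite -lee_fin gE.
have mlng : measurable_fun setT (fun x => ln (g x)).
  exact: (measurableT_comp (@measurable_ln R) mg).
have cov (F : E -> \bar R) : (forall x, 0 <= F x)%E -> measurable_fun setT F ->
    (\int[nu]_x F x = \int[mu]_x (F x * (g x)%:E))%E.
  move=> F0 mF; rewrite -(Radon_Nikodym_SigmaFinite.change_of_variables numu F0 measurableT mF).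
  by apply: eq_integral => x _; rewrite gE.
have mRN : measurable_fun setT RN.
  by apply: (@measurable_int _ _ _ mu); exact: Radon_Nikodym_integrable.
have REln : (\int[nu]_x lne (RN x) = \int[nu]_x (ln (g x))%:E)%E.
  apply: ae_eq_integral => //.
  - exact: (measurableT_comp measurable_lne mRN).
  - exact/measurable_EFinP.
  have h1 : ae_eq nu setT f RN.
    apply: (null_dominates_ae_eq measurableT numu).
    exact: ae_eq_Radon_Nikodym_SigmaFinite.
  have mz : measurable [set x | g x = 0].
    rewrite (_ : [set x | _] = setT `&` g @^-1` [set 0]); last by rewrite setTI.
    by apply: mg => //; exact: measurable_set1.
  (* [lne 0 = -oo] whereas [ln 0 = 0]; the two integrands are compared off the set [g = 0], which is
     [nu]-null. *)
  have h2 : \forall x \ae nu, g x <> 0.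
    exists [set x | g x = 0]; split=> //.
      rewrite nuf//; transitivity (\int[mu]_(x in [set x | g x = 0%R]) 0)%E.
        by apply: eq_integral => x /set_mem/= gx; rewrite -gE gx.
      by rewrite integral0.
    by move=> x /= /contrapT.
  apply: filterS2 h1 h2 => x /(_ I) <- gx _.
  by rewrite -gE lne_EFin// lt_neqAle g0 andbT eq_sym; apply/eqP.
rewrite REln => H.
pose up x := Num.max (ln (g x)) 0; pose un x := Num.max (- ln (g x)) 0.
have mup : measurable_fun setT up by apply: measurable_maxr => //; exact: measurable_cst.
have mun : measurable_fun setT un.
  apply: measurable_maxr; last exact: measurable_cst.
  by apply: measurable_funN.
have up0 x : 0 <= up x by rewrite le_max lexx orbT.
have un0 x : 0 <= un x by rewrite le_max lexx orbT.
have uE x : ln (g x) = up x - un x.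
  rewrite /up /un; have [h|h] := leP 0 (ln (g x)).
    by rewrite max_r ?subr0// oppr_le0.
  by rewrite max_l ?sub0r ?opprK// oppr_ge0 ltW.
have unint : mu.-integrable setT (fun x => (un x * g x)%:E).
  apply: bmf_integrable; split; first exact: measurable_funM.
  by exists 1 => x; rewrite ger0_norm ?mulr_ge0//; exact: ln_lower.
have RE : (\int[nu]_x (ln (g x))%:E =
    \int[mu]_x (up x * g x)%:E - \int[mu]_x (un x * g x)%:E)%E.
  rewrite integralE; congr (_ - _)%E.
    transitivity (\int[nu]_x (up x)%:E)%E.
      by apply: eq_integral => x _; rewrite funeposE EFin_max.
    by rewrite cov//; exact/measurable_EFinP.
  transitivity (\int[nu]_x (un x)%:E)%E.
    by apply: eq_integral => x _; rewrite funenegE EFin_max.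
  by rewrite cov//; exact/measurable_EFinP.
have unfin : (\int[mu]_x (un x * g x)%:E)%E \is a fin_num by exact: integrable_fin_num.
have upint : mu.-integrable setT (fun x => (up x * g x)%:E).
  apply/integrableP; split.
    by apply/measurable_EFinP; exact: measurable_funM.
  rewrite (_ : (fun x => _) = (fun x => (up x * g x)%:E)); last first.
    by apply/funext => x; rewrite gee0_abs// lee_fin mulr_ge0.
  move: H; rewrite RE -(fineK unfin).
  by case: (\int[mu]_x (up x * g x)%:E)%E => // r _; exact: ltry.
have upfin : (\int[mu]_x (up x * g x)%:E)%E \is a fin_num by exact: integrable_fin_num.
have e : (fun x => (g x * ln (g x))%:E) =
    ((fun x => (up x * g x)%:E) \- (fun x => (un x * g x)%:E))%E.
  by apply/funext => x /=; rewrite uE mulrC mulrBl.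
exists g; split => //.
- by move=> A mA; rewrite nuf//; apply: eq_integral => x _; rewrite gE.
- by rewrite e; exact: integrableB.
rewrite RE /Rintegral fineK.
  by rewrite e integralB.
by rewrite e integralB// fin_numB upfin.
Qed.

End entropy.

Section tilt.
Context {R : realType}.

(** Legendre duality: [a ln a - a] is the conjugate of the exponential, with equality at [v = ln a]
    for [a > 0]. *)
Lemma young_entropy (a v : R) : 0 <= a -> a * v <= a * ln a - a + expR v.
Proof.
rewrite le_eqVlt => /predU1P[<-|a0].
  by rewrite !mul0r subr0 add0r expR_ge0.
have := expR_ge1Dx (v - ln a); rewrite expRB lnK ?posrE// ler_pdivlMr// => h.
by rewrite mulrDl mul1r mulrBl in h; lra.
Qed.

Lemma probability_density {d} {T : measurableType d} (P : probability T R) (h : T -> \bar R) :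
  measurable_fun setT h -> (forall x, 0 <= h x)%E -> (\int[P]_x h x = 1)%E ->
  exists Q : probability T R, forall A, Q A = (\int[P]_(x in A) h x)%E.
Proof.
move=> mh h0 h1; pose m' A := (\int[P]_(x in A) h x)%E.
have m'0 : m' set0 = 0%E by exact: integral_set0.
have m'ge0 A : (0 <= m' A)%E by apply: integral_ge0.
have m's := @semi_sigma_additive_nng_induced _ _ _ P _ mh h0.
pose M := isMeasure.Build _ _ _ m' m'0 m'ge0 m's.
pose mm : {measure set T -> \bar R} := HB.pack m' M.
(* The mass is already 1: normalisation leaves the measure unchanged and supplies the probability
   structure. *)
exists (mnormalize mm P) => A.
by rewrite /= /mnormalize [mm setT]h1 onee_eq0/= invr1 mule1.
Qed.

Lemma Rintegral_expR_gt0 {d} {T : measurableType d} (P : probability T R) (f : T -> R) :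
  bmf f -> bmf (fun x => expR (f x)) /\ 0 < \int[P]_x expR (f x).
Proof.
move=> [mf [M hM]].
have be : bmf (fun x => expR (f x)).
  split; first by apply: measurableT_comp mf; exact: measurable_expR.
  exists (expR M) => x; rewrite ger0_norm ?expR_ge0// ler_expR.
  by rewrite (le_trans (ler_norm _)).
split=> //; apply: (@lt_le_trans _ _ (expR (- M))); first exact: expR_gt0.
rewrite -[leLHS](Rintegral_prob_cst P); apply: le_Rintegral => //.
- exact: finite_measure_integrable_cst.
- exact: bmf_integrable.
move=> x _; rewrite ler_expR; have := hM x; rewrite ler_norml => /andP[] //.
Qed.

(** Jensen's inequality, from the tangent of [expR] at the mean [c]. *)
Lemma Rintegral_le_ln {d} {T : measurableType d} (P : probability T R) (f : T -> R) :
  bmf f -> \int[P]_x f x <= ln (\int[P]_x expR (f x)).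
Proof.
move=> bf; have [be e0] := Rintegral_expR_gt0 P bf.
set c := \int[P]_x f x.
rewrite -ler_expR lnK ?posrE//.
have h : \int[P]_x (expR c * (1 - c + f x)) <= \int[P]_x expR (f x).
  apply: le_Rintegral => //.
  - apply: bmf_integrable; apply: bmfZ; apply: bmfD => //; exact: bmf_cst.
  - exact: bmf_integrable.
  move=> x _; rewrite -[f x in leRHS](subrK c) [f x - c + c]addrC expRD ler_wpM2l ?expR_ge0//.
  by have := expR_ge1Dx (f x - c); lra.
apply: le_trans h; rewrite RintegralZl//; last first.
  apply: bmf_integrable; apply: bmfD => //; exact: bmf_cst.
rewrite RintegralD//; [|exact: finite_measure_integrable_cst|exact: bmf_integrable].
by rewrite Rintegral_prob_cst -/c subrK mulr1.
Qed.

(** [Q] has density [g (Y w)] with respect to [P], where [g] is the density of [nu]: the entropy is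
    unchanged, and every variable on [Omega] can be studied under both measures. The variational
    inequality is Young duality, integrated. *)
Lemma entropy_tilt {d1 d2} {Omega : measurableType d1} {E : measurableType d2}
    (P : probability Omega R) (Y : {mfun Omega >-> E}) (nu : probability E R) :
  (relative_entropy nu (distribution P Y) < +oo)%E ->
  exists (Q : probability Omega R) (H : R),
    [/\ forall A, measurable A -> nu A = Q (Y @^-1` A),
        relative_entropy nu (distribution P Y) = H%:E &
        forall f, bmf f -> \int[Q]_w f w <= H + ln (\int[P]_w expR (f w))].
Proof.
move=> /entropy_density_law[g [mg g0 nuE intl RE]].
pose G w := g (Y w).
have mY : measurable_fun setT Y by exact: measurable_funPT.
have mG : measurable_fun setT G by exact: (measurableT_comp mg mY).
have G0 w : 0 <= G w by exact: g0.
have mGE : measurable_fun setT (fun w => (G w)%:E) by apply/measurable_EFinP.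
have nuG A : measurable A -> (\int[P]_(w in Y @^-1` A) (G w)%:E = nu A)%E.
  move=> mA; rewrite nuE// [in RHS]/distribution/=.
  rewrite ge0_integral_pushforward//; last by move=> ? _; rewrite lee_fin.
  by apply/measurable_EFinP; exact: measurable_funTS.
have G1 : (\int[P]_w (G w)%:E = 1)%E.
  by rewrite -[X in integral _ X _]/(Y @^-1` setT) nuG// probability_setT.
have [Q QE] := @probability_density _ _ P (fun w => (G w)%:E) mGE (fun w => G0 w) G1.
pose l w := G w * ln (G w).
have il : P.-integrable setT (EFin \o l).
  apply/integrableP; split.
    apply/measurable_EFinP; apply: measurable_funM => //.
    exact: (measurableT_comp (@measurable_ln R) mG).
  have /integrableP[ml] := intl.
  rewrite ge0_integral_pushforward//.
  by apply: measurableT_comp ml.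
have ilE : \int[P]_w l w = \int[distribution P Y]_x (g x * ln (g x)).
  rewrite /Rintegral integral_pushforward//.
  by have /integrableP[] := intl.
exists Q, (\int[P]_w l w); split.
- by move=> A mA; rewrite QE nuG.
- by rewrite RE ilE.
move=> f bf; have [be e0] := Rintegral_expR_gt0 P bf.
set c := ln _; have [mf [M hM]] := bf.
(* Subtracting [c] normalises the exponential integral to 1, which cancels the term [- a] of
   [young_entropy] after integration. The constant [K] then makes the function nonnegative for the
   density formula. *)
pose F w := f w - c.
have mF : measurable_fun setT F by apply: measurable_funB => //; exact: measurable_cst.
pose K := M + `|c|.
have FK w : 0 <= F w + K.
  rewrite /F /K; have := hM w; have := ler_norm c; rewrite ler_norml => h1 /andP[h2 h3]; lra.
have bF : bmf F by apply: bmfD => //; exact: bmf_cst.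
have beF : bmf (fun w => expR (F w)) by have [] := Rintegral_expR_gt0 P bF.
have eF : \int[P]_w expR (F w) = 1.
  transitivity (\int[P]_w ((expR c)^-1 * expR (f w))).
    by apply: eq_Rintegral => w _; rewrite /F expRD expRN mulrC.
  rewrite RintegralZl//; last exact: bmf_integrable.
  by rewrite /c lnK ?posrE// mulVf// gt_eqF.
have iG : P.-integrable setT (EFin \o G).
  by apply: ge0_integrable_R => //; rewrite G1 ltry.
have RG1 : \int[P]_w G w = 1 by rewrite /Rintegral G1.
have FKQ : (\int[Q]_w (F w + K)%:E = \int[P]_w ((F w + K) * G w)%:E)%E.
  rewrite (@ge0_integral_density _ _ _ P Q (fun w => (G w)%:E) _ mGE (fun A _ => QE A))//.
  by apply/measurable_EFinP; apply: measurable_funD => //; exact: measurable_cst.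
have iFG : P.-integrable setT (EFin \o (fun w => (F w + K) * G w)).
  apply: ge0_integrable_R.
  - by apply: measurable_funM => //; apply: measurable_funD => //; exact: measurable_cst.
  - by move=> w; rewrite mulr_ge0.
  rewrite -FKQ -EFin_Rintegral ?ltry//; apply: bmf_integrable.
  by apply: bmfD => //; exact: bmf_cst.
have QF : \int[Q]_w (F w + K) = \int[P]_w ((F w + K) * G w) by rewrite /Rintegral FKQ.
have le1 : \int[P]_w ((F w + K) * G w) <=
    \int[P]_w (l w + ((K - 1) * G w + expR (F w))).
  apply: le_Rintegral => //.
    apply: integrable_RD => //; apply: integrable_RD; last exact: bmf_integrable.
    exact: integrable_RZ.
  by move=> w _; have := young_entropy (F w) (G0 w); rewrite /l; lra.
have i2 := integrable_RZ (K - 1) iG.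
have i3 := bmf_integrable P beF.
rewrite (RintegralD measurableT il (integrable_RD i2 i3)) in le1.
rewrite (RintegralD measurableT i2 i3) (RintegralZl (K - 1) measurableT iG) in le1.
rewrite RG1 eF -QF in le1.
have iF := bmf_integrable Q bf.
have : \int[Q]_w (F w + K) = \int[Q]_w f w + (K - c).
  rewrite -[X in _ + X](Rintegral_prob_cst Q) -(RintegralD measurableT iF).
    by apply: eq_Rintegral => w _; rewrite /F; ring.
  exact: finite_measure_integrable_cst.
by move=> e; rewrite e in le1; lra.
Qed.

End tilt.

(** * Couplings whose density is constant on the cells of a partition *)

Section finite_partition.
Context {R : realType} {d} {T : measurableType d} {I : finType}.
Variable rho : T -> I.
Hypothesis mrho : forall i, measurable (rho @^-1` [set i]).

Lemma partition_sumE (phi : I -> R) x :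
  phi (rho x) = \sum_i phi i * \1_(rho @^-1` [set i]) x.
Proof.
rewrite (bigD1 (rho x))//= big1 ?addr0 => [|i ix].
  by rewrite indicE mem_set// mulr1.
by rewrite indicE memNset ?mulr0//= => /esym/eqP; apply/negP.
Qed.

Lemma bmf_partition (phi : I -> R) : bmf (fun x => phi (rho x)).
Proof.
split.
  under eq_fun do rewrite partition_sumE.
  apply: measurable_sum => i; apply: measurable_funM; first exact: measurable_cst.
  exact: measurable_indic.
exists (\sum_i `|phi i|) => x.
by rewrite (bigD1 (rho x))//= lerDl sumr_ge0.
Qed.

Lemma Rintegral_partition (m : probability T R) (phi : I -> R) :
  \int[m]_x phi (rho x) = \sum_i phi i * fine (m (rho @^-1` [set i])).
Proof.
under eq_Rintegral do rewrite partition_sumE.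
have ib i : m.-integrable setT (EFin \o (\1_(rho @^-1` [set i]) : T -> R)).
  by apply: bmf_integrable; exact: bmf_indic.
rewrite Rintegral_sum => [|i]; last exact: integrable_RZ.
apply: eq_bigr => i _; rewrite (RintegralZl (phi i) measurableT (ib i)).
by congr (_ * _); rewrite /Rintegral integral_indic// setIT.
Qed.

Lemma sum_partition (m : probability T R) : \sum_i fine (m (rho @^-1` [set i])) = 1.
Proof.
rewrite -(Rintegral_prob_cst m 1) (Rintegral_partition m (fun=> 1)).
by apply: eq_bigr => i _; rewrite mul1r.
Qed.

Lemma measurable_partition_prod ij :
  measurable ((fun z : T * T => (rho z.1, rho z.2)) @^-1` [set ij]).
Proof.
rewrite (_ : _ @^-1` _ = (rho @^-1` [set ij.1]) `*` (rho @^-1` [set ij.2])).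
  exact: measurableX.
by case: ij => i j; apply/seteqP; split=> -[x y] /= -[<- <-].
Qed.

End finite_partition.

Section glued_coupling.
Context {R : realType} {d} {T : measurableType d} {I : finType}.
Variables (Q P : probability T R) (rho : T -> I).
Hypothesis mrho : forall i, measurable (rho @^-1` [set i]).
Let p i := fine (Q (rho @^-1` [set i])).
Let q i := fine (P (rho @^-1` [set i])).
Variable k : I -> I -> R.
Hypotheses (k0 : forall i j, 0 <= k i j) (kp : forall i, \sum_j k i j = p i)
  (kq : forall j, \sum_i k i j = q j).

(** The density of the coupling with respect to [Q \x P] on the cell [(i, j)]. The value 1 on null
    rows and columns keeps [\sum_j theta i j * q j = 1] for every [i], and likewise for columns,
    without exceptional cells. *)
Let theta i j : R := if (p i == 0) || (q j == 0) then 1 else k i j / (p i * q j).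

Let p0 i : 0 <= p i. Proof. exact: fine_ge0. Qed.
Let q0 i : 0 <= q i. Proof. exact: fine_ge0. Qed.

Let theta0 i j : 0 <= theta i j.
Proof. by rewrite /theta; case: ifP => // _; rewrite divr_ge0// mulr_ge0. Qed.

Let kp0 i j : p i = 0 -> k i j = 0.
Proof.
move=> pi0; have /eqP := kp i; rewrite pi0 psumr_eq0// => /allP h.
by apply/eqP/h; exact: mem_index_enum.
Qed.

Let kq0 i j : q j = 0 -> k i j = 0.
Proof.
move=> qj0; have /eqP := kq j; rewrite qj0 psumr_eq0// => /allP h.
by apply/eqP/(h i); exact: mem_index_enum.
Qed.

Let theta_row i : \sum_j theta i j * q j = 1.
Proof.
rewrite /theta; have [pi0|pi0] := eqVneq (p i) 0.
  by under eq_bigr do rewrite mul1r; exact: (sum_partition mrho P).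
transitivity ((p i)^-1 * \sum_j k i j); last by rewrite kp mulVf.
rewrite mulr_sumr; apply: eq_bigr => j _ /=; have [qj0|qj0] := eqVneq (q j) 0.
  by rewrite qj0 mulr0 kq0// mulr0.
by field; rewrite pi0 qj0.
Qed.

Let theta_col j : \sum_i theta i j * p i = 1.
Proof.
rewrite /theta; have [qj0|qj0] := eqVneq (q j) 0.
  under eq_bigr do rewrite orbT mul1r; exact: (sum_partition mrho Q).
transitivity ((q j)^-1 * \sum_i k i j); last by rewrite kq mulVf.
rewrite mulr_sumr; apply: eq_bigr => i _; rewrite orbF; have [pi0|pi0] := eqVneq (p i) 0.
  by rewrite pi0 mulr0 kp0// mulr0.
by field; rewrite pi0 qj0.
Qed.

Let rho2 (z : T * T) : I * I := (rho z.1, rho z.2).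

Let mrho2 ij : measurable (rho2 @^-1` [set ij]).
Proof. exact: measurable_partition_prod. Qed.

Let D (z : T * T) : R := theta (rho z.1) (rho z.2).

Let bD : bmf D.
Proof. exact: (bmf_partition mrho2 (fun ij => theta ij.1 ij.2)). Qed.

Let bmf_fst (f : T -> R) : bmf f -> bmf (fun z : T * T => f z.1).
Proof.
move=> [mf [M hM]]; split; last by exists M => z; exact: hM.
exact: (measurableT_comp mf measurable_fst).
Qed.

Let bmf_snd (f : T -> R) : bmf f -> bmf (fun z : T * T => f z.2).
Proof.
move=> [mf [M hM]]; split; last by exists M => z; exact: hM.
exact: (measurableT_comp mf measurable_snd).
Qed.

Let intD_fst (f : T -> R) : bmf f -> \int[(Q \x P)%E]_z (f z.1 * D z) = \int[Q]_x f x.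
Proof.
move=> bf; rewrite -(@Rintegral_prod _ _ _ _ _ Q P (fun z => f z.1 * D z)); last first.
  by apply: bmfM => //; exact: bmf_fst.
apply: eq_Rintegral => x _; rewrite /D/=.
have bt := bmf_partition mrho (theta (rho x)).
rewrite (RintegralZl (f x) measurableT (bmf_integrable P bt)).
by rewrite (Rintegral_partition mrho P (theta (rho x))) theta_row mulr1.
Qed.

Let intD_snd (f : T -> R) : bmf f -> \int[(Q \x P)%E]_z (f z.2 * D z) = \int[P]_x f x.
Proof.
move=> bf; rewrite -(@Rintegral_prod _ _ _ _ _ Q P (fun z => f z.2 * D z)); last first.
  by apply: bmfM => //; exact: bmf_snd.
pose fk i y := f y * theta i (rho y).
have bfk i : bmf (fk i).
  by apply: bmfM => //; exact: (bmf_partition mrho (theta i)).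
transitivity (\int[Q]_x \int[P]_y fk (rho x) y); first exact: eq_Rintegral.
rewrite (Rintegral_partition mrho Q (fun i => \int[P]_y fk i y)).
transitivity (\sum_i \int[P]_y (p i * fk i y)).
  by apply: eq_bigr => i _; rewrite mulrC (RintegralZl (p i) measurableT (bmf_integrable P (bfk i))).
rewrite -Rintegral_sum => [|i]; last exact: (bmf_integrable P (bmfZ (p i) (bfk i))).
apply: eq_Rintegral => y _.
transitivity (f y * \sum_i theta i (rho y) * p i); last by rewrite theta_col mulr1.
by rewrite mulr_sumr; apply: eq_bigr => i _; rewrite /fk; ring.
Qed.

(* Inside each cell the two coordinates are independent. *)
Lemma glued_coupling : exists pi : probability (T * T)%type R,
  [/\ forall A, measurable A -> pi (A `*` setT) = Q A,
      forall B, measurable B -> pi (setT `*` B) = P B &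
      forall c : I -> I -> R, (forall i j, 0 <= c i j) ->
        (\int[pi]_z (c (rho z.1) (rho z.2))%:E <= (\sum_i \sum_j k i j * c i j)%:E)%E].
Proof.
have mD : measurable_fun setT (fun z => (D z)%:E) by apply/measurable_EFinP; exact: bmf_meas.
have D0 z : (0 <= (D z)%:E)%E by rewrite lee_fin; exact: theta0.
have iD (f : T * T -> R) : bmf f ->
    (\int[(Q \x P)%E]_z (f z * D z)%:E = (\int[(Q \x P)%E]_z (f z * D z))%:E)%E.
  move=> bf; rewrite EFin_Rintegral//.
  exact: (@bmf_integrable _ _ _ (Q \x P : probability _ _)%E _ (bmfM bf bD)).
have D1 : (\int[(Q \x P)%E]_z (D z)%:E = 1)%E.
  have := iD (cst 1) (bmf_cst 1).
  under eq_integral do rewrite /= mul1r.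
  by move=> ->; rewrite (intD_fst (bmf_cst 1)) Rintegral_prob_cst.
have [pi piE] := @probability_density _ _ _ ((Q \x P : probability _ _)%E) _ mD D0 D1.
have piI (A : set (T * T)) : measurable A ->
    pi A = (\int[(Q \x P)%E]_z (\1_A z * D z)%:E)%E.
  move=> mA; rewrite piE integral_mkcond; apply: eq_integral => z _.
  by rewrite patchE indicE; case: ifPn => _; rewrite ?mul1r ?mul0r.
exists pi; split.
- move=> A mA; rewrite piI; last exact: measurableX.
  transitivity ((\int[(Q \x P)%E]_z (\1_A z.1 * D z))%:E); last first.
    rewrite (intD_fst (bmf_indic mA)) EFin_Rintegral; last exact: bmf_integrable (bmf_indic mA).
    by rewrite integral_indic// setIT.
  rewrite -(iD _ (bmf_fst (bmf_indic mA))); apply: eq_integral => z _.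
  by rewrite !indicE in_setX in_setT andbT.
- move=> A mA; rewrite piI; last exact: measurableX.
  transitivity ((\int[(Q \x P)%E]_z (\1_A z.2 * D z))%:E); last first.
    rewrite (intD_snd (bmf_indic mA)) EFin_Rintegral; last exact: bmf_integrable (bmf_indic mA).
    by rewrite integral_indic// setIT.
  rewrite -(iD _ (bmf_snd (bmf_indic mA))); apply: eq_integral => z _.
  by rewrite !indicE in_setX in_setT.
move=> c c0.
have bc : bmf (fun z => c (rho z.1) (rho z.2)).
  exact: (bmf_partition mrho2 (fun ij => c ij.1 ij.2)).
rewrite (@ge0_integral_density _ _ _ (Q \x P : probability _ _)%E pi _ _ mD (fun A _ => piE A)); last 2 first.
- by apply/measurable_EFinP; exact: bmf_meas.
- by move=> z; rewrite lee_fin.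
rewrite -[leLHS]/(\int[(Q \x P)%E]_z (c (rho z.1) (rho z.2) * D z)%:E)%E iD// lee_fin.
rewrite (Rintegral_partition mrho2 (Q \x P : probability _ _)%E (fun ij => c ij.1 ij.2 * theta ij.1 ij.2)).
rewrite pair_bigA/=; apply: ler_sum => -[i j] _ /=.
have -> : fine ((Q \x P)%E (rho2 @^-1` [set (i, j)])) = p i * q j.
  rewrite (_ : _ @^-1` _ = (rho @^-1` [set i]) `*` (rho @^-1` [set j])); last first.
    by apply/seteqP; split=> -[x y] /= -[<- <-].
  rewrite product_measure1E// fineM//; exact: fin_num_measure.
rewrite /theta; have [pi0|pi0] := eqVneq (p i) 0.
  by rewrite pi0 mul0r mulr0 mulr_ge0.
have [qj0|qj0] /= := eqVneq (q j) 0.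
  by rewrite qj0 !mulr0 mulr_ge0.
by rewrite le_eqVlt; apply/orP; left; apply/eqP; field; rewrite pi0 qj0.
Qed.

End glued_coupling.

(** * Rounding vectors to finitely many codes *)

Section bucket.
Context {R : realType} (n : nat).
Local Notation N := (n.+1%:R : R).

Definition clip (x : R) : R := Num.max (- N) (Num.min N x).

Definition bucket_level (x : R) : R := (clip x + N) * N.

(** The clipped line [[- N, N]] is cut into [2 N^2] cells of length [1 / N], numbered from 0. The
    further index [2 N^2] is reached only when [clip x = N]. *)
Definition bucket (x : R) : 'I_(2 * n.+1 ^ 2).+1 := inord (Num.truncn (bucket_level x)).

Definition bucket_val (i : 'I_(2 * n.+1 ^ 2).+1) : R := i%:R / N - N.

Let N0 : 0 < N. Proof. by rewrite ltr0n. Qed.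

Lemma clipP x : [\/ x <= - N /\ clip x = - N, - N <= x <= N /\ clip x = x |
  N <= x /\ clip x = N].
Proof.
rewrite /clip; have [h1|h1] := leP N x.
  by apply: Or33; rewrite max_r//; have := N0; lra.
have [h2|h2] := leP x (- N); first by apply: Or31.
by apply: Or32; rewrite !ltW.
Qed.

Lemma clip_itv x : - N <= clip x <= N.
Proof. by have := N0; case: (clipP x) => -[h ->] M0; apply/andP; split; lra. Qed.

Lemma clip_lip x y : `|clip x - clip y| <= `|x - y|.
Proof.
have := N0; case: (clipP x) => -[h ->]; case: (clipP y) => -[h' ->] M0;
  rewrite ler_norml; case: (ler0P (x - y)) => h5; apply/andP; split; lra.
Qed.

Lemma clip_close x : `|x - clip x| <= Num.max (`|x| - N) 0.
Proof.
have := N0; case: (clipP x) => -[h ->] M0; rewrite le_max.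
- by apply/orP; left; rewrite !ler0_norm; lra.
- by rewrite subrr normr0 lexx orbT.
- by apply/orP; left; rewrite !ger0_norm; lra.
Qed.

Lemma bucket_level_itv x : 0 <= bucket_level x <= (2 * n.+1 ^ 2)%:R.
Proof.
have /andP[h1 h2] := clip_itv x; rewrite /bucket_level natrM natrX; apply/andP; split.
  by rewrite mulr_ge0 ?(ltW N0)//; lra.
by rewrite expr2 mulrA ler_pM2r//; lra.
Qed.

Lemma bucketE x : (bucket x)%:R <= bucket_level x < (bucket x).+1%:R.
Proof.
have /andP[h0 h1] := bucket_level_itv x.
have /andP[h2 h3] := truncn_itv h0.
rewrite /bucket inordK ?h2 ?h3// ltnS.
by rewrite -(ler_nat R) (le_trans h2).
Qed.

Lemma bucket_eqP x i : bucket x = i <-> i%:R <= bucket_level x < i.+1%:R.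
Proof.
split=> [<-|/andP[h1 h2]]; first exact: bucketE.
have /andP[h3 h4] := bucketE x; apply: ord_inj; apply/eqP.
have := le_lt_trans h3 h2; have := le_lt_trans h1 h4.
by rewrite !ltr_nat !ltnS eqn_leq => -> ->.
Qed.

Lemma measurable_bucket i : measurable (bucket @^-1` [set i]).
Proof.
rewrite (_ : _ @^-1` _ = setT `&` bucket_level @^-1` `[i%:R, i.+1%:R[); last first.
  by rewrite setTI; apply/seteqP; split=> x; rewrite /= in_itv/= => /bucket_eqP.
have : measurable_fun setT bucket_level; last first.
  by move=> h; apply: h => //; exact: measurable_itv.
apply: measurable_funM; last exact: measurable_cst.
apply: measurable_funD; last exact: measurable_cst.
apply: measurable_maxr; first exact: measurable_cst.
by apply: measurable_minr; first exact: measurable_cst.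
Qed.

Lemma bucket_val_itv x : clip x - N^-1 <= bucket_val (bucket x) <= clip x.
Proof.
have /andP[h1 h2] := bucketE x; rewrite /bucket_val.
apply/andP; split; last by rewrite lerBlDr ler_pdivrMr.
rewrite lerBrDr ler_pdivlMr//.
have -> : (clip x - N^-1 + N) * N = bucket_level x - 1.
  by rewrite /bucket_level; field; rewrite lt0r_neq0.
by move: h2; rewrite -natr1; lra.
Qed.

Lemma bucket_val_lip x y :
  `|bucket_val (bucket x) - bucket_val (bucket y)| <= `|x - y| + N^-1.
Proof.
have /andP[h1 h2] := bucket_val_itv x; have /andP[h3 h4] := bucket_val_itv y.
move: (N^-1) (bucket_val _) (bucket_val _) h1 h2 h3 h4 => e bx b_y h1 h2 h3 h4.
have := clip_lip x y; rewrite !ler_norml => /andP[h5 h6]; apply/andP; split; lra.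
Qed.

Lemma bucket_val_close x : `|x - bucket_val (bucket x)| <= Num.max (`|x| - N) 0 + N^-1.
Proof.
have /andP[h1 h2] := bucket_val_itv x.
have : 0 <= N^-1 by rewrite invr_ge0 ltW.
have := clip_close x.
move: (N^-1) (bucket_val _) h1 h2 (Num.max _ _) => e bx h1 h2 M.
rewrite !ler_norml => /andP[h5 h6] h7; apply/andP; split; lra.
Qed.

End bucket.

Section quantization.
Context {R : realType} {d m : nat} (n : nat).
Local Notation L := #|{: 'I_m * 'I_d}|.
Local Notation N := (n.+1%:R : R).
Definition code := {ffun 'I_L -> 'I_(2 * n.+1 ^ 2).+1}.

Definition quantize (z : L.-tuple R) : code := [ffun j => bucket n (tnth z j)].

Definition decode (k : code) (i : 'I_m) : 'rV[R]_d :=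
  \row_l bucket_val (k (enum_rank (i, l))).

Definition code_dist (k k' : code) : R :=
  \big[Num.max/0]_i enorm (decode k i - decode k' i).

Lemma code_dist_ge0 k k' : 0 <= code_dist k k'.
Proof.
by rewrite /code_dist; elim/big_ind: _ => [|x y x0 y0|i _]; rewrite ?le_max ?x0 ?enorm_ge0.
Qed.

Lemma row_subE (u v : 'rV[R]_d) l : (u - v) 0 l = u 0 l - v 0 l.
Proof. by rewrite !mxE. Qed.

Lemma decode_quantize z i l :
  decode (quantize z) i 0 l = bucket_val (bucket n (block z i 0 l)).
Proof. by rewrite !mxE /quantize ffunE. Qed.

(** Clipping is a contraction, so on passing to codes only the rounding error [1 / N] per coordinate
    is lost, uniformly in [z] and [z']. The unbounded clipping error appears only in
    [enorm_decode_close]. *)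
Lemma enorm_decode_lip z z' i :
  enorm (decode (quantize z) i - decode (quantize z') i) <=
  enorm (block z i - block z' i) + d%:R / N.
Proof.
pose u : 'rV[R]_d := \row_l `|(block z i - block z' i) 0 l|.
apply: (@le_trans _ _ (enorm (u + const_mx N^-1))).
  apply: enorm_le_enorm => l; rewrite row_subE !decode_quantize.
  have -> : (u + const_mx N^-1) 0 l = `|block z i 0 l - block z' i 0 l| + N^-1.
    by rewrite [LHS]mxE [const_mx _ _ _]mxE; congr (_ + _); rewrite mxE row_subE.
  rewrite [leRHS]ger0_norm ?addr_ge0 ?invr_ge0//.
  exact: bucket_val_lip.
apply: (le_trans (ler_enormD _ _)); apply: lerD.
  by apply: enorm_le_enorm => l; rewrite mxE normr_id.
apply: (le_trans (enorm_le_sum _)).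
under eq_bigr do rewrite mxE ger0_norm ?invr_ge0//.
by rewrite sumr_const card_ord mulr_natl.
Qed.

Lemma enorm_decode_close z i B : enorm (block z i) <= B ->
  enorm (block z i - decode (quantize z) i) <= d%:R * (Num.max (B - N) 0 + N^-1).
Proof.
move=> hB; apply: (le_trans (enorm_le_sum _)).
apply: (@le_trans _ _ (\sum_(l < d) (Num.max (B - N) 0 + N^-1))); last first.
  by rewrite sumr_const card_ord mulr_natl.
apply: ler_sum => l _; rewrite row_subE decode_quantize.
apply: (le_trans (bucket_val_close _ _)); rewrite lerD2r ge_max !le_max lexx orbT andbT.
apply/orP; left; rewrite lerB//; apply: le_trans hB; exact: coord_le_enorm.
Qed.

Lemma measurable_quantize k : measurable (quantize @^-1` [set k]).
Proof.
rewrite (_ : _ @^-1` _ = \bigcap_(j in [set: 'I_L])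
    (fun z => tnth z j) @^-1` (@bucket R n @^-1` [set k j])); last first.
  apply/seteqP; split=> z /=; first by move=> <- j _ /=; rewrite ffunE.
  by move=> h; apply/ffunP => j; rewrite ffunE; exact: h.
apply: fin_bigcap_measurable => [|j _]; first exact: finite_finset.
rewrite -[X in measurable X]setTI; apply: measurable_tnth => //.
exact: measurable_bucket.
Qed.

End quantization.

(** * The dual bound for the coded process *)

Section dual_bound.
Context {R : realType} {d : nat} {T : R}.
Hypothesis hT : 0 < T.
Context {dO} {Omega : measurableType dO} (P Q : probability Omega R).
Variable X : {mfun Omega >-> c0path d T}.
Hypothesis hX : gaussian_process P X.
Variable s2 : R.
Hypothesis s2_gt0 : 0 < s2.
Hypothesis var_le : forall t v, path_var P X t v <= s2 * dotv v v.
Variable H : R.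
Hypothesis entropy_le : forall f, bmf f ->
  \int[Q]_w f w <= H + ln (\int[P]_w expR (f w)).
Variable n : nat.
Context {m : nat} (tau : 'I_m -> horizon T).

Definition path_code w : @code d m n := quantize n (grid_vec X tau w).

Lemma measurable_path_code k : measurable (path_code @^-1` [set k]).
Proof.
rewrite -[X in measurable X]setTI.
have := measurable_grid_vec X tau measurableT (@measurable_quantize R d m n k); exact.
Qed.

(* [27/26] and [27] come from [(a + b)^2 <= 27/26 a^2 + 27 b^2]. *)
Definition dual_cost : R := 8 / 3 * (27 / 26) * s2 * H + 27 * (d%:R / n.+1%:R) ^+ 2.

Lemma transport_dual_bound (phi psi : @code d m n -> R) :
  (forall k l : @code d m n, phi k + psi l <= code_dist k l ^+ 2) ->
  \sum_k phi k * fine (Q (path_code @^-1` [set k])) +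
  \sum_l psi l * fine (P (path_code @^-1` [set l])) <= dual_cost.
Proof.
have key (a c A B lF lG h : R) : a * (A - c) <= h + lF -> a / 3 * B <= lG ->
  lF + 3 * lG <= 0 -> a * (A + B) <= h + a * c by lra.
move=> dual.
rewrite -(Rintegral_partition measurable_path_code Q) -(Rintegral_partition measurable_path_code P).
(* The Prekopa-Leindler rate [3 / (8 * s2)] is lowered by [26/27], since [code_dist ^+ 2] is only
   bounded by [27/26 r + e]; the constant [e] is moved into [phi]. *)
pose be := 3 / (8 * s2) * (26 / 27); pose e := 27 * (d%:R / n.+1%:R : R) ^+ 2.
have be0 : 0 < be by rewrite !mulr_gt0 ?invr_gt0 ?mulr_gt0.
pose F k := be * (phi k - e); pose G l := be / 3 * psi l.
have bF := bmf_partition measurable_path_code F.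
have bG := bmf_partition measurable_path_code G.
have [beF eF] := Rintegral_expR_gt0 P bF.
have [beG eG] := Rintegral_expR_gt0 P bG.
have PL : (\int[P]_w expR (F (path_code w))) * (\int[P]_w expR (G (path_code w))) ^+ 3 <= 1.
  have bq (f : @code d m n -> R) := bmf_partition (@measurable_quantize R d m n) f.
  have := grid_prekopa_leindler hX s2_gt0 var_le tau
    (bq (fun k => expR (F k))) (bq (fun k => expR (G k)))
    (fun z => expR_ge0 _) (fun z => expR_ge0 _).
  apply=> z z' r r0 hr.
  rewrite -expRM_natl -expRD ler_expR.
  have hd : code_dist (quantize n z) (quantize n z') <= Num.sqrt r + d%:R / n.+1%:R.
    apply: bigmax_le => [|i _]; first by rewrite addr_ge0 ?sqrtr_ge0 ?divr_ge0.
    apply: (le_trans (enorm_decode_lip _ _ _ _)); rewrite lerD2r.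
    by rewrite /enorm ler_sqrt.
  have hd2 : code_dist (quantize n z) (quantize n z') ^+ 2 <= 27 / 26 * r + e.
    apply: (@le_trans _ _ ((Num.sqrt r + d%:R / n.+1%:R) ^+ 2)).
      by apply: lerXn2r; rewrite ?nnegrE ?code_dist_ge0 ?(le_trans (code_dist_ge0 _ _ _) hd).
    rewrite /e -[r in leRHS](sqr_sqrtr r0).
    move: (Num.sqrt r) (d%:R / n.+1%:R) => a c.
    have := sqr_ge0 (a - 26 * c); rewrite sqrrB sqrrD; lra.
  have h := le_trans (dual (quantize n z) (quantize n z')) hd2.
  have -> : 3 / (8 * s2) * r = be * (27 / 26 * r).
    by rewrite /be; field; rewrite gt_eqF.
  rewrite /F /G; move: (phi _) (psi _) h => a c h.
  by have := ler_wpM2l (ltW be0) h; lra.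
have PLln : ln (\int[P]_w expR (F (path_code w))) + 3 * ln (\int[P]_w expR (G (path_code w))) <= 0.
  have := PL; rewrite -ler_ln ?posrE ?mulr_gt0 ?exprn_gt0//.
  by rewrite lnM ?posrE ?exprn_gt0// lnXn// ln1 mulr_natl.
have hF := entropy_le bF; have hG := Rintegral_le_ln P bG.
have bphi := bmf_partition measurable_path_code phi.
have bpsi := bmf_partition measurable_path_code psi.
have iF : \int[Q]_w F (path_code w) = be * (\int[Q]_w phi (path_code w) - e).
  rewrite -[e in RHS](Rintegral_prob_cst Q) -(RintegralB measurableT (bmf_integrable Q bphi)); last exact: finite_measure_integrable_cst.
  rewrite -RintegralZl//.
  by apply: (@bmf_integrable _ _ _ Q (fun w => phi (path_code w) - e)); apply: bmfD => //; exact: bmf_cst.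
have iG : \int[P]_w G (path_code w) = be / 3 * \int[P]_w psi (path_code w).
  by rewrite -(RintegralZl (be / 3) measurableT (bmf_integrable P bpsi)).
rewrite iF in hF; rewrite iG in hG.
rewrite -(ler_pM2l be0) /dual_cost -/e.
have -> : be * (8 / 3 * (27 / 26) * s2 * H + e) = H + be * e.
  by rewrite /be; field; rewrite gt_eqF.
exact: key hF hG PLln.
Qed.

End dual_bound.

(** * Quantization errors vanish in mean square *)

Section quantization_error.
Context {R : realType} {d : nat} {T : R}.
Hypothesis hT : 0 < T.
Context {dO} {Omega : measurableType dO} (P : probability Omega R).
Variable X : {mfun Omega >-> c0path d T}.
Hypothesis hX : gaussian_process P X.

Definition quant_err n w : R :=
  modulus n (X w) + d%:R * (Num.max (`|X w| - n.+1%:R) 0 + n.+1%:R^-1).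

Local Notation code_of n := (path_code X n (@grid _ _ hT n)).

Lemma quant_err_ge0 n w : 0 <= quant_err n w.
Proof.
apply: addr_ge0; first exact: modulus_ge0.
apply: mulr_ge0; first exact: ler0n.
apply: addr_ge0; last by rewrite invr_ge0.
by rewrite le_max lexx orbT.
Qed.

(** Each path at time [t] is compared with its decoded value at a grid time nearby: the modulus pays
    for the change of time, the clipping and rounding errors for the change of value. *)
Lemma path_dist_le n w w' : `|(X w : cpath d T) - (X w' : cpath d T)| <=
  code_dist (code_of n w) (code_of n w') + (quant_err n w + quant_err n w').
Proof.
apply: supnorm_le => [|t]; first by apply: addr_ge0; [exact: code_dist_ge0|apply: addr_ge0; exact: quant_err_ge0].
have [i hi] := grid_close hT n t.
have h v : enorm (X v t - decode (code_of n v) i) <= quant_err n v.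
  rewrite -[X v t](subrK (X v (grid hT i))) -addrA.
  apply: (le_trans (ler_enormD _ _)); rewrite lerD ?modulus_ub//.
  rewrite -[X v (grid hT i)](block_grid_vec X (@grid _ _ hT n)).
  apply: enorm_decode_close; rewrite block_grid_vec.
  exact: (supnorm_ub (X v : cpath d T)).
rewrite [X in enorm X](_ : _ = (decode (code_of n w) i - decode (code_of n w') i) +
  ((X w t - decode (code_of n w) i) +
   - (X w' t - decode (code_of n w') i))); last first.
  rewrite [LHS](_ : _ = X w t - X w' t)//.
  by apply/rowP => l; rewrite !row_subE !mxE; ring.
apply: (le_trans (ler_enormD _ _)); apply: lerD; first exact: le_bigmax.
by apply: (le_trans (ler_enormD _ _)); rewrite enormN lerD.
Qed.

Lemma measurable_quant_err n : measurable_fun setT (quant_err n).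
Proof.
apply: measurable_funD.
  by apply: (measurableT_comp (measurable_modulus hT n)); exact: measurable_funPT.
apply: measurable_funM; first exact: measurable_cst.
apply: measurable_funD; last exact: measurable_cst.
apply: measurable_maxr; last exact: measurable_cst.
by apply: measurable_funB; [exact: measurable_normX|exact: measurable_cst].
Qed.

Lemma quant_err_le n w : quant_err n w ^+ 2 <= 2 * (d%:R + 2) ^+ 2 * (`|X w| ^+ 2 + 1).
Proof.
have h : quant_err n w <= (d%:R + 2) * (`|X w| + 1).
  have h1 := modulus_le_supnorm hT n (X w).
  have h2 : Num.max (`|X w| - n.+1%:R) 0 + n.+1%:R^-1 <= `|X w| + 1.
    apply: lerD; first by rewrite ge_max normr_ge0 andbT lerBlDr lerDl.
    by rewrite invf_le1 ?ltr0n// ler1n.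
  have h3 := ler_wpM2l (ler0n R d) h2.
  rewrite /quant_err mulrDl; apply: (le_trans (lerD h1 h3)).
  by rewrite addrC lerD2l mulrDr lerDl.
have h2 : quant_err n w ^+ 2 <= ((d%:R + 2) * (`|X w| + 1)) ^+ 2.
  by apply: lerXn2r h; rewrite nnegrE ?quant_err_ge0// !(mulr_ge0, addr_ge0).
apply: (le_trans h2); rewrite exprMn.
have -> : 2 * (d%:R + 2) ^+ 2 * (`|X w| ^+ 2 + 1) = (d%:R + 2) ^+ 2 * (2 * (`|X w| ^+ 2 + 1)) by ring.
apply: ler_wpM2l; first exact: sqr_ge0.
have := sqr_ge0 (`|X w| - 1); rewrite sqrrB sqrrD; lra.
Qed.

Lemma cvg_quant_err w : quant_err n w @[n --> \oo] --> (0 : R).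
Proof.
have e : 0 + d%:R * (0 + 0) = 0 :> R by rewrite addr0 mulr0 addr0.
rewrite -[X in _ --> X]e.
apply: cvgD; first exact: cvg_modulus.
apply: cvgM; first exact: cvg_cst.
apply: cvgD; last exact: cvg_harmonic.
apply: cvg_near_cst; near=> n; rewrite max_r// subr_le0.
apply: (@le_trans _ _ n%:R); last by rewrite ler_nat.
near: n; exact: nbhs_infty_ger.
Unshelve. all: by end_near. Qed.

Section moments.
Variables (Q : probability Omega R) (H : R).
Hypothesis entropy_le : forall f, bmf f ->
  \int[Q]_w f w <= H + ln (\int[P]_w expR (f w)).

(** The entropy inequality is applied to [al] times the truncated squared excess, whose exponential
    integral under [P] is at most 8. This bounds its mean under [Q] by [H + ln 8], and monotone
    convergence removes the truncation. *)
Lemma integrable_normX_sqr : Q.-integrable setT (EFin \o (fun w => `|X w| ^+ 2)).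
Proof.
have [al al0 [M M0 hM]] := fernique_truncated hT hX.
have mX := measurable_normX X.
pose f w := al * excess M `|X w| ^+ 2.
pose F n w := al * Num.min (excess M `|X w| ^+ 2) n%:R.
have mexc : measurable_fun setT (fun w => excess M `|X w| ^+ 2).
  apply: measurable_funX; apply: measurable_maxr; last exact: measurable_cst.
  by apply: measurable_funB; [exact: mX|exact: measurable_cst].
have F0 n w : 0 <= F n w by rewrite mulr_ge0 ?(ltW al0)// le_min ler0n sqr_ge0.
have bF n : bmf (F n).
  split; last by exists (al * n%:R) => w; rewrite ger0_norm// ler_wpM2l ?(ltW al0)// ge_min lexx orbT.
  apply: measurable_funM; first exact: measurable_cst.
  by apply: measurable_minr; last exact: measurable_cst.
have mF n : measurable_fun setT (fun w => (F n w)%:E).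
  by apply/measurable_EFinP; exact: bmf_meas.
have QF n : (\int[Q]_w (F n w)%:E <= (H + ln 8)%:E)%E.
  rewrite -EFin_Rintegral; last exact: bmf_integrable.
  rewrite lee_fin (le_trans (entropy_le (bF n)))// lerD2l.
  have [_ eF] := Rintegral_expR_gt0 P (bF n).
  by rewrite ler_ln ?posrE//; exact: hM.
have c := @cvg_monotone_convergence _ _ _ Q setT measurableT (fun n w => (F n w)%:E) mF.
have {}c : (\int[Q]_w (F n w)%:E)%E @[n --> \oo] --> (\int[Q]_w (f w)%:E)%E.
  rewrite (_ : (fun w => (f w)%:E) = (fun w => limn (fun n => (F n w)%:E))); last first.
    apply/funext => w; apply/esym/cvg_lim => //.
    by apply: cvg_near_cst; near=> n; rewrite /F min_l//; near: n; exact: nbhs_infty_ger.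
  apply: c => [n w _|w _ a b ab]; rewrite lee_fin// ler_wpM2l ?(ltW al0)//.
  by rewrite le_min ge_min lexx/= ge_min ler_nat ab orbT.
have h : (\int[Q]_w (f w)%:E <= (H + ln 8)%:E)%E.
  rewrite -(cvg_lim _ c)//; apply: lime_le; first by apply/cvg_ex; eexists; exact: c.
  by apply: nearW => n; exact: QF.
have intf : Q.-integrable setT (EFin \o f).
  apply: ge0_integrable_R; last exact: le_lt_trans h (ltry _).
    by apply: measurable_funM; first exact: measurable_cst.
  by move=> w; rewrite mulr_ge0 ?sqr_ge0 ?ltW.
apply: (@integrable_Rdom _ _ _ Q _ (fun w => 2 / al * f w + 2 * M ^+ 2)).
- exact: measurable_funX.
- apply: integrable_RD; first exact: integrable_RZ.
  exact: finite_measure_integrable_cst.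
move=> w; rewrite ger0_norm ?sqr_ge0// /f mulrA divfK ?gt_eqF//.
have hx : `|X w| <= excess M `|X w| + M by rewrite -lerBlDr le_max lexx.
move: (excess _ _) hx => e; have : 0 <= `|X w| :> R by exact: normr_ge0.
move: (`|X w| : R) => x x0 hx.
apply: (@le_trans _ _ ((e + M) ^+ 2)); first by apply: (lerXn2r _ _ _ hx); rewrite nnegrE// (le_trans x0).
have := sqr_ge0 (e - M); rewrite sqrrB sqrrD; lra.
Unshelve. all: by end_near. Qed.

Lemma integrable_quant_err n : Q.-integrable setT (EFin \o (fun w => quant_err n w ^+ 2)).
Proof.
apply: (@integrable_Rdom _ _ _ Q _ (fun w => 2 * (d%:R + 2) ^+ 2 * (`|X w| ^+ 2 + 1))).
- by apply: measurable_funX; exact: measurable_quant_err.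
- apply: integrable_RZ; apply: integrable_RD; first exact: integrable_normX_sqr.
  exact: finite_measure_integrable_cst.
- by move=> w; rewrite ger0_norm ?sqr_ge0// quant_err_le.
Qed.

Lemma cvg_quant_err_sqr : \int[Q]_w (quant_err n w ^+ 2) @[n --> \oo] --> (0 : R).
Proof.
have [//|||||_ _ h] := @dominated_convergence _ _ _ Q setT measurableT
  (fun n => EFin \o (fun w => quant_err n w ^+ 2)) (cst 0%E)
  (EFin \o (fun w => 2 * (d%:R + 2) ^+ 2 * (`|X w| ^+ 2 + 1))).
- by move=> n; apply/measurable_EFinP; apply: measurable_funX; exact: measurable_quant_err.
- exact: measurable_cst.
- apply: aeW => w _; apply: cvg_EFin; first exact: nearW.
  rewrite -[X in _ --> X](mul0r (0 : R)).
  under eq_fun do rewrite /= expr2.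
  by apply: cvgM; exact: cvg_quant_err.
- apply: integrable_RZ; apply: integrable_RD; first exact: integrable_normX_sqr.
  exact: finite_measure_integrable_cst.
- by apply: aeW => w n _; rewrite lee_fin ger0_norm ?sqr_ge0// quant_err_le.
rewrite integral0 in h.
exact: (fine_cvg h).
Qed.

End moments.

End quantization_error.

(** * Transport inequality for the law of [Y] *)

Section measurable_unif_dist.
Context {R : realType} {d : nat} {T : R} {xi : 'rV[R]_d}.
Hypothesis hT : 0 < T.
Local Notation E := (cxipath T xi).

Lemma measurable_cxipath_coord (t : horizon T) i :
  measurable_fun setT (fun x : E => x t 0 i).
Proof.
pose g (x : cpath d T) : R := x t 0 i.
have cg : continuous g.
  move=> x; have FF : Filter (nbhs (x : cpath d T)) by exact: nbhs_filter.
  rewrite /continuous_at; apply/(@cvgrPdist_lt _ _ _ (nbhs (x : cpath d T)) FF) => e e0.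
  near=> y.
  apply: (@le_lt_trans _ _ `|x - y|).
    apply: le_trans (supnorm_ub (x - y) t); apply: le_trans (coord_le_enorm _ i).
    by rewrite [in leRHS](_ : (x - y) t = x t - y t)// !mxE.
  near: y; have := @nbhsx_ballx _ _ x e e0.
  by apply: filterS => y; rewrite -ball_normE.
have cf : continuous (fun x : E => g (x : cpath d T)).
  move=> x; apply: continuous_comp; last exact: cg.
  exact: (@initial_continuous _ _ (@set_val _ _)).
apply: (measurability _ (RGenOInfty.measurableE R)).
move=> _ [_ [q ->] <-]; rewrite setTI; apply: sub_sigma_algebra.
by move/continuousP: cf; apply; exact: interval_open.
Unshelve. all: by end_near. Qed.

Let grid_dist n (z : E * E) : R := grid_sup hT n ((z.1 : cpath d T) - (z.2 : cpath d T)).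

Let measurable_grid_dist n : measurable_fun setT (grid_dist n).
Proof.
apply: measurable_bigmax => i; apply: measurable_enorm => k.
under eq_fun do rewrite row_subE.
apply: measurable_funB.
  exact: (measurableT_comp (measurable_cxipath_coord (grid hT i) k) measurable_fst).
exact: (measurableT_comp (measurable_cxipath_coord (grid hT i) k) measurable_snd).
Qed.

(** Measurability is meant for the product of the Borel sigma-algebras: each [grid_dist] involves
    finitely many coordinates of the two factors, and the distance is their limit. *)
Lemma measurable_unif_dist : measurable_fun setT (fun z : E * E => unif_dist z.1 z.2).
Proof.
apply: (measurable_fun_cvg measurable_grid_dist) => z _.
exact: cvg_grid_sup.
Qed.

End measurable_unif_dist.

Lemma marginal_integral {d1 d2} {T1 : measurableType d1} {T2 : measurableType d2} {R : realType}
    (m : probability T1 R) (m' : probability T2 R) (g : T1 -> T2) (f : T2 -> \bar R) :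
  measurable_fun setT g -> (forall A, measurable A -> m (g @^-1` A) = m' A) ->
  measurable_fun setT f -> (forall x, 0 <= f x)%E ->
  (\int[m]_x f (g x) = \int[m']_y f y)%E.
Proof.
move=> mg gm mf f0.
pose G : {mfun T1 >-> T2} := HB.pack g (isMeasurableFun.Build _ _ _ _ _ mg).
transitivity (\int[distribution m G]_y f y)%E.
  by rewrite ge0_integral_distribution.
by apply: eq_measure_integral => A mA _; exact: gm.
Qed.

Section transport_bound.
Context {R : realType} {d : nat} {T : R}.
Hypothesis hT : 0 < T.
Context {xi : 'rV[R]_d} {b : 'rV[R]_d -> 'rV[R]_d}.
Hypothesis hb : continuous b.
Context {C1 C2 : R}.
Hypothesis hC : 0 <= C1 + C2.
Hypothesis hb1 : forall eta zeta : 'rV[R]_d,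
  dotv (b eta - b zeta) (eta - zeta) <= C1 * enorm (eta - zeta) ^+ 2.
Hypothesis hb2 : forall eta zeta : 'rV[R]_d, eta - zeta != 0 ->
  enorm (b eta - b zeta
         - (dotv (b eta - b zeta) (eta - zeta) / enorm (eta - zeta) ^+ 2)
             *: (eta - zeta)) <= C2 * enorm (eta - zeta).
Context {dO : measure_display} {Omega : measurableType dO} (P : probability Omega R).
Variable X : {mfun Omega >-> c0path d T}.
Hypothesis hX : gaussian_process P X.
Variable Y : {mfun Omega >-> cxipath T xi}.
Hypothesis hY : forall w : Omega, is_solution b (X w) (Y w).
Variables (s2 : R) (s2_gt0 : 0 < s2).
Hypothesis var_le : forall t v, path_var P X t v <= s2 * dotv v v.

Local Notation code_of n := (path_code X n (@grid _ _ hT n)).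

Let unif_dist_sqr_le n w w' : unif_dist (Y w) (Y w') ^+ 2 <=
  25 / 4 * expR (4 * T * (C1 + C2)) *
  (27 / 26 * code_dist (code_of n w) (code_of n w') ^+ 2 +
   (54 * quant_err X n w ^+ 2 + 54 * quant_err X n w' ^+ 2)).
Proof.
have h1 := solution_lipschitz hT hb hC hb1 hb2 (hY w) (hY w').
have h2 := path_dist_le hT X n w w'.
set L := expR _; have LE : L = expR (2 * T * (C1 + C2)) ^+ 2.
  by rewrite -expRM_natl /L; congr expR; ring.
apply: (@le_trans _ _ ((5 / 2 * expR (2 * T * (C1 + C2)) * `|X w - X w'|) ^+ 2)).
  by apply: lerXn2r h1; rewrite nnegrE ?normr_ge0// !mulr_ge0 ?expR_ge0.
rewrite exprMn [X in X * _]exprMn -LE -[(5 / 2) ^+ 2](_ : 25 / 4 = _); last by field.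
apply: ler_wpM2l; first by rewrite mulr_ge0 ?expR_ge0.
have {h2} : `|X w - X w'| <= code_dist (code_of n w) (code_of n w') +
  (quant_err X n w + quant_err X n w') by exact: h2.
have := quant_err_ge0 hT X n w; have := quant_err_ge0 hT X n w'.
have := code_dist_ge0 (code_of n w) (code_of n w') : 0 <= _ :> R.
have := normr_ge0 (X w - X w').
move: (`|X w - X w'| : R) (code_dist _ _) (quant_err _ _ _) (quant_err _ _ _).
move=> x c e e' x0 c0 e0 e'0 h.
apply: (@le_trans _ _ ((c + (e + e')) ^+ 2)); first by apply: lerXn2r h; rewrite nnegrE ?addr_ge0.
(* [(c + e + e')^2 <= 27/26 c^2 + 27 (e + e')^2] and [(e + e')^2 <= 2 e^2 + 2 e'^2], whence 54. *)
have := sqr_ge0 (c - 26 * (e + e')); have := sqr_ge0 (e - e').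
rewrite !sqrrB !sqrrD; lra.
Qed.

Variables (nu : probability (cxipath T xi) R) (Q : probability Omega R) (H : R).
Hypothesis nuE : forall A, measurable A -> nu A = Q (Y @^-1` A).
Hypothesis H0 : 0 <= H.
Hypothesis entropy_le : forall f, bmf f ->
  \int[Q]_w f w <= H + ln (\int[P]_w expR (f w)).

Let L2 := 25 / 4 * expR (4 * T * (C1 + C2)).

Let remainder n : R := L2 * (27 / 26 * (27 * (d%:R / n.+1%:R) ^+ 2) +
  54 * (\int[Q]_w (quant_err X n w ^+ 2) + \int[P]_w (quant_err X n w ^+ 2))).

(** The entropy bound of [P] relative to itself, with entropy 0, makes the moment estimates stated
    for [Q] available for [P]. *)
Let entropy_self f : bmf f -> \int[P]_w f w <= 0 + ln (\int[P]_w expR (f w)).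
Proof. by rewrite add0r; exact: Rintegral_le_ln. Qed.

Let cvg_remainder : remainder n @[n --> \oo] --> (0 : R).
Proof.
have e : L2 * (27 / 26 * (27 * (d%:R * 0 * (d%:R * 0))) + 54 * (0 + 0)) = 0.
  by ring.
rewrite -[X in _ --> X]e; apply: cvgM; first exact: cvg_cst.
apply: cvgD.
  apply: cvgM; first exact: cvg_cst.
  apply: cvgM; first exact: cvg_cst.
  under eq_fun do rewrite expr2.
  by apply: cvgM; (apply: cvgM; [exact: cvg_cst|exact: cvg_harmonic]).
apply: cvgM; first exact: cvg_cst.
apply: cvgD; first exact: (cvg_quant_err_sqr hT hX entropy_le).
exact: (cvg_quant_err_sqr hT hX entropy_self).
Qed.

(** The plan on codes is spread to a coupling of [Q] and [P] on [Omega * Omega], whose image under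
    [(Y, Y)] couples [nu] with the law of [Y]. The cost splits into the code cost, bounded by
    [dual_cost], and errors depending on one coordinate each, which see only the marginals. *)
Let transport_cost_le n : (transport_cost nu (distribution P Y) <=
  (L2 * (27 / 26 * (8 / 3 * (27 / 26) * s2 * H)) + remainder n)%:E)%E.
Proof.
pose rho := code_of n.
have mrho k : measurable (rho @^-1` [set k]) by exact: measurable_path_code.
have [k [k0 kp kq kc]] := finite_duality (fun i => fine_ge0 (measure_ge0 Q (rho @^-1` [set i])))
  (fun i => fine_ge0 (measure_ge0 P (rho @^-1` [set i])))
  (sum_partition mrho Q) (sum_partition mrho P)
  (transport_dual_bound hX s2_gt0 var_le entropy_le (n := n) (@grid _ _ hT n)).
have [pi0 [pi0Q pi0P pi0c]] := glued_coupling mrho k0 kp kq.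
pose YY (z : Omega * Omega) := (Y z.1, Y z.2).
have mYY : measurable_fun setT YY.
  apply: measurable_fun_pair.
    exact: (measurableT_comp (@measurable_funPT _ _ _ _ Y) measurable_fst).
  exact: (measurableT_comp (@measurable_funPT _ _ _ _ Y) measurable_snd).
pose mY : {mfun (Omega * Omega)%type >-> (cxipath T xi * cxipath T xi)%type} :=
  HB.pack YY (isMeasurableFun.Build _ _ _ _ _ mYY).
pose pi : probability (cxipath T xi * cxipath T xi)%type R := distribution pi0 mY.
have mYpre A : measurable A -> measurable (Y @^-1` A).
  by move=> mA; rewrite -[X in measurable X]setTI; exact: (@measurable_funPT _ _ _ _ Y).
have cpi : coupling nu (distribution P Y) pi.
  split=> A mA.
    rewrite nuE// -(pi0Q _ (mYpre _ mA)).
    by congr (pi0 _); apply/seteqP; split=> z.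
  rewrite -[RHS]/(P (Y @^-1` A)) -(pi0P _ (mYpre _ mA)).
  by congr (pi0 _); apply/seteqP; split=> z.
apply: (@le_trans _ _ (\int[pi]_z (unif_dist z.1 z.2 ^+ 2)%:E)%E).
  by apply: ereal_inf_lbound; exists pi.
have mu2 : measurable_fun setT (fun z : cxipath T xi * cxipath T xi => (unif_dist z.1 z.2 ^+ 2)%:E).
  by apply/measurable_EFinP; apply: measurable_funX; exact: measurable_unif_dist.
rewrite (ge0_integral_distribution mY mu2); last by move=> z; rewrite lee_fin sqr_ge0.
have mu3 := measurableT_comp mu2 mYY.
pose c z : R := code_dist (rho z.1) (rho z.2) ^+ 2.
pose e w : R := quant_err X n w ^+ 2.
have mc : measurable_fun setT (fun z => (c z)%:E).
  apply/measurable_EFinP.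
  exact: (bmf_meas (bmf_partition (measurable_partition_prod mrho) (fun kl => code_dist kl.1 kl.2 ^+ 2))).
have me : measurable_fun setT (fun w => (e w)%:E).
  by apply/measurable_EFinP; apply: measurable_funX; exact: measurable_quant_err.
have me1 : measurable_fun setT (fun z : Omega * Omega => (e z.1)%:E).
  exact: (measurableT_comp me measurable_fst).
have me2 : measurable_fun setT (fun z : Omega * Omega => (e z.2)%:E).
  exact: (measurableT_comp me measurable_snd).
have L20 : 0 <= L2 by rewrite mulr_ge0 ?expR_ge0.
have c0 z : (0 <= (c z)%:E)%E by rewrite lee_fin sqr_ge0.
have e0 w : (0 <= (e w)%:E)%E by rewrite lee_fin sqr_ge0.
pose F1 z := ((L2 * (27 / 26))%:E * (c z)%:E)%E.
pose F2 (z : Omega * Omega) := ((L2 * 54)%:E * (e z.1)%:E)%E.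
pose F3 (z : Omega * Omega) := ((L2 * 54)%:E * (e z.2)%:E)%E.
have mF1 : measurable_fun setT F1 by exact: measurable_funeM.
have mF2 : measurable_fun setT F2 by exact: measurable_funeM.
have mF3 : measurable_fun setT F3 by exact: measurable_funeM.
have F10 z : (0 <= F1 z)%E by rewrite mule_ge0// lee_fin mulr_ge0.
have F20 z : (0 <= F2 z)%E by rewrite mule_ge0// lee_fin mulr_ge0.
have F30 z : (0 <= F3 z)%E by rewrite mule_ge0// lee_fin mulr_ge0.
have mF23 : measurable_fun setT (fun z => F2 z + F3 z)%E by exact: emeasurable_funD.
have mF123 : measurable_fun setT (fun z => F1 z + (F2 z + F3 z))%E by exact: emeasurable_funD.
apply: (@le_trans _ _ (\int[pi0]_z (F1 z + (F2 z + F3 z)))%E).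
  apply: (@ge0_le_integral _ _ _ pi0 setT measurableT _ _ _ mu3 mF123) => [z _|z _].
    by rewrite lee_fin sqr_ge0.
  rewrite /F1 /F2 /F3 -!EFinM -!EFinD lee_fin; apply: (le_trans (unif_dist_sqr_le n z.1 z.2)).
  by rewrite -/L2 /c /e /rho; lra.
rewrite (ge0_integralD pi0 measurableT (fun z _ => F10 z) mF1); [|by move=> z _; rewrite adde_ge0|exact: mF23].
rewrite (ge0_integralD pi0 measurableT (fun z _ => F20 z) mF2 (fun z _ => F30 z) mF3).
rewrite (ge0_integralZl pi0 measurableT mc (fun z _ => c0 z)); last by rewrite lee_fin mulr_ge0.
rewrite (ge0_integralZl pi0 measurableT me1 (fun z _ => e0 z.1)); last by rewrite lee_fin mulr_ge0.
rewrite (ge0_integralZl pi0 measurableT me2 (fun z _ => e0 z.2)); last by rewrite lee_fin mulr_ge0.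
rewrite (@marginal_integral _ _ _ _ _ pi0 Q fst _ measurable_fst _ me e0); last first.
  move=> A mA; rewrite -(pi0Q _ mA); congr (pi0 _).
  by apply/seteqP; split=> z //= [].
rewrite (@marginal_integral _ _ _ _ _ pi0 P snd _ measurable_snd _ me e0); last first.
  move=> A mA; rewrite -(pi0P _ mA); congr (pi0 _).
  by apply/seteqP; split=> z //= [].
rewrite -(EFin_Rintegral (integrable_quant_err hT hX entropy_le n)).
rewrite -(EFin_Rintegral (integrable_quant_err hT hX entropy_self n)).
have hc : (\int[pi0]_z (c z)%:E <= (@dual_cost R d s2 H n)%:E)%E.
  apply: (le_trans (pi0c (fun i j => code_dist i j ^+ 2) _)) => [i j|]; first exact: sqr_ge0.
  by rewrite lee_fin.
apply: (@le_trans _ _ ((L2 * (27 / 26))%:E * (@dual_cost R d s2 H n)%:E +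
  ((L2 * 54)%:E * (\int[Q]_w e w)%:E + (L2 * 54)%:E * (\int[P]_w e w)%:E))%E).
  by rewrite leeD2r// lee_wpmul2l// lee_fin mulr_ge0.
rewrite -!EFinM -!EFinD lee_fin /dual_cost /remainder /e le_eqVlt; apply/orP; left; apply/eqP.
by ring.
Qed.

Lemma transport_bound : (transport_cost nu (distribution P Y) <=
  (18 * s2 * expR (4 * T * (C1 + C2)) * H)%:E)%E.
Proof.
apply/lee_addgt0Pr => eps eps0.
have [n hn] : exists n, remainder n < eps.
  have : \forall n \near \oo, remainder n < eps by apply: (cvgr_lt 0 cvg_remainder).
  by move=> [n _ /(_ n (leqnn n))]; exists n.
apply: (le_trans (transport_cost_le n)); rewrite -EFinD lee_fin lerD ?(ltW hn)//.
rewrite /L2; have : 0 <= expR (4 * T * (C1 + C2)) * s2 * H.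
  by rewrite !mulr_ge0 ?expR_ge0 ?(ltW s2_gt0).
(* One factor [27/26] comes from the dual bound and one from the pathwise estimate;
   [50/3 * (27/26)^2] is about 17.97. *)
move: (expR _) => E0 h; have : 0 <= (18 - 50 / 3 * (27 / 26) ^+ 2) * (E0 * s2 * H).
  by rewrite mulr_ge0//; lra.
lra.
Qed.

End transport_bound.

(** * The weak variance and the conclusion *)

Section weak_variance.
Context {R : realType} {d : nat} {T : R}.
Hypothesis hT : 0 < T.
Context {dO : measure_display} {Omega : measurableType dO} (P : probability Omega R).
Variable X : {mfun Omega >-> c0path d T}.
Hypothesis hX : gaussian_process P X.
Local Notation C0 := (c0path d T).

(** Evaluation at [t] in the direction of [v], normalised to lie in the dual unit ball; for [v = 0]
    the convention [0^-1 = 0] makes it vanish. *)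
Let coord_form (t : horizon T) (v : 'rV[R]_d) (x : C0) : R^o :=
  (enorm v)^-1 * dotv v (x t).

Let coord_form_linear t v : linear (coord_form t v).
Proof.
move=> a x y; rewrite /coord_form.
rewrite [(c0path_val (a *: x + y)) t](_ : _ = a *: x t + y t)//.
by rewrite dotvDr dotvZr mulrDr mulrCA.
Qed.

Let coord_form_le t v x : `|coord_form t v x| <= `|x|.
Proof.
have h : `|dotv v (x t)| <= enorm v * `|x|.
  have h1 : enorm (x t) <= `|x| by exact: supnorm_ub.
  by apply: le_trans (normr_dotv_le _ _) _; rewrite ler_wpM2l ?enorm_ge0.
rewrite /coord_form normrM ger0_norm ?invr_ge0 ?enorm_ge0//.
have [->|v0] := eqVneq (enorm v) 0; first by rewrite invr0 mul0r.
by rewrite ler_pdivrMl// lt_neqAle eq_sym v0 enorm_ge0.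
Qed.

Let coord_form_lip t v x y : coord_form t v x - coord_form t v y <= 1 * `|x - y|.
Proof.
rewrite mul1r; apply: le_trans (coord_form_le t v (x - y)); apply: le_trans (ler_norm _).
rewrite /coord_form [(c0path_val (x - y)) t](_ : _ = x t - y t)//.
by rewrite dotvDr dotvNr mulrBr.
Qed.

Lemma weak_variance_ge0 (gamma : probability C0 R) : (0 <= weak_variance gamma)%E.
Proof.
pose l : {linear C0 -> R^o} := [the {linear C0 -> R^o} of \0%R].
apply: (@le_trans _ _ (\int[gamma]_x ((l x) ^+ 2)%:E)%E).
  by apply: integral_ge0 => x _; rewrite lee_fin sqr_ge0.
apply: ereal_sup_ubound; exists l => //; split; first exact: cst_continuous.
by move=> x; rewrite normr0.
Qed.

(** A variance is at most the second moment, which is what the weak variance controls; this covers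
    processes with nonzero mean. *)
Lemma path_var_le_weak_variance t v :
  ((path_var P X t v)%:E <= weak_variance (distribution P X) * (dotv v v)%:E)%E.
Proof.
have [m [s hs]] := gaussian_marginal hX t v.
pose U w := dotv v (X w t).
have mU : measurable_fun setT U by exact: measurable_marginal.
have iU := integrable_gaussian_sqr mU hs.
apply: (@le_trans _ _ (\int[P]_w (U w ^+ 2))%:E).
  by rewrite lee_fin /path_var lerBlDr lerDl sqr_ge0.
have [v0|v0] := eqVneq (enorm v) 0.
  have vz := enorm_eq0 v0.
  have U0 w : U w = 0 by rewrite /U vz -(scale0r (0 : 'rV[R]_d)) dotvZl mul0r.
  under eq_Rintegral do rewrite U0 expr0n/=.
  by rewrite Rintegral_prob_cst -sqr_enorm v0 expr0n/= mule0.
have v00 : 0 < enorm v by rewrite lt_neqAle eq_sym v0 enorm_ge0.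
pose l : {linear C0 -> R^o} := HB.pack (coord_form t v)
  (GRing.isLinear.Build _ _ _ _ (coord_form t v) (coord_form_linear t v)).
have cl : continuous l.
  exact: (@lipschitz_continuous R d T (coord_form t v) 1 (coord_form_lip t v)).
have ub : (\int[distribution P X]_x ((l x) ^+ 2)%:E <= weak_variance (distribution P X))%E.
  by apply: ereal_sup_ubound; exists l => //; split=> // x; exact: coord_form_le.
have ml : measurable_fun setT (fun x : C0 => ((l x) ^+ 2)%:E).
  apply/measurable_EFinP; apply: measurable_funX.
  exact: (@lipschitz_measurable R d T (coord_form t v) 1 (coord_form_lip t v)).
rewrite (ge0_integral_distribution X ml) in ub; last by move=> x; rewrite lee_fin sqr_ge0.
have e : (\int[P]_w (U w ^+ 2))%:E =
    ((\int[P]_w ((fun x : C0 => ((l x) ^+ 2)%:E) \o X) w) * (dotv v v)%:E)%E.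
  rewrite EFin_Rintegral// muleC -(ge0_integralZl P measurableT).
  - apply: eq_integral => w _; rewrite /= -EFinM; congr EFin.
    rewrite /l/= /coord_form exprMn -sqr_enorm mulrA -exprMn mulfV// expr1n mul1r//.
  - by apply: (measurableT_comp ml); exact: measurable_funPT.
  - by move=> w _; rewrite lee_fin sqr_ge0.
  - by rewrite lee_fin dotvv_ge0.
by rewrite e lee_wpmul2r// lee_fin dotvv_ge0.
Qed.

End weak_variance.
Theorem theorem2p6 (R : realType) (d : nat) (T : R) (hT : 0 < T)
  (xi : 'rV[R]_d) (b : 'rV[R]_d -> 'rV[R]_d) (hb : continuous b)
  (C1 C2 : R) (hC : 0 <= C1 + C2)
  (hb1 : forall eta zeta : 'rV[R]_d,
     dotv (b eta - b zeta) (eta - zeta) <= C1 * enorm (eta - zeta) ^+ 2)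
  (hb2 : forall eta zeta : 'rV[R]_d, eta - zeta != 0 ->
     enorm (b eta - b zeta
            - (dotv (b eta - b zeta) (eta - zeta) / enorm (eta - zeta) ^+ 2)
                *: (eta - zeta))
       <= C2 * enorm (eta - zeta))
  (dO : measure_display) (Omega : measurableType dO) (P : probability Omega R)
  (X : {mfun Omega >-> c0path d T}) (hX : gaussian_process P X)
  (Y : {mfun Omega >-> cxipath T xi})
  (hY : forall w : Omega, is_solution b (X w) (Y w))
  (nu : probability (cxipath T xi) R) :
  (relative_entropy nu (distribution P Y) < +oo)%E ->
  (transport_cost nu (distribution P Y)
     <= 18%:E * weak_variance (distribution P X)
        * (expR (4 * T * (C1 + C2)))%:E
        * relative_entropy nu (distribution P Y))%E.

Proof.
move=> /[dup] REfin /(entropy_tilt (Y := Y))[Q [H [nuE REH entropy_le]]].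
have H0 : 0 <= H.
  have := entropy_le _ (bmf_cst 0); rewrite /= expR0 !Rintegral_prob_cst ln1 addr0; exact.
have bound s2 (s20 : 0 < s2) (hv : forall t v, path_var P X t v <= s2 * dotv v v) :=
  transport_bound hT hb hC hb1 hb2 hX hY s20 hv nuE H0 entropy_le.
have vle := path_var_le_weak_variance hX.
have := weak_variance_ge0 (distribution P X).
rewrite REH; case: (weak_variance _) vle => [s||] vle W0 //; last first.
  (* With infinite weak variance the right-hand side is [+oo] unless [H = 0]. Then [+oo * 0 = 0],
     and the cost is shown to be at most 0 by means of some finite bound on the one-time
     variances. *)
  have [Hz|Hn0] := eqVneq H 0.
    have [s2 s20 hv] := path_var_bound hX.
    by have := bound s2 s20 hv; rewrite Hz mulr0 mule0.
  rewrite gt0_muley ?lte_fin// gt0_mulye ?lte_fin ?expR_gt0// gt0_mulye ?leey//.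
  by rewrite lte_fin lt_neqAle eq_sym Hn0.
rewrite lee_fin in W0; rewrite -!EFinM.
apply/lee_addgt0Pr => eps eps0; set E0 := expR _.
have E0H : 0 <= 18 * E0 * H by rewrite !mulr_ge0 ?expR_ge0.
have c0 : 0 < 18 * E0 * H + 1 by rewrite ltr_wpDl.
(* [s] may be 0 whereas the bound requires a positive variance; the increment contributes at most
   [eps] to the right-hand side. *)
pose s2 := s + eps / (18 * E0 * H + 1).
have d0 : 0 < eps / (18 * E0 * H + 1) by rewrite divr_gt0.
have s20 : 0 < s2 by rewrite ltr_wpDl.
have hv t v : path_var P X t v <= s2 * dotv v v.
  rewrite -lee_fin; apply: (le_trans (vle t v)); rewrite -EFinM lee_fin.
  by rewrite ler_wpM2r ?dotvv_ge0// lerDl ltW.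
apply: (le_trans (bound s2 s20 hv)); rewrite -EFinD lee_fin -/E0 /s2.
have -> : 18 * (s + eps / (18 * E0 * H + 1)) * E0 * H =
  18 * s * E0 * H + eps / (18 * E0 * H + 1) * (18 * E0 * H) by ring.
by rewrite lerD2l mulrAC ler_pdivrMr// ler_wpM2l ?(ltW eps0)// lerDl.
Qed.
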